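(* Let $M$ be a (compact) Einstein cone-manifold of dimension $n\ge3$ with negative Ricci curvature. Then there is a direct sum decomposition $$L^2(S^2M)=\ker\beta_{max}\oplus\operatorname{Im}\delta^*_{min}.$$
   Context: Cone-manifold: $M$ is a compact manifold of dimension $n\ge3$, $\Sigma=\coprod_{i=1}^p\Sigma_i$ a closed embedded submanifold of codimension $2$ with components $\Sigma_i$, and $\alpha_1,\dots,\alpha_p>0$ the cone angles; $M\setminus\Sigma$ carries an incomplete Riemannian metric $g$, each $\Sigma_i$ a Riemannian metric $g_i$, and every point of $\Sigma_i$ has a neighbourhood diffeomorphic to $D^2\times U$ ($U\subset\Sigma_i$ open) in which, in cylindrical coordinates, $g=dr^2+(\frac{\alpha_i}{2\pi})^2r^2d\theta^2+g_i+q$, where $q$ is a symmetric $2$-tensor with $g(q,q)=o(r^2)$ and $g(\nabla q,\nabla q)=o(1)$ as $r\to0$. It is Einstein with negative Ricci curvature if $ric(g)=c\,g$ on $M\setminus\Sigma$ with a constant $c<0$. $S^2M$ is the bundle of symmetric $2$-tensors over $M\setminus\Sigma$; $L^2$ spaces are with respect to $g$. For a $1$-form $\eta$, $\delta^*\eta$ is the symmetric part of $\nabla\eta$. For a symmetric $2$-tensor $h$, $\delta h=\nabla^*h$ (formal adjoint of $\delta^*$), $\delta h(x)=-\sum_i(\nabla_{e_i}h)(e_i,x)$, and $\beta h=\delta h+\frac12d\operatorname{tr}_gh$. For a differential operator $A$ between sections of metric bundles over $M\setminus\Sigma$ with formal adjoint $A^t$: $A_{min}$ is the closure in $L^2$ of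 $A$ on $C^\infty$ sections with compact support in $M\setminus\Sigma$; $A_{max}$ is the Hilbert-space adjoint of $A^t|_{C_0^\infty}$, i.e. $u\in D(A_{max})$ iff $u\in L^2$ and $Au$ (in the distributional sense) is in $L^2$. *)

(* Defs.v *)
From HB Require Import structures.
From mathcomp Require Import all_boot all_order all_algebra.
From mathcomp Require Import all_classical all_reals all_analysis.

Set Implicit Arguments.
Unset Strict Implicit.
Unset Printing Implicit Defensive.
Import Order.TTheory GRing.Theory Num.Theory.
Import numFieldNormedType.Exports.
Local Open Scope classical_set_scope.
Local Open Scope ring_scope.

Definition pd (R : realType) (n : nat) (i : 'I_n) (f : 'rV[R]_n -> R)
  : 'rV[R]_n -> R := fun x => 'D_(delta_mx 0 i) f x.

Fixpoint Ck (R : realType) (n k : nat) (W : set 'rV[R]_n) (f : 'rV[R]_n -> R)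
  : Prop :=
  match k with
  | 0 => forall x, W x -> {for x, continuous f}
  | k'.+1 => (forall x i, W x -> derivable f x (delta_mx 0 i)) /\
             (forall i, Ck k' W (pd i f))
  end.

Definition smooth_on (R : realType) (n : nat) (W : set 'rV[R]_n)
    (f : 'rV[R]_n -> R) : Prop :=
  forall k, Ck k W f.

(* The Lebesgue integral over R^n of a nonnegative Borel function, as an
   iterated one-dimensional Lebesgue integral (Tonelli). *)
Fixpoint integral_Rn (R : realType) (n : nat)
  : ('rV[R]_n -> \bar R) -> \bar R :=
  match n with
  | 0 => fun f => f 0
  | n'.+1 => fun f =>
      (\int[lebesgue_measure]_(t in [set: R])
         integral_Rn (fun v : 'rV[R]_n' => f (row_mx (const_mx t : 'rV_1) v)))%E
  end.

(* In this section a metric, a 1-form and a 2-tensor on an open subset of R^n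
   are given by their components [G], [eta], [h] in the standard coordinates. *)

Section Coordinates.
Variables (R : realType) (n : nat).
Local Notation V := 'rV[R]_n.
Implicit Types (G h : V -> 'M[R]_n) (eta : V -> 'rV[R]_n) (x : V).

(* [christoffel G k i j] is Gamma^k_ij. *)
Definition christoffel G (k i j : 'I_n) : V -> R := fun x =>
  2^-1 * \sum_l invmx (G x) k l *
    (pd i (fun y => G y j l) x + pd j (fun y => G y i l) x
     - pd l (fun y => G y i j) x).

Definition ricci_coord G x : 'M[R]_n := \matrix_(j, k)
  \sum_i (pd i (christoffel G i j k) x - pd j (christoffel G i i k) x
    + \sum_p (christoffel G i i p x * christoffel G p j k x
              - christoffel G i j p x * christoffel G p i k x)).

(* Covariant derivatives; the index [i] is the direction of derivation. *)
Definition nabla1 G eta x (i j : 'I_n) : R :=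
  pd i (fun y => eta y 0 j) x - \sum_p christoffel G p i j x * eta x 0 p.

Definition nabla2 G h x (i j k : 'I_n) : R :=
  pd i (fun y => h y j k) x
  - \sum_p (christoffel G p i j x * h x p k + christoffel G p i k x * h x j p).

Definition delta_star_coord G eta x : 'M[R]_n :=
  \matrix_(i, j) (2^-1 * (nabla1 G eta x i j + nabla1 G eta x j i)).

Definition delta_coord G h x : 'rV[R]_n :=
  \row_k - (\sum_i \sum_j invmx (G x) i j * nabla2 G h x i j k).

Definition trace_coord G h x : R := \tr (invmx (G x) *m h x).

Definition beta_coord G h x : 'rV[R]_n :=
  \row_k (delta_coord G h x 0 k + 2^-1 * pd k (trace_coord G h) x).

End Coordinates.

(* Inner products induced by a positive definite matrix [G] on covectors,
   covariant 2-tensors, and covariant 3-tensors. *)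
Definition inner1 (R : realType) (n : nat) (G : 'M[R]_n) (a b : 'rV[R]_n) : R :=
  \sum_i \sum_j invmx G i j * a 0 i * b 0 j.

Definition inner2 (R : realType) (n : nat) (G a b : 'M[R]_n) : R :=
  \sum_i \sum_j \sum_k \sum_l
    invmx G i k * invmx G j l * a i j * b k l.

Definition inner3 (R : realType) (n : nat) (G : 'M[R]_n)
    (a b : 'I_n -> 'I_n -> 'I_n -> R) : R :=
  \sum_i \sum_j \sum_k \sum_i' \sum_j' \sum_k'
    invmx G i i' * invmx G j j' * invmx G k k' * a i j k * b i' j' k'.

Definition posdef (R : realType) (n : nat) (A : 'M[R]_n) : Prop :=
  A^T = A /\ forall v : 'rV[R]_n, v != 0 -> 0 < (v *m A *m v^T) 0 0.

Record chart (R : realType) (n : nat) (M : ptopologicalType) := Chart {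
  cdom : set M;
  cmap :> M -> 'rV[R]_n;
  cinv : 'rV[R]_n -> M }.

Section Manifolds.
Variables (R : realType) (n : nat) (M : ptopologicalType).
Local Notation V := 'rV[R]_n.
Local Notation chart := (chart R n M).
Implicit Types (c d : chart).

Record is_chart c : Prop := IsChart {
  chart_open : open (cdom c);
  chart_open_image : open (c @` cdom c);
  chart_cancel : forall x, cdom c x -> cinv c (c x) = x;
  chart_continuous : forall x, cdom c x -> {for x, continuous c};
  chart_inv_continuous :
    forall y, (c @` cdom c) y -> {for y, continuous (cinv c)} }.

Definition smooth_transition c d : Prop :=
  forall i, smooth_on (c @` (cdom c `&` cdom d)) (fun y => d (cinv c y) 0 i).

Definition compatible c d : Prop :=
  smooth_transition c d /\ smooth_transition d c.

(* A smooth structure without boundary. The chosen chart [chart_at x] around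
   [x] identifies the tangent space at [x] with R^n; sections of tensor bundles
   are accordingly plain functions on [M] with values in row vectors or
   matrices. *)
Record smooth_manifold := SmoothManifold {
  atlas : set chart;
  chart_at : M -> chart;
  atlas_chart : forall c, atlas c -> is_chart c;
  atlas_compatible : forall c d, atlas c -> atlas d -> compatible c d;
  chart_at_atlas : forall x, atlas (chart_at x);
  chart_at_dom : forall x, cdom (chart_at x) x;
  manifold_hausdorff : hausdorff_space M }.

Variable X : smooth_manifold.

(* Membership in the maximal atlas. *)
Definition smooth_chart c : Prop :=
  is_chart c /\ forall d, atlas X d -> compatible c d.

(* [frame c y] expresses the coordinate vectors of [c] at the point of
   coordinates [y] in the identification of its tangent space with R^n. *)
Definition frame c (y : V) : 'M[R]_n :=
  jacobian (fun z => chart_at X (cinv c y) (cinv c z)) y.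

(* Components in the chart [c], as functions of the coordinates, of a 1-form
   and of a covariant 2-tensor. *)
Definition local1 c (eta : M -> 'rV[R]_n) : V -> 'rV[R]_n :=
  fun y => eta (cinv c y) *m (frame c y)^T.

Definition local2 c (h : M -> 'M[R]_n) : V -> 'M[R]_n :=
  fun y => frame c y *m h (cinv c y) *m (frame c y)^T.

Section Regular.
(* [Z] is the closed set outside of which the tensor fields live. *)
Variable Z : set M.

Definition smooth1 (eta : M -> 'rV[R]_n) : Prop :=
  forall c, atlas X c -> forall i,
    smooth_on (c @` (cdom c `\` Z)) (fun y => local1 c eta y 0 i).

Definition smooth2 (h : M -> 'M[R]_n) : Prop :=
  forall c, atlas X c -> forall i j,
    smooth_on (c @` (cdom c `\` Z)) (fun y => local2 c h y i j).

Definition riemannian_metric (g : M -> 'M[R]_n) : Prop :=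
  smooth2 g /\ forall x, ~ Z x -> posdef (g x).

Definition compactly_supported (W : zmodType) (s : M -> W) : Prop :=
  exists K : set M,
    [/\ compact K, K `<=` ~` Z & forall x, ~ K x -> s x = 0].

Variable g : M -> 'M[R]_n.

Definition ricci (x : M) : 'M[R]_n :=
  let c := chart_at X x in ricci_coord (local2 c g) (c x).

Definition einstein (k : R) : Prop := forall x, ~ Z x -> ricci x = k *: g x.

Definition delta_star (eta : M -> 'rV[R]_n) (x : M) : 'M[R]_n :=
  let c := chart_at X x in
  delta_star_coord (local2 c g) (local1 c eta) (c x).

Definition beta (h : M -> 'M[R]_n) (x : M) : 'rV[R]_n :=
  let c := chart_at X x in beta_coord (local2 c g) (local2 c h) (c x).

End Regular.
End Manifolds.

Notation borel M := (g_sigma_algebraType (@open M)).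

(* The Riemannian volume measure of [g] outside [Z]: in a chart it is
   [sqrt (det g)] times Lebesgue measure. This determines [mu] on the Borel
   subsets of the complement of [Z], the only place where it is used. *)
Definition riemannian_volume (R : realType) (n : nat) (M : ptopologicalType)
    (X : smooth_manifold R n M) (Z : set M) (g : M -> 'M[R]_n)
    (mu : {measure set (borel M) -> \bar R}) : Prop :=
  forall c, atlas X c -> forall A : set (borel M),
    measurable A -> A `<=` cdom c `\` Z ->
    mu A = integral_Rn (fun y =>
      (\1_(c @` A) y * Num.sqrt (\det (local2 X c g y)))%:E).

Record metric_bundle (R : realType) (M : Type) := MetricBundle {
  fibre : lmodType R;
  fibre_inner : M -> fibre -> fibre -> R;
  measurable_section : set (M -> fibre);
  test_section : set (M -> fibre) }.

Section Bundles.
Variables (R : realType) (n : nat) (M : ptopologicalType).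
Variables (X : smooth_manifold R n M) (Z : set M) (g : M -> 'M[R]_n).

Definition one_forms : metric_bundle R M :=
  {| fibre := 'rV[R]_n;
     fibre_inner := fun x => inner1 (g x);
     measurable_section := [set eta | forall c, atlas X c -> forall i,
       measurable_fun (cdom c `\` Z : set (borel M))
         (fun x : borel M => local1 X c eta (c x) 0 i)];
     test_section := [set eta | smooth1 X Z eta /\ compactly_supported Z eta] |}.

Definition sym2_tensors : metric_bundle R M :=
  {| fibre := 'M[R]_n;
     fibre_inner := fun x => inner2 (g x);
     measurable_section := [set h |
       (forall x, ~ Z x -> (h x)^T = h x) /\
       forall c, atlas X c -> forall i j,
         measurable_fun (cdom c `\` Z : set (borel M))
           (fun x : borel M => local2 X c h (c x) i j)];
     test_section := [set h |
       [/\ forall x, ~ Z x -> (h x)^T = h x, smooth2 X Z h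
         & compactly_supported Z h]] |}.

End Bundles.

Section Operators.
Variables (R : realType) (M : ptopologicalType) (Z : set M).
Variable mu : {measure set (borel M) -> \bar R}.

Definition sqnorm (E : metric_bundle R M) (u : M -> fibre E) : \bar R :=
  (\int[mu]_(x in ~` Z) (fibre_inner (x : M) (u x) (u x))%:E)%E.

Definition L2 (E : metric_bundle R M) : set (M -> fibre E) :=
  [set u | measurable_section u /\ (sqnorm u < +oo)%E].

Definition L2_inner (E : metric_bundle R M) (u v : M -> fibre E) : R :=
  \int[mu]_(x in ~` Z) fibre_inner (x : M) (u x) (v x).

Definition ae_eq_sections (E : metric_bundle R M) (u v : M -> fibre E) : Prop :=
  {ae mu, forall x : borel M, ~ Z x -> u x = v x}.

Variables (E F : metric_bundle R M).
Variable A : (M -> fibre E) -> (M -> fibre F).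

(* [psi] is the value at the test section [phi] of the formal adjoint of [A]. *)
Definition formal_adjoint (phi : M -> fibre F) (psi : M -> fibre E) : Prop :=
  test_section psi /\
  forall s, test_section s -> L2_inner (A s) phi = L2_inner s psi.

(* The graph of [A_min]: the closure in L^2 of the graph of [A] on test
   sections. *)
Definition min_graph (u : M -> fibre E) (v : M -> fibre F) : Prop :=
  [/\ L2 u, L2 v & forall eps : R, 0 < eps ->
    exists s, [/\ test_section s, (sqnorm (fun x => u x - s x)%R < eps%:E)%E
                & (sqnorm (fun x => v x - A s x)%R < eps%:E)%E]].

(* The graph of [A_max]: the adjoint of the formal adjoint on test sections. *)
Definition max_graph (u : M -> fibre E) (v : M -> fibre F) : Prop :=
  [/\ L2 u, L2 v & forall phi psi,
    test_section phi -> formal_adjoint phi psi ->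
    L2_inner u psi = L2_inner v phi].

Definition ker_max : set (M -> fibre E) := [set u | max_graph u (fun=> 0)].

Definition im_min : set (M -> fibre F) := [set v | exists u, min_graph u v].

End Operators.

(* Every element of L^2(E) is, in exactly one way, the sum of an element of [A]
   and of an element of [B]; equalities hold almost everywhere. *)
Definition L2_direct_sum (R : realType) (M : ptopologicalType) (Z : set M)
    (mu : {measure set (borel M) -> \bar R}) (E : metric_bundle R M)
    (A B : set (M -> fibre E)) : Prop :=
  [/\ A `<=` L2 Z mu (E := E), B `<=` L2 Z mu (E := E) &
   forall h, L2 Z mu h ->
    exists a b, [/\ A a, B b, ae_eq_sections Z mu h (fun x => a x + b x) &
      forall a' b', A a' -> B b' ->
        ae_eq_sections Z mu h (fun x => a' x + b' x) ->
        ae_eq_sections Z mu a' a /\ ae_eq_sections Z mu b' b]].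

Section Cone.
Variables (R : realType) (n : nat) (M : ptopologicalType).
Variable X : smooth_manifold R n M.
Local Notation V := 'rV[R]_n.

(* R^n is split as R^2 x R^(n-2), the coordinates of index 0 and 1 being the
   transverse ones. [radius2] is the square of the radial coordinate of the
   first factor, [axis] the projection onto {0} x R^(n-2). *)
Definition radius2 (y : V) : R := \sum_(i < n | (i < 2)%N) y 0 i ^+ 2.

Definition axis (y : V) : V := \row_i (if (i < 2)%N then 0 else y 0 i).

Definition slice_chart (S : set M) (c : chart R n M) : Prop :=
  smooth_chart X c /\ forall x, cdom c x -> (S x <-> radius2 (c x) = 0).

Definition codim2_submanifold (S : set M) : Prop :=
  closed S /\ forall x, S x -> exists c, slice_chart S c /\ cdom c x.

(* A metric on the submanifold [S], represented by any field [k] of bilinear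
   forms on the ambient tangent spaces along [S]; only the values of [k] on
   vectors tangent to [S] matter. *)
Definition submanifold_metric (S : set M) (k : M -> 'M[R]_n) : Prop :=
  forall c, slice_chart S c ->
    let K := local2 X c k in
    (forall i j : 'I_n, (2 <= i)%N -> (2 <= j)%N ->
       smooth_on (axis @^-1` (c @` cdom c)) (fun y => K (axis y) i j)) /\
    (forall x, cdom c x -> S x ->
       (forall i j : 'I_n, (2 <= i)%N -> (2 <= j)%N ->
          K (c x) i j = K (c x) j i) /\
       (forall v : V, axis v = v -> v != 0 ->
          0 < (v *m K (c x) *m v^T) 0 0)).

(* The components of dr^2 + (a / 2 pi)^2 r^2 dtheta^2 + k in the coordinates of
   R^2 x R^(n-2). On R^2 minus the origin dr^2 has components x_i x_j / r^2, and
   r^2 dtheta^2 is the Euclidean metric minus dr^2. *)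
Definition cone_model (a : R) (K : V -> 'M[R]_n) (y : V) : 'M[R]_n :=
  \matrix_(i, j)
    if (i < 2)%N && (j < 2)%N then
      let rr := y 0 i * y 0 j / radius2 y in
      rr + (a / (2 * pi)) ^+ 2 * ((i == j)%:R - rr)
    else if (2 <= i)%N && (2 <= j)%N then K (axis y) i j
    else 0.

(* A chart onto D x U, with D an open disk of R^2 centred at 0, in which the
   metric [g] has the form required along the stratum [S], whose metric is [k].
   [Z] is the whole singular set. The estimates on [q] are uniform in U. *)
Definition cone_chart (Z S : set M) (a : R) (g k : M -> 'M[R]_n)
    (c : chart R n M) : Prop :=
  [/\ slice_chart S c, slice_chart Z c,
    exists2 rho : R, 0 < rho & c @` cdom c =
      [set y | radius2 y < rho ^+ 2 /\ (c @` cdom c) (axis y)] &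
    let G := local2 X c g in
    let q y := G y - cone_model a (local2 X c k) y in
    forall eps : R, 0 < eps -> exists2 r : R, 0 < r &
      forall y, (c @` cdom c) y -> 0 < radius2 y -> radius2 y < r ^+ 2 ->
        inner2 (G y) (q y) (q y) <= eps * radius2 y /\
        inner3 (G y) (nabla2 G q y) (nabla2 G q y) <= eps].

Definition singular_set (p : nat) (S : 'I_p -> set M) : set M :=
  [set x | exists i, S i x].

Record cone_manifold (p : nat) (S : 'I_p -> set M) (alpha : 'I_p -> R)
    (g : M -> 'M[R]_n) (gS : 'I_p -> M -> 'M[R]_n) : Prop := ConeManifold {
  stratum_submanifold : forall i, codim2_submanifold (S i);
  stratum_nonempty : forall i, S i !=set0;
  stratum_connected : forall i, connected (S i);
  strata_disjoint : forall i j, i != j -> S i `&` S j = set0;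
  angle_gt0 : forall i, 0 < alpha i;
  regular_metric : riemannian_metric X (singular_set S) g;
  stratum_metric : forall i, submanifold_metric (S i) (gS i);
  cone_charts : forall i x, S i x -> exists c,
    cone_chart (singular_set S) (S i) (alpha i) g (gS i) c /\ cdom c x }.

End Cone.

(* Main.v *)
Require Import Defs.
From HB Require Import structures.
From mathcomp Require Import all_boot all_order all_algebra.
From mathcomp Require Import all_classical all_reals all_analysis.
From mathcomp Require Import measurable_realfun ring lra.

Set Implicit Arguments.
Unset Strict Implicit.
Unset Printing Implicit Defensive.
Import Order.TTheory GRing.Theory Num.Theory.
Import numFieldNormedType.Exports.
Local Open Scope classical_set_scope.
Local Open Scope ring_scope.

(* Let T v = v - (tr_g v / 2) g. The formal adjoint of beta is phi |-> T delta^* phi.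
   For a compactly supported 1-form phi, Bochner's formula on an Einstein
   manifold with ric = k g gives, after integration,
     |delta^* phi|^2 - k |phi|^2 <= 2 <T delta^* phi, delta^* phi>,
   so for k < 0 the form B(phi, psi) = <T delta^* phi, delta^* psi> controls both
   |phi| and |delta^* phi|. Given h in L^2, minimise B(phi, phi) - 2 <h, T delta^* phi>
   over test forms: a minimising sequence phi_j and its images delta^* phi_j are
   Cauchy in L^2, and the limit v of delta^* phi_j satisfies
   <v, T delta^* phi> = <h, T delta^* phi> for every test form phi; hence
   h - v lies in ker beta_max. If d in Im delta^*_min is orthogonal to all the
   T delta^* phi, the same inequality applied to an approximation delta^* s of d
   bounds |delta^* s| by a multiple of |d - delta^* s|, hence d = 0.
   Near the singular set nothing is used: test sections vanish there. *)

(** * Calculus in several variables *)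

(** The orthogonal complement of ker beta_max is the closure of the T delta^* phi, not of the
    delta^* phi, so orthogonal projection does not give the decomposition. Nor is v |-> <T v, v>
    coercive: pointwise it is indefinite, since <T g, g> = n - n^2 / 2 is negative for n >= 3.
    Positivity appears only on v = delta^* phi and only after integration. With N = nabla phi one
    has 2 |delta^* phi|^2 = |N|^2 + <N, N^T> and tr delta^* phi = div phi, and Bochner's identity
    says that <N, N^T> - (div phi)^2 + Ric(phi, phi) is a divergence. Hence 2 <T delta^* phi,
    delta^* phi> integrates to |N|^2 - k |phi|^2, while |delta^* phi| <= |N|. The term - k |phi|^2
    matters because an element of Im delta^*_min must come with an L^2 potential: the phi_j have to
    converge too. The volume is given through iterated integrals in charts, so the divergence
    theorem for forms with compact support in the regular set is derived from translation invariance
    in R^n and a partition of unity. *)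

Lemma continuous_at_sum (R : realType) (T : topologicalType) (I : Type)
    (r : seq I) (F : I -> T -> R) x :
  (forall i, {for x, continuous (F i)}) ->
  {for x, continuous (fun y => \sum_(i <- r) F i y)}.
Proof.
move=> Fc; elim: r => [|i r IH].
  under [X in {for _, continuous X}]funext do rewrite big_nil.
  exact: cst_continuous.
under [X in {for _, continuous X}]funext do rewrite big_cons.
exact: continuousD.
Qed.

Section PartialDerivatives.
Variables (R : realType) (n : nat).
Local Notation V := 'rV[R]_n.
Local Notation e_ i := (delta_mx 0 i : V).
Implicit Types (f g : V -> R) (x y z : V) (W : set V).

Lemma le_coord_norm (v : V) i : `|v 0 i| <= `|v|.
Proof.
rewrite [leRHS]/Num.norm /= mx_normrE; apply/bigmax_geP; right => /=.
by exists (0, i).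
Qed.

Lemma norm_rV_lt (v : V) (e : R) :
  0 < e -> (forall i, `|v 0 i| < e) -> `|v| < e.
Proof.
move=> e0 ve; rewrite [ltLHS]/Num.norm /= mx_normrE.
by apply/bigmax_ltP; split => //= -[i j] _ /=; rewrite ord1.
Qed.

Lemma norm_rV_le (v : V) (e : R) :
  0 <= e -> (forall i, `|v 0 i| <= e) -> `|v| <= e.
Proof.
move=> e0 ve; rewrite [leLHS]/Num.norm /= mx_normrE.
by apply/bigmax_leP; split => //= -[i j] _ /=; rewrite ord1.
Qed.

Lemma open_normP W y : open W -> W y ->
  exists2 e : R, 0 < e & forall z, `|z - y| < e -> W z.
Proof.
move=> Wo Wy; have /nbhs_ballP[e /= e0 eW] := open_nbhs_nbhs (conj Wo Wy).
exists e => // z zy; apply: eW; rewrite -ball_normE /ball_ /=.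
by rewrite -opprB normrN.
Qed.

Lemma is_derive_line f z i (t : R) :
  derivable f (z + t *: e_ i) (e_ i) ->
  is_derive t 1 (fun s => f (z + s *: e_ i)) (pd i f (z + t *: e_ i)).
Proof.
move=> df; rewrite /pd /derive.
have E : (fun h : R => h^-1 *: (((fun s => f (z + s *: e_ i)) \o shift t) (h *: 1) -
   f (z + t *: e_ i))) =
  (fun h : R => h^-1 *: ((f \o shift (z + t *: e_ i)) (h *: e_ i) - f (z + t *: e_ i))).
  apply/funext => h /=; congr (_ *: (f _ - _)).
  by rewrite [h *: 1]mulr1 scalerDl addrCA.
by split; rewrite /derivable /derive E.
Qed.

(** Mean value theorem along the axis, for either sign of [s]. Taking [c] to be a partial derivative
    at the centre gives first-order expansions; [c = 0] bounds difference quotients. *)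
Lemma pd_line_bound f z i (s c eps : R) :
  (forall t : R, `|t| <= `|s| -> derivable f (z + t *: e_ i) (e_ i)) ->
  (forall t : R, `|t| <= `|s| -> `|pd i f (z + t *: e_ i) - c| <= eps) ->
  `|f (z + s *: e_ i) - f z - c * s| <= eps * `|s|.
Proof.
move=> df bd; pose h (t : R) := f (z + t *: e_ i).
have dh (t : R) : `|t| <= `|s| -> is_derive t 1 h (pd i f (z + t *: e_ i)).
  by move=> /df; exact: is_derive_line.
have h0 : h 0 = f z by rewrite /h scale0r addr0.
have ch (a b : R) : (forall t : R, t \in `[a, b] -> `|t| <= `|s|) ->
    {within `[a, b], continuous h}.
  move=> ab; apply: derivable_within_continuous => t tab.
  by have [] := dh _ (ab _ tab).
case: (ltgtP s 0) => s0.
- have ab (t : R) : t \in `[s, 0] -> `|t| <= `|s|.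
    by rewrite in_itv /= => /andP[? t0]; rewrite !ler0_norm ?lerN2// ltW.
  have [t tin /eqP] := MVT s0 (fun (t : R) tt => dh t (ab t (subset_itv_oo_cc tt))) (ch _ _ ab).
  rewrite h0 sub0r -/(h s) => /eqP E.
  have -> : h s - f z - c * s = (pd i f (z + t *: e_ i) - c) * s.
    by rewrite mulrBl; congr (_ - _); rewrite -opprB E mulrN opprK.
  by rewrite normrM ler_wpM2r // bd //; exact/ab/subset_itv_oo_cc.
- have ab (t : R) : t \in `[0, s] -> `|t| <= `|s|.
    by rewrite in_itv /= => /andP[? t0]; rewrite !ger0_norm // ltW.
  have [t tin /eqP] := MVT s0 (fun (t : R) tt => dh t (ab t (subset_itv_oo_cc tt))) (ch _ _ ab).
  rewrite h0 subr0 -/(h s) => /eqP E.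
  have -> : h s - f z - c * s = (pd i f (z + t *: e_ i) - c) * s.
    by rewrite mulrBl; congr (_ - _).
  by rewrite normrM ler_wpM2r // bd //; exact/ab/subset_itv_oo_cc.
- by rewrite s0 scale0r addr0 subrr mulr0 subr0 normr0 mulr0.
Qed.

(** The points [y + head_part k h] lead from [y] to [y + h] by moves parallel to one axis each, so
    that [pd_line_bound] applies to every move. *)
Definition head_part (k : nat) (h : V) : V := \row_j (if (j < k)%N then h 0 j else 0).

Lemma head_partS (h : V) (i : 'I_n) :
  head_part i.+1 h = head_part i h + h 0 i *: e_ i.
Proof.
apply/rowP => j; rewrite !mxE eqxx /= ltnS leq_eqVlt.
case: (eqVneq j i) => [->|ji]; rewrite ?eqxx ?ltnn ?add0r ?mulr1 //.
by rewrite mulr0 addr0 -[(j == i :> nat)]/(j == i) (negbTE ji).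
Qed.

Lemma C1_differentiable W f y : open W -> W y ->
  (forall x i, W x -> derivable f x (e_ i)) ->
  (forall i, {for y, continuous (pd i f)}) ->
  differentiable f y.
Proof.
move=> Wo Wy df cf.
pose L (h : V) : R := \sum_i h 0 i * pd i f y.
have Llin : linear L.
  move=> a u v; rewrite /L scaler_sumr -big_split /=; apply: eq_bigr => i _.
  by rewrite !mxE mulrDl -mulrA.
pose LL := GRing.isLinear.Build _ _ _ _ L Llin.
pose Ll : {linear V -> R} := HB.pack L LL.
have Lc : continuous Ll.
  move=> h; rewrite /= /L.
  apply: continuous_at_sum => i; by apply: continuousM; [exact: coord_continuous|exact: cst_continuous].
(* A continuous linear map with such an expansion is the differential, by [diff_unique]; [L] is the
   candidate built from the partial derivatives. *)
suff Ho : f \o shift y = cst (f y) + Ll +o_ (0 : V) id.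
  by apply/diff_locallyP; rewrite (diff_unique Lc Ho); split.
apply/eqaddoP => _ /posnumP[eps].
have [e e0 eW] := open_normP Wo Wy.
have n0 : 0 < n.+1%:R :> R by rewrite ltr0n.
(* Each of the n coordinate moves may cost [eps'] times the norm of h; n + 1 in place of n keeps the
   quotient meaningful for n = 0. *)
pose eps' := eps%:num / n.+1%:R.
have eps'0 : 0 < eps' by rewrite divr_gt0.
have /choice[dd ddP] (i : 'I_n) : exists d : R, 0 < d /\
    forall z, `|z - y| < d -> `|pd i f z - pd i f y| <= eps'.
  have /cvgrPdist_le /(_ _ eps'0)/nbhs_ballP[d /= d0 dP] := cf i.
  exists d; split => // z zy; rewrite -opprB normrN; apply: dP.
  by rewrite -ball_normE /ball_ /= -opprB normrN.
pose d := \big[Num.min/e]_i dd i.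
have d0 : 0 < d.
  rewrite /d; elim/big_ind: _ => // [a b a0 b0|i _]; first by rewrite lt_min a0.
  by case: (ddP i).
have de : d <= e by rewrite /d; apply: bigmin_le_id.
have dH i z : `|z - y| < d -> `|pd i f z - pd i f y| <= eps'.
  move=> zy; apply: (ddP i).2; apply: lt_le_trans zy _.
  by rewrite /d (bigD1 i) //= ge_min lexx.
near=> h.
have hd : `|h| < d.
  near: h; apply/nbhs_ballP; exists d => //= z.
  by rewrite -ball_normE /ball_ /= sub0r normrN.
have hp k : `|head_part k h| <= `|h|.
  apply: norm_rV_le => // i; rewrite mxE; case: ifP => _; last by rewrite normr0.
  exact: le_coord_norm.
have hpt (i : 'I_n) (t : R) : `|t| <= `|h 0 i| -> `|head_part i h + t *: e_ i| <= `|h|.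
  move=> ti; apply: norm_rV_le => // j; rewrite !mxE eqxx /=.
  case: (eqVneq j i) => [->|ji]; rewrite ?ltnn ?add0r ?mulr1 ?mulr0 ?addr0.
    by apply: le_trans ti _; apply: le_coord_norm.
  by case: ifP => _; rewrite ?normr0 //; apply: le_coord_norm.
have key (i : 'I_n) : `|f (y + head_part i.+1 h) - f (y + head_part i h) - pd i f y * h 0 i| <= eps' * `|h|.
  rewrite head_partS addrA; apply: le_trans (_ : eps' * `|h 0 i| <= _); last first.
    by rewrite ler_wpM2l ?le_coord_norm // ltW.
  have yW (t : R) : `|t| <= `|h 0 i| -> `|y + head_part i h + t *: e_ i - y| < d.
    by move=> /hpt hh; rewrite addrC !addrA addNr add0r (le_lt_trans hh).
  apply: pd_line_bound => t ti; last by apply/dH/yW.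
  by apply: df; apply: eW; apply: lt_le_trans (yW _ ti) de.
have -> : (f \o shift y - (cst (f y) + Ll)) h =
    \sum_(i < n) (f (y + head_part i.+1 h) - f (y + head_part i h) - pd i f y * h 0 i).
  rewrite sumrB.
  have -> : \sum_(i < n) (f (y + head_part i.+1 h) - f (y + head_part i h)) = f (y + h) - f y.
    rewrite -(big_mkord xpredT (fun i => f (y + head_part i.+1 h) - f (y + head_part i h))).
    rewrite telescope_sumr //; congr (f _ - f _).
      by congr (_ + _); apply/rowP => j; rewrite mxE ltn_ord.
    by rewrite -[RHS]addr0; congr (_ + _); apply/rowP => j; rewrite !mxE ltn0.
  rewrite !fctE /= /L opprD addrA [h + y]addrC; congr (_ - _).
  by apply: eq_bigr => i _; rewrite mulrC.
apply: le_trans (ler_norm_sum _ _ _) _.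
apply: le_trans (_ : \sum_(i < n) eps' * `|h| <= _); first exact: ler_sum.
rewrite sumr_const card_ord -mulr_natl mulrA ler_wpM2r //.
by rewrite /eps' mulrCA ger_pMr // ler_pdivrMr // mul1r ler_nat.
Unshelve. all: by end_near. Qed.

End PartialDerivatives.
Section PdRules.
Variables (R : realType) (n : nat).
Local Notation V := 'rV[R]_n.
Local Notation e_ i := (delta_mx 0 i : V).
Implicit Types (f g : V -> R) (x y z : V) (W : set V) (i j : 'I_n).

Lemma pd_diff f y i : differentiable f y -> pd i f y = 'd f y (e_ i).
Proof. exact: deriveE. Qed.

Lemma diff_pd_sum f y v : differentiable f y ->
  'd f y v = \sum_i v 0 i * pd i f y.
Proof.
move=> df; rewrite {1}(row_sum_delta v) linear_sum; apply: eq_bigr => i _.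
by rewrite linearZ pd_diff.
Qed.

Lemma pd_eq W f g y i : open W -> W y -> (forall z, W z -> f z = g z) ->
  pd i f y = pd i g y.
Proof.
move=> Wo Wy fg; apply: near_eq_derive.
by apply: filterS (open_nbhs_nbhs (conj Wo Wy)) => z /fg.
Qed.

Lemma derivable_eq W f g y i : open W -> W y -> (forall z, W z -> f z = g z) ->
  derivable f y (e_ i) -> derivable g y (e_ i).
Proof.
move=> Wo Wy fg; apply: near_eq_derivable.
by near=> z; apply: fg; near: z; exact: open_nbhs_nbhs.
Unshelve. all: by end_near.
Qed.

Lemma continuous_eq (T : topologicalType) W (f g : V -> T) y : open W -> W y ->
  (forall z, W z -> f z = g z) -> {for y, continuous f} -> {for y, continuous g}.
Proof.
move=> Wo Wy fg fc; rewrite /prop_for /continuous_at -(fg _ Wy).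
have fg' : \forall z \near nbhs y, f z = g z.
  by near=> z; apply: fg; near: z; exact: open_nbhs_nbhs.
by apply: cvg_trans fc; exact: (near_eq_cvg fg').
Unshelve. all: by end_near. Qed.

Lemma differentiable_eq W f g y : open W -> W y -> (forall z, W z -> f z = g z) ->
  differentiable f y -> differentiable g y.
Proof.
move=> Wo Wy fg df; have [e e0 eW] := open_normP Wo Wy.
have H : g \o shift y = cst (g y) + 'd f y +o_ (0 : V) id.
  apply/eqaddoP => eps eps0.
  have /eqaddoP/(_ _ eps0) Hf := diff_locally df.
  near=> h.
  have <- : (f \o shift y - (cst (f y) + 'd f y)) h = (g \o shift y - (cst (g y) + 'd f y)) h.
    rewrite !fctE /= (fg y Wy); congr (_ - _); apply: fg; apply: eW; rewrite addrK.
    near: h; apply/nbhs_ballP; exists e => //= z.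
    by rewrite -ball_normE /ball_ /= sub0r normrN.
  by near: h.
apply/diff_locallyP; rewrite (diff_unique (diff_continuous df) H); split => //.
exact: diff_continuous.
Unshelve. all: by end_near. Qed.

Lemma pd_cst c y i : pd i (fun=> c) y = 0.
Proof. by rewrite pd_diff ?diff_cst//; exact: differentiable_cst. Qed.

Section Rules.
Variables (f g : V -> R) (y : V).
Hypotheses (df : differentiable f y) (dg : differentiable g y).

Lemma pdD i : pd i (fun z => f z + g z) y = pd i f y + pd i g y.
Proof.
rewrite -[fun z => _]/(f + g) !pd_diff //; first by rewrite diffD.
exact: differentiableD.
Qed.

Lemma pdN i : pd i (fun z => - f z) y = - pd i f y.
Proof.
rewrite -[fun z => _]/(- f) !pd_diff //; first by rewrite diffN.
exact: differentiableN.
Qed.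

Lemma pdB i : pd i (fun z => f z - g z) y = pd i f y - pd i g y.
Proof.
rewrite -[fun z => _]/(f - g) !pd_diff //; first by rewrite diffB.
exact: differentiableB.
Qed.

Lemma pdM i : pd i (fun z => f z * g z) y = pd i f y * g y + f y * pd i g y.
Proof.
rewrite -[fun z => _]/(f * g) !pd_diff //; last exact: differentiableM.
transitivity (f y * 'd g y (e_ i) + g y * 'd f y (e_ i)).
  by rewrite diffM.
by rewrite addrC (mulrC (g y)).
Qed.

Lemma pdMl c i : pd i (fun z => c * f z) y = c * pd i f y.
Proof.
rewrite -[fun z => _]/(c *: f) !pd_diff //; first by rewrite diffZ.
exact: differentiableZ.
Qed.

Lemma pdV i : f y != 0 -> pd i (fun z => (f z)^-1) y = - (f y) ^- 2 * pd i f y.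
Proof.
move=> fy0; rewrite !pd_diff //; first by rewrite diffV.
exact: differentiableV.
Qed.

Lemma differentiable_add : differentiable (fun z => f z + g z) y.
Proof. exact: differentiableD. Qed.

Lemma differentiable_mul : differentiable (fun z => f z * g z) y.
Proof. exact: differentiableM. Qed.

End Rules.

Lemma differentiable_bigsum (I : Type) (r : seq I) (P : pred I) (F : I -> V -> R) y :
  (forall k, differentiable (F k) y) ->
  differentiable (fun z => \sum_(k <- r | P k) F k z) y.
Proof.
move=> dF; elim: r => [|k r IH].
  under [X in differentiable X _]funext do rewrite big_nil.
  exact: differentiable_cst.
under [X in differentiable X _]funext do rewrite big_cons.
by case: (P k) => //; exact: differentiable_add.
Qed.

Lemma pd_sum (I : Type) (r : seq I) (P : pred I) (F : I -> V -> R) y i :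
  (forall k, differentiable (F k) y) ->
  pd i (fun z => \sum_(k <- r | P k) F k z) y = \sum_(k <- r | P k) pd i (F k) y.
Proof.
move=> dF; elim: r => [|k r IH].
  rewrite big_nil; under [X in pd _ X]funext do rewrite big_nil.
  exact: pd_cst.
rewrite big_cons; under [X in pd _ X]funext do rewrite big_cons.
case: (P k) => //; rewrite pdD ?IH //; exact: differentiable_bigsum.
Qed.

Lemma differentiable_bigprod (I : Type) (r : seq I) (F : I -> V -> R) y :
  (forall k, differentiable (F k) y) ->
  differentiable (fun z => \prod_(k <- r) F k z) y.
Proof.
move=> dF; elim: r => [|k r IH].
  under [X in differentiable X _]funext do rewrite big_nil.
  exact: differentiable_cst.
under [X in differentiable X _]funext do rewrite big_cons.
exact: differentiable_mul.
Qed.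

(** [uniq r] makes [l != k] omit exactly one factor. Applied in [pd_det] to the Leibniz expansion of
    a determinant. *)
Lemma pd_bigprod (I : eqType) (r : seq I) (F : I -> V -> R) y i : uniq r ->
  (forall k, differentiable (F k) y) ->
  pd i (fun z => \prod_(k <- r) F k z) y =
  \sum_(k <- r) pd i (F k) y * \prod_(l <- r | l != k) F l y.
Proof.
move=> + dF; elim: r => [_|k r IH /= /andP[kr ur]].
  rewrite big_nil; under [X in pd _ X]funext do rewrite big_nil.
  exact: pd_cst.
under [X in pd _ X]funext do rewrite big_cons.
rewrite pdM // ?IH //; last exact: differentiable_bigprod.
rewrite big_cons big_cons eqxx /=; congr (_ + _).
  congr (_ * _); rewrite big_seq [RHS]big_seq_cond; apply: eq_bigl => l.
  by case: (boolP (l \in r)) => //= lr; case: eqP lr kr => //= -> ->.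
rewrite mulr_sumr; apply: eq_big_seq => l lr.
rewrite big_cons; case: eqP => [kl|_]; first by move: kr; rewrite kl lr.
by rewrite mulrCA.
Qed.

Lemma differentiable_rV m (tau : V -> 'rV[R]_m) y :
  (forall j : 'I_m, differentiable (fun z => tau z 0 j) y) -> differentiable tau y.
Proof.
move=> dt.
have -> : tau = \sum_(j < m) (fun z => tau z 0 j *: (delta_mx 0 j : 'rV_m)).
  by apply/funext => z; rewrite {1}(row_sum_delta (tau z)) fct_sumE.
by apply: differentiable_sum => j; exact: differentiableZl.
Qed.

Lemma diff_coord m (w v : 'rV[R]_m) (j : 'I_m) :
  'd (fun N : 'rV[R]_m => N 0 j) w v = v 0 j.
Proof.
have @f : {linear 'rV[R]_m -> R}.
  by exists (fun N : 'rV[R]_m => N 0 j); do 2![eexists]; do ?[constructor];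
     rewrite ?mxE// => ? *; rewrite ?mxE//; move=> ?; rewrite !mxE.
rewrite (_ : (fun _ => _) = f) // diff_lin //; exact: coord_continuous.
Qed.

Lemma jacobianE m (tau : V -> 'rV[R]_m) y i (j : 'I_m) : differentiable tau y ->
  jacobian tau y i j = pd i (fun z => tau z 0 j) y.
Proof.
move=> dt; rewrite /jacobian mxE.
have -> : (fun z => tau z 0 j) = (fun N : 'rV[R]_m => N 0 j) \o tau by [].
rewrite pd_diff; last by apply: differentiable_comp => //; exact: differentiable_coord.
by rewrite [in RHS]diff_comp //= ?diff_coord //; exact: differentiable_coord.
Qed.

Lemma pd_comp f (tau : V -> V) y i :
  (forall j, differentiable (fun z => tau z 0 j) y) -> differentiable f (tau y) ->
  pd i (fun z => f (tau z)) y =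
  \sum_j pd i (fun z => tau z 0 j) y * pd j f (tau y).
Proof.
move=> dt df; have dtau := differentiable_rV dt.
rewrite -[fun z => _]/(f \o tau) pd_diff; last exact: differentiable_comp.
rewrite diff_comp //= diff_pd_sum //; apply: eq_bigr => j _.
by congr (_ * _); rewrite -jacobianE // /jacobian mxE.
Qed.

Lemma differentiable_compV f (tau : V -> V) y :
  (forall j, differentiable (fun z => tau z 0 j) y) -> differentiable f (tau y) ->
  differentiable (fun z => f (tau z)) y.
Proof. by move=> dt df; apply: differentiable_comp => //; exact: differentiable_rV. Qed.

Lemma pd_comp_real (phi : R -> R) f y i : differentiable f y ->
  derivable phi (f y) 1 ->
  pd i (fun z => phi (f z)) y = phi^`()%classic (f y) * pd i f y.
Proof.
move=> df /derivable1_diffP dphi; rewrite -[fun z => _]/(phi \o f).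
rewrite pd_diff; last exact: differentiable_comp.
by rewrite diff_comp //= diff1E // pd_diff // mulrC.
Qed.

Lemma pd_coord y i j : pd i (fun z : V => z 0 j) y = (i == j)%:R.
Proof.
rewrite pd_diff; last exact: differentiable_coord.
by rewrite diff_coord !mxE eqxx /= eq_sym.
Qed.

End PdRules.

(** * Schwarz's theorem and closure properties of the classes C^k *)

Section CkCalculus.
Variables (R : realType) (n : nat).
Local Notation V := 'rV[R]_n.
Local Notation e_ i := (delta_mx 0 i : V).
Implicit Types (f g : V -> R) (x y z : V) (W : set V) (i j : 'I_n).

Lemma shift_quotient f v z i :
  (fun h : R => h^-1 *: (((fun x => f (x + v)) \o shift z) (h *: e_ i) - f (z + v))) =
  (fun h : R => h^-1 *: ((f \o shift (z + v)) (h *: e_ i) - f (z + v))).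
Proof. by apply/funext => h /=; rewrite addrA. Qed.

Lemma pd_shift f v z i : pd i (fun x => f (x + v)) z = pd i f (z + v).
Proof. by rewrite /pd /derive shift_quotient. Qed.

Lemma derivable_shift f v z i :
  derivable f (z + v) (e_ i) -> derivable (fun x => f (x + v)) z (e_ i).
Proof. by rewrite /derivable shift_quotient. Qed.

(** Second difference over the square spanned by s e_i and s e_j. It is symmetric in i and j, which
    is why mixed derivatives commute. *)
Definition cross_difference f y i j (s : R) : R :=
  f (y + s *: e_ i + s *: e_ j) - f (y + s *: e_ i) - (f (y + s *: e_ j) - f y).

(** The second difference is the increment along e_i of [F z = f (z + s e_j) - f z], and [pd i F] is
    the increment of [pd i f] along e_j: two uses of [pd_line_bound]. *)
Lemma cross_difference_bound W f y i j (eps : R) : open W -> W y -> 0 < eps ->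
  (forall x i, W x -> derivable f x (e_ i)) ->
  (forall x i j, W x -> derivable (pd i f) x (e_ j)) ->
  {for y, continuous (pd j (pd i f))} ->
  exists2 d : R, 0 < d & forall s : R, 0 < s -> s < d ->
    `|cross_difference f y i j s - pd j (pd i f) y * s * s| <= eps * s * s.
Proof.
move=> Wo Wy eps0 df ddf cf.
have [e e0 eW] := open_normP Wo Wy.
have [d' d'0 d'P] : exists2 d : R, 0 < d &
    forall z, `|z - y| < d -> `|pd j (pd i f) z - pd j (pd i f) y| <= eps.
  have /cvgrPdist_le /(_ _ eps0)/nbhs_ballP[d /= d0 dP] := cf.
  exists d => // z zy; rewrite -opprB normrN; apply: dP.
  by rewrite -ball_normE /ball_ /= -opprB normrN.
(* A point of the square of side s is at distance at most 2 s from y; halving keeps the whole square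
   inside both balls. *)
exists (Num.min e d' / 2); first by rewrite divr_gt0 // lt_min e0.
move=> s s0; rewrite ltr_pdivlMr // lt_min => /andP[se sd'].
have e1 k : `|e_ k| <= 1.
  apply: norm_rV_le => // l; rewrite mxE eqxx /=.
  by case: (l == k); rewrite ?normr1 ?normr0.
have near_y (t u : R) : `|t| <= s -> `|u| <= s ->
    `|y + t *: e_ i + u *: e_ j - y| <= s * 2.
  move=> ts us; rewrite addrC !addrA addNr add0r.
  apply: le_trans (ler_normD _ _) _; rewrite !normrZ mulr_natr mulr2n.
  by apply: lerD; rewrite -[leRHS]mulr1 ler_pM.
have s_norm : `|s| = s by rewrite gtr0_norm.
have inW (t u : R) : `|t| <= s -> `|u| <= s -> W (y + t *: e_ i + u *: e_ j).
  by move=> ts us; apply: eW; apply: le_lt_trans se; exact: near_y.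
have inWi (t : R) : `|t| <= s -> W (y + t *: e_ i).
  by move=> ts; have := inW t 0 ts; rewrite scale0r addr0 normr0; apply; exact: ltW.
pose F z := f (z + s *: e_ j) - f z.
have dF (t : R) : `|t| <= `|s| -> derivable F (y + t *: e_ i) (e_ i).
  rewrite s_norm => ts; apply: derivableB; last exact/df/inWi.
  by apply: derivable_shift; apply: df; apply: inW; rewrite ?s_norm.
have pF (t : R) : `|t| <= `|s| ->
    `|pd i F (y + t *: e_ i) - pd j (pd i f) y * s| <= eps * s.
  rewrite s_norm => ts.
  have -> : pd i F (y + t *: e_ i) =
      pd i f (y + t *: e_ i + s *: e_ j) - pd i f (y + t *: e_ i).
    rewrite -(pd_shift f (s *: e_ j)) /pd; apply: deriveB; last exact/df/inWi.
    by apply: derivable_shift; apply: df; apply: inW; rewrite ?s_norm.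
  rewrite -{3}s_norm; apply: pd_line_bound => u; rewrite s_norm => us.
    exact/ddf/inW.
  by apply: d'P; apply: le_lt_trans sd'; exact: near_y.
have := pd_line_bound dF pF.
by rewrite s_norm.
Qed.

(** Both mixed derivatives are within eps / 2 of the same second difference divided by s^2. *)
Lemma pd_swap W f y i j : open W -> W y -> Ck 2 W f ->
  pd i (pd j f) y = pd j (pd i f) y.
Proof.
move=> Wo Wy [df ddf]; apply/eqP; rewrite -subr_eq0 -normr_le0.
apply/ler_addgt0Pr => _/posnumP[eps]; rewrite add0r.
have df2 x k l : W x -> derivable (pd k f) x (e_ l) by move=> Wx; apply: (ddf k).1.
have e2 : 0 < eps%:num / 2 by rewrite divr_gt0.
have [d d0 dP] := cross_difference_bound Wo Wy e2 df df2 ((ddf i).2 j _ Wy).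
have [d' d'0 d'P] := cross_difference_bound Wo Wy e2 df df2 ((ddf j).2 i _ Wy).
pose s := Num.min d d' / 2.
have m0 : 0 < Num.min d d' by rewrite lt_min d0.
have s0 : 0 < s by rewrite divr_gt0.
have sm : s < Num.min d d' by rewrite /s ltr_pdivrMr // ltr_pMr // ltr1n.
have [md md'] : Num.min d d' <= d /\ Num.min d d' <= d'.
  by rewrite !ge_min !lexx orbT.
have {dP}dP := dP s s0 (lt_le_trans sm md).
have {d'P} := d'P s s0 (lt_le_trans sm md').
have -> : cross_difference f y j i s = cross_difference f y i j s.
  rewrite /cross_difference -!addrA [s *: e_ j + _]addrC; ring.
move: dP; move: (cross_difference _ _ _ _ _) (pd i (pd j f) y) (pd j (pd i f) y).
move=> D c' c dP d'P.
have ss : 0 < s * s by rewrite mulr_gt0.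
rewrite -(ler_pM2r ss) -[X in _ * X <= _](gtr0_norm ss) -normrM.
have -> : (c' - c) * (s * s) = (D - c * s * s) - (D - c' * s * s) by ring.
apply: le_trans (ler_normB _ _) _.
apply: le_trans (lerD dP d'P) _.
by rewrite -!(mulrA (eps%:num / 2)) -mulrDl -splitr.
Qed.

Lemma Ck1_differentiable W f y : open W -> Ck 1 W f -> W y -> differentiable f y.
Proof. by move=> Wo [df cf] Wy; apply: (C1_differentiable Wo) => // i; exact: cf. Qed.

(** [Ck k.+1] does not mention the continuity of [f] itself; the base case recovers it from
    [C1_differentiable]. *)
Lemma CkW W k f : open W -> Ck k.+1 W f -> Ck k W f.
Proof.
move=> Wo; elim: k f => [|k IH] f fC.
  by move=> x Wx; apply: differentiable_continuous; exact: Ck1_differentiable Wx.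
by case: fC => df cf; split => // i; exact: IH.
Qed.

Lemma Ck_le W k l f : open W -> (l <= k)%N -> Ck k W f -> Ck l W f.
Proof.
move=> Wo; elim: k => [|k IH]; first by rewrite leqn0 => /eqP->.
by rewrite leq_eqVlt => /predU1P[-> //|lk] fC; apply: IH => //; exact: CkW.
Qed.

Lemma CkS_differentiable W k f y : open W -> Ck k.+1 W f -> W y -> differentiable f y.
Proof. by move=> Wo fC; apply: Ck1_differentiable => //; exact: (Ck_le Wo _ fC). Qed.

Lemma CkS_intro W k f : (forall y, W y -> differentiable f y) ->
  (forall i, Ck k W (pd i f)) -> Ck k.+1 W f.
Proof. by move=> df cf; split => // x i Wx; apply: diff_derivable; exact: df. Qed.

Lemma Ck_subset W W' k f : W' `<=` W -> Ck k W f -> Ck k W' f.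
Proof.
move=> WW; elim: k f => [|k IH] f; first by move=> fc x /WW; exact: fc.
by move=> [df cf]; split => [x i /WW|i]; [exact: df|exact/IH/cf].
Qed.

Lemma Ck_eq W k f g : open W -> (forall z, W z -> f z = g z) -> Ck k W f -> Ck k W g.
Proof.
move=> Wo; elim: k f g => [|k IH] f g fg.
  by move=> fc x Wx; exact: (continuous_eq Wo Wx fg (fc _ Wx)).
move=> [df cf]; split => [x i Wx|i].
  by apply: (derivable_eq Wo Wx fg); exact: df.
by apply: IH (cf i) => z Wz; exact: (pd_eq _ Wo Wz fg).
Qed.

(** Serves for functions defined by cases, such as extensions by zero from a compact set: each case
    is treated on an open set of its own. *)
Lemma Ck_local W k f :
  (forall y, W y -> exists W', [/\ open W', W' y & Ck k W' f]) -> Ck k W f.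
Proof.
elim: k f => [|k IH] f H.
  by move=> x /H[W' [_ W'x]]; apply.
split => [x i /H[W' [_ W'x [df _]]]|i]; first exact: df.
by apply: IH => y /H[W' [W'o W'y [_ cf]]]; exists W'; split => //; exact: cf.
Qed.

Lemma Ck_cst W k c : Ck k W (fun=> c : R).
Proof.
elim: k c => [|k IH] c; first by move=> x _; exact: cst_continuous.
split=> [x i _|i]; first exact: derivable_cst.
by rewrite (_ : pd i _ = fun=> 0) //; apply/funext => x; exact: pd_cst.
Qed.

Lemma CkD W k f g : open W -> Ck k W f -> Ck k W g -> Ck k W (fun z => f z + g z).
Proof.
move=> Wo; elim: k f g => [|k IH] f g fC gC.
  by move=> x Wx; apply: continuousD; [exact: fC|exact: gC].
apply: CkS_intro => [y Wy|i].
  by apply: differentiable_add; [exact: (CkS_differentiable Wo fC Wy)|exact: (CkS_differentiable Wo gC Wy)].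
apply: (Ck_eq Wo _ (IH _ _ (fC.2 i) (gC.2 i))) => z Wz /=.
by rewrite pdD //; [exact: (CkS_differentiable Wo fC Wz)|exact: (CkS_differentiable Wo gC Wz)].
Qed.

Lemma CkM W k f g : open W -> Ck k W f -> Ck k W g -> Ck k W (fun z => f z * g z).
Proof.
move=> Wo; elim: k f g => [|k IH] f g fC gC.
  by move=> x Wx; apply: continuousM; [exact: fC|exact: gC].
apply: CkS_intro => [y Wy|i].
  by apply: differentiable_mul; [exact: (CkS_differentiable Wo fC Wy)|exact: (CkS_differentiable Wo gC Wy)].
apply: (Ck_eq Wo _ (CkD Wo (IH _ _ (fC.2 i) (CkW Wo gC)) (IH _ _ (CkW Wo fC) (gC.2 i)))).
by move=> z Wz /=; rewrite pdM //; [exact: (CkS_differentiable Wo fC Wz)|exact: (CkS_differentiable Wo gC Wz)].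
Qed.

Lemma CkN W k f : open W -> Ck k W f -> Ck k W (fun z => - f z).
Proof.
move=> Wo fC; apply: (Ck_eq Wo _ (CkM Wo (Ck_cst W k (-1)) fC)) => z _ /=.
by rewrite mulN1r.
Qed.

Lemma CkB W k f g : open W -> Ck k W f -> Ck k W g -> Ck k W (fun z => f z - g z).
Proof. by move=> Wo fC gC; apply: CkD => //; exact: CkN. Qed.

Lemma Ck_sum W k (I : Type) (r : seq I) (F : I -> V -> R) : open W ->
  (forall l, Ck k W (F l)) -> Ck k W (fun z => \sum_(l <- r) F l z).
Proof.
move=> Wo FC; elim: r => [|l r IH].
  by under [X in Ck _ _ X]funext do rewrite big_nil; exact: Ck_cst.
by under [X in Ck _ _ X]funext do rewrite big_cons; exact: CkD.
Qed.

Lemma Ck_prod W k (I : Type) (r : seq I) (F : I -> V -> R) : open W ->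
  (forall l, Ck k W (F l)) -> Ck k W (fun z => \prod_(l <- r) F l z).
Proof.
move=> Wo FC; elim: r => [|l r IH].
  by under [X in Ck _ _ X]funext do rewrite big_nil; exact: Ck_cst.
by under [X in Ck _ _ X]funext do rewrite big_cons; exact: CkM.
Qed.

(** The derivative of 1/f is - (1/f) (1/f) f', and the induction hypothesis applies to 1/f
    itself. *)
Lemma CkV W k f : open W -> (forall z, W z -> f z != 0) -> Ck k W f ->
  Ck k W (fun z => (f z)^-1).
Proof.
move=> Wo f0; elim: k f f0 => [|k IH] f f0 fC.
  by move=> x Wx; apply: continuousV; [exact: f0|exact: fC].
apply: CkS_intro => [y Wy|i].
  by apply: differentiableV; [exact: (CkS_differentiable Wo fC Wy)|exact: f0].
have iC := IH _ f0 (CkW Wo fC).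
apply: (Ck_eq Wo _ (CkN Wo (CkM Wo (CkM Wo iC iC) (fC.2 i)))) => z Wz /=.
rewrite pdV //; [|exact: (CkS_differentiable Wo fC Wz)|exact: f0].
by rewrite expr2 invfM mulNr.
Qed.

Lemma Ck_coord W k j : Ck k W (fun z : V => z 0 j).
Proof.
case: k => [|k]; first by move=> x _; exact: coord_continuous.
apply: CkS_intro => [y _|i]; first exact: differentiable_coord.
by rewrite (_ : pd i _ = fun=> (i == j)%:R); [exact: Ck_cst|apply/funext => x; exact: pd_coord].
Qed.

Lemma continuous_rV (T : topologicalType) m (tau : T -> 'rV[R]_m) (y : T) :
  (forall j : 'I_m, {for y, continuous (fun z : T => tau z 0 j)}) -> {for y, continuous tau}.
Proof.
move=> ct; rewrite /prop_for /continuous_at.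
apply/cvgrPdist_lt => e e0.
have : \forall t \near y, forall j : 'I_m, `|tau y 0 j - tau t 0 j| < e.
  apply: filter_forall => j.
  by have /cvgrPdist_lt/(_ _ e0) := ct j.
apply: filterS => t H; apply: norm_rV_lt => // j; rewrite !mxE; exact: H.
Qed.

Lemma Ck_comp U W k f (tau : V -> V) : open U -> open W ->
  (forall y, U y -> W (tau y)) -> (forall j, Ck k U (fun z => tau z 0 j)) ->
  Ck k W f -> Ck k U (fun z => f (tau z)).
Proof.
move=> Uo Wo UW; elim: k f => [|k IH] f tC fC.
  move=> x Ux; apply: (@continuous_comp _ _ _ tau f); last exact/fC/UW.
  by apply: continuous_rV => j; exact: tC.
have dt y j : U y -> differentiable (fun z => tau z 0 j) y.
  by move=> Uy; exact: (CkS_differentiable Uo (tC j) Uy).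
apply: CkS_intro => [y Uy|i].
  by apply: differentiable_compV => [j|]; [exact: dt|exact: (CkS_differentiable Wo fC (UW _ Uy))].
have tC' j : Ck k U (fun z => tau z 0 j) by exact/CkW/tC.
pose F j z := pd i (fun z => tau z 0 j) z * pd j f (tau z).
apply: (@Ck_eq _ _ (fun z => \sum_j F j z)) => //.
  move=> z Uz; rewrite pd_comp // => [j|]; first exact: dt.
  exact: (CkS_differentiable Wo fC (UW _ Uz)).
apply: Ck_sum => // j; apply: CkM => //; first exact: (tC j).2.
by apply: IH => //; exact: fC.2.
Qed.

Lemma Ck_sqrt W k f : open W -> (forall z, W z -> 0 < f z) -> Ck k W f ->
  Ck k W (fun z => Num.sqrt (f z)).
Proof.
move=> Wo f0; elim: k f f0 => [|k IH] f f0 fC.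
  by move=> x Wx; apply: (@continuous_comp _ _ _ f Num.sqrt); [exact: fC|exact: sqrt_continuous].
have ds z : W z -> derivable Num.sqrt (f z) 1.
  by move=> /f0 /is_derive1_sqrt[].
have df z : W z -> differentiable f z by move=> Wz; exact: (CkS_differentiable Wo fC Wz).
apply: CkS_intro => [y Wy|i].
  by apply: (@differentiable_comp _ _ _ _ f Num.sqrt); [exact: df|exact/derivable1_diffP/ds].
have sC := IH _ f0 (CkW Wo fC).
have s0 z : W z -> 2 * Num.sqrt (f z) != 0.
  by move=> Wz; rewrite mulf_neq0 // gt_eqF // sqrtr_gt0 f0.
apply: (Ck_eq Wo _ (CkM Wo (CkV Wo s0 (CkM Wo (Ck_cst W k 2) sC)) (fC.2 i))) => z Wz /=.
rewrite pd_comp_real //; [|exact: df|exact: ds].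
by rewrite derive1E (@derive_val _ _ _ _ _ _ _ (is_derive1_sqrt (f0 _ Wz))).
Qed.

Lemma Ck_det W k m (A : V -> 'M[R]_m) : open W ->
  (forall i j : 'I_m, Ck k W (fun z => A z i j)) -> Ck k W (fun z => \det (A z)).
Proof.
move=> Wo AC; rewrite /determinant; apply: Ck_sum => // s.
apply: CkM => //; first exact: Ck_cst.
by apply: Ck_prod => // i.
Qed.

Lemma Ck_invmx W k m (A : V -> 'M[R]_m) (i j : 'I_m) : open W ->
  (forall z, W z -> A z \in unitmx) ->
  (forall i j : 'I_m, Ck k W (fun z => A z i j)) -> Ck k W (fun z => invmx (A z) i j).
Proof.
move=> Wo A1 AC.
have dC := Ck_det Wo AC.
have d0 z : W z -> \det (A z) != 0 by move=> /A1; rewrite unitmxE unitfE.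
apply: (@Ck_eq _ _ (fun z => (\det (A z))^-1 * ((-1) ^+ (j + i) * \det (row' j (col' i (A z)))))) => //.
  by move=> z Wz; rewrite /invmx A1 // !mxE.
apply: CkM => //; first exact: CkV.
apply: CkM => //; first exact: Ck_cst.
apply: Ck_det => // a b.
under [X in Ck _ _ X]funext do rewrite !mxE.
exact: AC.
Qed.

End CkCalculus.

Opaque pd.

(** * Bochner's identity in coordinates *)

Section ConnectionIdentity.
Variables (R : realType) (n : nat).
Local Notation V := 'rV[R]_n.
Variables (Gam : 'I_n -> 'I_n -> 'I_n -> V -> R) (xi : 'I_n -> V -> R) (x : V).
Hypothesis Gam_diff : forall k i j, differentiable (Gam k i j) x.
Hypothesis Gam_sym : forall k i j, Gam k i j x = Gam k j i x.
Hypothesis xi_diff : forall k, differentiable (xi k) x.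
Hypothesis dxi_diff : forall i k, differentiable (pd i (xi k)) x.
Hypothesis ddxi_sym : forall i j k, pd i (pd j (xi k)) x = pd j (pd i (xi k)) x.

(** nabla_i xi^k for a vector field xi. The section treats an arbitrary torsion-free connection; the
    metric enters later, through the passage between vector fields and 1-forms. *)
Definition cov_deriv (i k : 'I_n) (y : V) : R :=
  pd i (xi k) y + \sum_p Gam k i p y * xi p y.

Lemma cov_deriv_diff i k : differentiable (cov_deriv i k) x.
Proof.
apply: differentiable_add => //; apply: differentiable_bigsum => p.
exact: differentiable_mul.
Qed.

Lemma pd_cov_deriv l i k : pd l (cov_deriv i k) x =
  pd l (pd i (xi k)) x +
  \sum_p (pd l (Gam k i p) x * xi p x + Gam k i p x * pd l (xi p) x).
Proof.
have dGx p : differentiable (fun y => Gam k i p y * xi p y) x.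
  exact: differentiable_mul.
rewrite pdD //; last exact: differentiable_bigsum.
congr (_ + _); rewrite pd_sum //; apply: eq_bigr => p _.
exact: pdM.
Qed.

Definition connection_ricci (j k : 'I_n) : R :=
  \sum_i (pd i (Gam i j k) x - pd j (Gam i i k) x
    + \sum_p (Gam i i p x * Gam p j k x - Gam i j p x * Gam p i k x)).

(** Contracted Ricci identity: the left side is nabla_i nabla_j xi^i - nabla_j nabla_i xi^i, where
    the second term is the plain derivative of the function div xi. Second derivatives of xi cancel
    by Schwarz, first derivatives by the symmetry of [Gam]; the curvature remains. *)
Lemma commutator_ricci j :
  \sum_i (pd i (cov_deriv j i) x - pd j (cov_deriv i i) x
    + \sum_p Gam i i p x * cov_deriv j p x
    - \sum_p Gam p i j x * cov_deriv p i x) =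
  \sum_k connection_ricci j k * xi k x.
Proof.
(* [E] collects the derivatives of [Gam], [F] and [F'] the first derivatives of [xi], [Q] and [Q']
   the products of two [Gam]. *)
pose E i := \sum_p ((pd i (Gam i j p) x - pd j (Gam i i p) x) * xi p x).
pose F i := \sum_p (Gam i j p x * pd i (xi p) x).
pose F' i := \sum_p (Gam p i j x * pd p (xi i) x).
pose Q i := \sum_p \sum_k Gam i i p x * Gam p j k x * xi k x.
pose Q' i := \sum_p \sum_k Gam p i j x * Gam i p k x * xi k x.
transitivity (\sum_i (E i + F i + Q i - (F' i + Q' i))).
  apply: eq_bigr => i _; rewrite !pd_cov_deriv (ddxi_sym j i i).
  have -> : \sum_p Gam i i p x * cov_deriv j p x =
      \sum_p (Gam i i p x * pd j (xi p) x) + Q i.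
    rewrite -big_split /=; apply: eq_bigr => p _.
    rewrite /cov_deriv mulrDr; congr (_ + _); rewrite mulr_sumr.
    by apply: eq_bigr => k _; rewrite mulrA.
  have -> : \sum_p Gam p i j x * cov_deriv p i x = F' i + Q' i.
    rewrite -big_split /=; apply: eq_bigr => p _.
    rewrite /cov_deriv mulrDr; congr (_ + _); rewrite mulr_sumr.
    by apply: eq_bigr => k _; rewrite mulrA.
  have -> : E i = \sum_p (pd i (Gam i j p) x * xi p x) -
                  \sum_p (pd j (Gam i i p) x * xi p x).
    by rewrite -sumrB; apply: eq_bigr => p _; rewrite mulrBl.
  rewrite !big_split /=.
  move: (pd i _ x) (Q i) (F' i + Q' i) => a q f.
  rewrite /F; move: (\sum_p _) (\sum_p _) (\sum_p _) (\sum_p _) => s1 s2 s3 s4.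
  ring.
rewrite sumrB !big_split /=.
have -> : \sum_i F' i = \sum_i F i.
  rewrite exchange_big /=; apply: eq_bigr => i _; apply: eq_bigr => p _.
  by rewrite Gam_sym.
have -> : \sum_i Q' i = \sum_i \sum_p \sum_k Gam i j p x * Gam p i k x * xi k x.
  rewrite exchange_big /=; apply: eq_bigr => i _; apply: eq_bigr => p _.
  by apply: eq_bigr => k _; rewrite (Gam_sym i p j).
transitivity (\sum_i (E i + (Q i - \sum_p \sum_k Gam i j p x * Gam p i k x * xi k x))).
  rewrite !big_split /= sumrN.
  move: (\sum_i E i) (\sum_i F i) (\sum_i Q i) (\sum_i _) => a b c d; ring.
have -> : \sum_k connection_ricci j k * xi k x =
  \sum_i \sum_k (pd i (Gam i j k) x - pd j (Gam i i k) x
    + \sum_p (Gam i i p x * Gam p j k x - Gam i j p x * Gam p i k x)) * xi k x.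
  rewrite exchange_big /=; apply: eq_bigr => k _.
  by rewrite /connection_ricci mulr_suml.
apply: eq_bigr => i _.
rewrite /Q exchange_big /= [X in _ - X]exchange_big /= -sumrB -big_split /=.
apply: eq_bigr => k _; rewrite [RHS]mulrDl; congr (_ + _).
by rewrite mulr_suml -sumrB; apply: eq_bigr => p _; rewrite mulrBl.
Qed.

(** Y^i = xi^j nabla_j xi^i - (div xi) xi^i, and the left side is the divergence of Y. By the
    product rule it contains xi^j (nabla_i nabla_j xi^i - nabla_j nabla_i xi^i), which
    [commutator_ricci] turns into Ric(xi, xi). *)
Lemma divergence_bochner :
  let Y i y := \sum_j xi j y * cov_deriv j i y - (\sum_j cov_deriv j j y) * xi i y in
  \sum_i (pd i (Y i) x + \sum_p Gam i i p x * Y p x) =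
  \sum_i \sum_j cov_deriv i j x * cov_deriv j i x
  - (\sum_i cov_deriv i i x) ^+ 2
  + \sum_j \sum_k connection_ricci j k * xi j x * xi k x.
Proof.
move=> Y.
have dA := cov_deriv_diff.
pose t := \sum_j cov_deriv j j x.
have dxA i j : differentiable (fun y => xi j y * cov_deriv j i y) x.
  exact: differentiable_mul.
have dtr : differentiable (fun y => \sum_j cov_deriv j j y) x.
  by apply: differentiable_bigsum => j; exact: dA.
have pdY i : pd i (Y i) x =
    \sum_j (pd i (xi j) x * cov_deriv j i x + xi j x * pd i (cov_deriv j i) x)
    - ((\sum_j pd i (cov_deriv j j) x) * xi i x + t * pd i (xi i) x).
  rewrite pdB; [|exact: differentiable_bigsum|exact: differentiable_mul].
  rewrite pdM // !pd_sum //.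
  by congr (_ - _); apply: eq_bigr => j _; rewrite pdM.
have -> : \sum_j \sum_k connection_ricci j k * xi j x * xi k x =
    \sum_j xi j x * \sum_k connection_ricci j k * xi k x.
  apply: eq_bigr => j _; rewrite mulr_sumr; apply: eq_bigr => k _.
  by rewrite mulrCA mulrA.
under [X in _ + X]eq_bigr do rewrite -commutator_ricci mulr_sumr.
rewrite [X in _ + X]exchange_big /= expr2 -/t mulr_suml.
have tE : t * t = \sum_i t * cov_deriv i i x by rewrite mulr_sumr.
rewrite [X in _ - X](_ : _ = \sum_i t * cov_deriv i i x); last first.
  by apply: eq_bigr => i _; rewrite mulrC.
pose c i := \sum_j pd i (cov_deriv j j) x * xi i x.
pose d i := \sum_j xi j x * pd j (cov_deriv i i) x.
have cd : \sum_i c i = \sum_i d i.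
  rewrite /c exchange_big /=; apply: eq_bigr => i _; apply: eq_bigr => j _.
  exact: mulrC.
pose b i := \sum_j \sum_p Gam j i p x * xi p x * cov_deriv j i x.
pose b' i := \sum_j xi j x * \sum_p Gam p i j x * cov_deriv p i x.
have bb i : b i = b' i.
  rewrite /b exchange_big /=; apply: eq_bigr => j _; rewrite mulr_sumr.
  by apply: eq_bigr => p _; rewrite mulrCA mulrA.
pose a2 i := \sum_j cov_deriv i j x * cov_deriv j i x.
pose e i := \sum_j xi j x * pd i (cov_deriv j i) x.
pose f i := \sum_j xi j x * \sum_p Gam i i p x * cov_deriv j p x.
have LE i : pd i (Y i) x + \sum_p Gam i i p x * Y p x =
    a2 i - b i + e i - c i + f i - t * cov_deriv i i x.
  rewrite pdY big_split /= mulr_suml -/(c i) -/(e i).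
  have -> : \sum_j pd i (xi j) x * cov_deriv j i x = a2 i - b i.
    rewrite /b /a2 -sumrB; apply: eq_bigr => j _; rewrite -mulr_suml -mulrBl.
    by congr (_ * _); rewrite /cov_deriv addrK.
  have -> : \sum_p Gam i i p x * Y p x = f i - t * \sum_p Gam i i p x * xi p x.
    rewrite /Y; under eq_bigr do rewrite mulrBr.
    rewrite sumrB; congr (_ - _).
      under eq_bigr do rewrite mulr_sumr.
      rewrite exchange_big /=; apply: eq_bigr => j _; rewrite mulr_sumr.
      by apply: eq_bigr => p _; rewrite mulrCA.
    by rewrite mulr_sumr; apply: eq_bigr => p _; rewrite mulrCA.
  rewrite /cov_deriv.
  move: (pd i (xi i) x) (\sum_p Gam i i p x * xi p x) => u v.
  move: (a2 i) (b i) (e i) (c i) (f i) => *; ring.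
under eq_bigr do rewrite LE.
rewrite !(sumrB, big_split) /= cd.
have -> : \sum_i \sum_j xi j x *
      (pd i (cov_deriv j i) x - pd j (cov_deriv i i) x +
       \sum_p Gam i i p x * cov_deriv j p x - \sum_p Gam p i j x * cov_deriv p i x) =
    \sum_i e i - \sum_i d i + \sum_i f i - \sum_i b i.
  rewrite -!sumrB -big_split -sumrB /=; apply: eq_bigr => i _.
  rewrite bb /e /f /d /b' -sumrB -big_split -sumrB /=.
  by apply: eq_bigr => j _; rewrite mulrBr mulrDr mulrBr.
rewrite -[\sum_i \sum_j cov_deriv i j x * _]/(\sum_i a2 i).
move: (\sum_i a2 i) (\sum_i b i) (\sum_i d i) (\sum_i e i) (\sum_i f i) (\sum_i t * _) => *.
ring.
Qed.

End ConnectionIdentity.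

(** * Positive definite matrices and the inner products they induce *)

Section PositiveMatrices.
Variable R : realType.

(** Cholesky factorisation by induction on n: split off the first row and pass to the Schur
    complement [C'] of the corner entry [p]. *)
Lemma posdef_factor n (P : 'M[R]_n) : posdef P -> exists Q : 'M[R]_n, P = Q^T *m Q.
Proof.
elim: n P => [|n IH] P [Ps Pp]; first by exists 0; apply/matrixP => -[].
pose p := P 0 0; pose r : 'rV[R]_n := ursubmx (P : 'M[R]_(1 + n)).
pose C : 'M[R]_n := drsubmx (P : 'M[R]_(1 + n)).
have PE : P = block_mx p%:M r r^T C :> 'M[R]_(1 + n).
  rewrite -[LHS](@submxK _ 1 n 1 n); congr block_mx.
    by apply/matrixP => i j; rewrite !ord1 !mxE eqxx mulr1n /p; congr (P _ _); exact/val_inj.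
  by rewrite /r -{1}Ps; apply/matrixP => i j; rewrite !mxE.
have rowE (a : 'M[R]_1) (v : 'rV[R]_n) : (row_mx a v *m P *m (row_mx a v)^T) 0 0 =
    p * a 0 0 ^+ 2 + 2 * a 0 0 * (v *m r^T) 0 0 + (v *m C *m v^T) 0 0.
  rewrite PE (mul_row_block a v p%:M r r^T C) tr_row_mx (mul_row_col _ _ a^T v^T).
  rewrite !mulmxDl !mul_mx_scalar.
  have E : a = (a 0 0)%:M by apply/matrixP => i j; rewrite !ord1 mxE eqxx mulr1n.
  rewrite {1 2 3 4}E !tr_scalar_mx !mul_mx_scalar !mul_scalar_mx -!scalemxAl.
  have -> : r *m v^T = v *m r^T.
    by rewrite -[LHS]trmxK trmx_mul trmxK; apply/matrixP => i j; rewrite !ord1 mxE.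
  by rewrite !mxE eqxx mulr1n; ring.
have p0 : 0 < p.
  have := Pp (row_mx (1%:M : 'M[R]_1) (0 : 'rV[R]_n)).
  rewrite rowE !mul0mx !mxE eqxx expr1n !mulr1 mulr0 !addr0; apply.
  apply/eqP => /(congr1 (fun v : 'rV[R]_(1 + n) => lsubmx v 0 0)).
  by rewrite row_mxKl !mxE eqxx => /eqP; rewrite oner_eq0.
pose C' := C - p^-1 *: (r^T *m r).
have Cs : C^T = C by rewrite /C trmx_drsub Ps.
have C'p : posdef C'.
  split=> [|v v0].
    by rewrite /C' linearB linearZ /= trmx_mul trmxK Cs.
  (* For given v this first coordinate minimises the quadratic form of P, and the minimum is the
     form of [C'] at v. *)
  have := Pp (row_mx (- (p^-1 *: (v *m r^T)) : 'M[R]_1) v).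
  rewrite rowE => H; apply: lt_le_trans (H _) _ => {H}.
    apply/eqP => /(congr1 (fun v : 'rV[R]_(1 + n) => rsubmx v)).
    by rewrite row_mxKr linear0; exact/eqP.
  rewrite /C' mulmxBr mulmxBl -scalemxAr -scalemxAl.
  have -> : v *m (r^T *m r) *m v^T = (v *m r^T) *m (v *m r^T)^T.
    by rewrite trmx_mul trmxK !mulmxA.
  move: (v *m r^T) => u.
  have -> : (u *m u^T) = ((u 0 0) ^+ 2)%:M.
    by apply/matrixP => i j; rewrite !ord1 !mxE big_ord1 mxE eqxx mulr1n expr2.
  rewrite [leRHS]mxE [X in _ <= _ + X]mxE [X in _ <= _ - X]mxE !mxE eqxx mulr1n.
  have pn : p != 0 by rewrite gt_eqF.
  by rewrite le_eqVlt; apply/orP; left; apply/eqP; field.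
have [Q' Q'E] := IH _ C'p.
exists (block_mx (Num.sqrt p)%:M ((Num.sqrt p)^-1 *: r) 0 Q' : 'M[R]_(1 + n)).
have sp : Num.sqrt p != 0 by rewrite gt_eqF // sqrtr_gt0.
rewrite PE (@tr_block_mx _ 1 n 1 n) (@mulmx_block _ 1 n 1 n 1 n).
rewrite trmx0 !mul0mx !mulmx0 !addr0 tr_scalar_mx -scalar_mxM -expr2 sqr_sqrtr ?ltW //.
have -> : (Num.sqrt p)%:M *m ((Num.sqrt p)^-1 *: r) = r.
  by rewrite mul_scalar_mx scalerA mulfV // scale1r.
have -> : ((Num.sqrt p)^-1 *: r)^T *m (Num.sqrt p)%:M = r^T.
  by rewrite linearZ /= mul_mx_scalar scalerA mulfV // scale1r.
suff -> : ((Num.sqrt p)^-1 *: r)^T *m ((Num.sqrt p)^-1 *: r) + Q'^T *m Q' = C by [].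
rewrite -Q'E -scalemxAr [X in X *m _]linearZ /= -scalemxAl scalerA -invfM -expr2 sqr_sqrtr ?ltW //.
by rewrite addrC subrK.
Qed.

Lemma posdef_unit n (P : 'M[R]_n) : posdef P -> P \in unitmx.
Proof.
move=> [_ Pp]; rewrite -row_free_unit -kermx_eq0; apply/negPn/negP => k0.
have [i /eqP ri] : exists i, row i (kermx P) != 0.
  apply/existsP; apply: contraNT k0; rewrite negb_exists => /forallP H.
  by apply/eqP/row_matrixP => i; rewrite row0; apply/eqP; have := H i; rewrite negbK.
have /Pp : row i (kermx P) != 0 by apply/eqP.
by rewrite -row_mul mulmx_ker row0 mul0mx mxE ltxx.
Qed.

Lemma posdef_inv n (P : 'M[R]_n) : posdef P -> posdef (invmx P).
Proof.
move=> Pp; have Pu := posdef_unit Pp; case: Pp => Ps Pp; split.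
  by rewrite trmx_inv Ps.
move=> v v0; have := Pp (v *m invmx P).
rewrite mulmxKV // trmx_mul trmx_inv Ps mulmxA; apply.
by apply: contra_neq v0 => E; rewrite -(mulmxKV Pu v) E mul0mx.
Qed.

(** [Q] passes to an orthonormal frame: in [inner1_factor] and [inner2_factor] the inner products
    become the Euclidean ones of [u *m Q^T] and [Q *m a *m Q^T], so positivity and definiteness are
    read off from sums of squares. *)
Lemma posdef_inv_factor n (P : 'M[R]_n) : posdef P ->
  exists2 Q : 'M[R]_n, Q \in unitmx & invmx P = Q^T *m Q.
Proof.
move=> Pp; have [Q QE] := posdef_factor (posdef_inv Pp); exists Q => //.
have : invmx P \in unitmx by rewrite unitmx_inv posdef_unit.
by rewrite QE unitmx_mul => /andP[].
Qed.

Lemma posdef_det_gt0 n (P : 'M[R]_n) : posdef P -> 0 < \det P.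
Proof.
move=> Pp; have [Q QE] := posdef_factor Pp.
have := posdef_unit Pp; rewrite unitmxE unitfE QE det_mulmx det_tr -expr2 => q0.
by rewrite lt_neqAle eq_sym q0 sqr_ge0.
Qed.

End PositiveMatrices.

Section InnerProducts.
Variables (R : realType) (n : nat).
Implicit Types (G a b c : 'M[R]_n) (u v : 'rV[R]_n).

Lemma inner1E G u v : inner1 G u v = (u *m invmx G *m v^T) 0 0.
Proof.
rewrite /inner1 mxE exchange_big /=; apply: eq_bigr => j _.
rewrite !mxE mulr_suml; apply: eq_bigr => i _.
by rewrite [u 0 i * _]mulrC.
Qed.

Lemma inner2E G a b : (invmx G)^T = invmx G ->
  inner2 G a b = \tr (invmx G *m a *m invmx G *m b^T).
Proof.
move=> Gs; have gs i j : invmx G i j = invmx G j i by rewrite -{1}Gs mxE.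
rewrite /inner2 /mxtrace [RHS](eq_bigr (fun k => \sum_l \sum_j \sum_i
   (invmx G i k * invmx G j l * a i j * b k l))).
  rewrite exchange_big /=.
  under eq_bigr do rewrite exchange_big /=.
  rewrite exchange_big /=.
  apply: eq_bigr => k _.
  under eq_bigr do rewrite exchange_big /=.
  rewrite exchange_big /=.
  apply: eq_bigr => l _; apply: eq_bigr => j _; apply: eq_bigr => i _ //.
move=> k _; rewrite mxE; apply: eq_bigr => l _; rewrite !mxE mulr_suml.
apply: eq_bigr => j _; rewrite mxE !mulr_suml; apply: eq_bigr => i _.
by rewrite (gs k i); congr (_ * _); rewrite mulrAC.
Qed.

Section Metric.
Variable G : 'M[R]_n.
Hypothesis Gp : posdef G.

Lemma posdef_invmx_sym : (invmx G)^T = invmx G.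
Proof. by have [] := posdef_inv Gp. Qed.

Let i2E a b := inner2E a b posdef_invmx_sym.

Lemma inner2C a b : inner2 G a b = inner2 G b a.
Proof.
rewrite !i2E -[LHS]mxtrace_tr !trmx_mul trmxK posdef_invmx_sym.
by rewrite mxtrace_mulC !mulmxA -mulmxA mxtrace_mulC !mulmxA.
Qed.

Lemma inner2Dl a b c : inner2 G (a + b) c = inner2 G a c + inner2 G b c.
Proof. by rewrite !i2E mulmxDr !mulmxDl linearD. Qed.

Lemma inner2Zl (k : R) a b : inner2 G (k *: a) b = k * inner2 G a b.
Proof. by rewrite !i2E -scalemxAr -!scalemxAl linearZ. Qed.

Lemma inner2Dr a b c : inner2 G c (a + b) = inner2 G c a + inner2 G c b.
Proof. by rewrite inner2C inner2Dl !(inner2C c). Qed.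

Lemma inner2Zr (k : R) a b : inner2 G a (k *: b) = k * inner2 G a b.
Proof. by rewrite inner2C inner2Zl (inner2C a). Qed.

Lemma inner2_tr a b : inner2 G a^T b^T = inner2 G a b.
Proof.
rewrite !i2E trmxK -[LHS]mxtrace_tr !trmx_mul trmxK posdef_invmx_sym !mulmxA.
by rewrite mxtrace_mulC !mulmxA mxtrace_mulC !mulmxA mxtrace_mulC !mulmxA.
Qed.

Lemma inner2_G a : inner2 G a G = \tr (invmx G *m a).
Proof.
have [Gs _] := Gp; rewrite i2E Gs -!mulmxA mulVmx ?mulmx1 //.
exact: posdef_unit.
Qed.

Lemma inner2_factor (Q : 'M[R]_n) a b : invmx G = Q^T *m Q ->
  inner2 G a b = \sum_i \sum_j (Q *m a *m Q^T) i j * (Q *m b *m Q^T) i j.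
Proof.
move=> QE; rewrite i2E QE.
have -> : \tr (Q^T *m Q *m a *m (Q^T *m Q) *m b^T) =
          \tr ((Q *m a *m Q^T) *m (Q *m b *m Q^T)^T).
  by rewrite !trmx_mul trmxK -!mulmxA mxtrace_mulC !mulmxA.
apply: eq_bigr => i _; rewrite mxE; apply: eq_bigr => j _.
by rewrite [X in _ * X]mxE.
Qed.

Lemma inner1_factor (Q : 'M[R]_n) u v : invmx G = Q^T *m Q ->
  inner1 G u v = \sum_i (u *m Q^T) 0 i * (v *m Q^T) 0 i.
Proof.
move=> QE; rewrite inner1E QE !mulmxA -mulmxA -[Q *m v^T]trmxK trmx_mul trmxK.
by rewrite mxE; apply: eq_bigr => i _; rewrite [X in _ * X]mxE.
Qed.

Lemma inner2_ge0 a : 0 <= inner2 G a a.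
Proof.
have [Q _ QE] := posdef_inv_factor Gp; rewrite (inner2_factor _ _ QE).
by do 2!apply: sumr_ge0 => ? _; rewrite -expr2 sqr_ge0.
Qed.

Lemma inner1_ge0 u : 0 <= inner1 G u u.
Proof.
have [Q _ QE] := posdef_inv_factor Gp; rewrite (inner1_factor _ _ QE).
by apply: sumr_ge0 => ? _; rewrite -expr2 sqr_ge0.
Qed.

Lemma inner1C u v : inner1 G u v = inner1 G v u.
Proof.
have [Q _ QE] := posdef_inv_factor Gp; rewrite !(inner1_factor _ _ QE).
by apply: eq_bigr => i _; rewrite mulrC.
Qed.

Lemma inner1Dl u v w : inner1 G (u + v) w = inner1 G u w + inner1 G v w.
Proof. by rewrite !inner1E !mulmxDl mxE. Qed.

Lemma inner1Zl (k : R) u v : inner1 G (k *: u) v = k * inner1 G u v.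
Proof. by rewrite !inner1E -!scalemxAl mxE. Qed.

(** Symmetrisation is an orthogonal projection; the inequality is |a - a^T|^2 >= 0 expanded. *)
Lemma inner2_sym_part_le a :
  inner2 G (2^-1 *: (a + a^T)) (2^-1 *: (a + a^T)) <= inner2 G a a.
Proof.
have := inner2_ge0 (a - a^T).
rewrite inner2Zl inner2Zr -scaleN1r !(inner2Dl, inner2Dr, inner2Zl, inner2Zr) (inner2C a^T a) inner2_tr.
move: (inner2 G a a) (inner2 G a a^T) => u v; lra.
Qed.

End Metric.

Section ChangeOfBasis.
Variables (G F : 'M[R]_n).
Hypotheses (Gu : G \in unitmx) (Fu : F \in unitmx).

Lemma congr_unit : F *m G *m F^T \in unitmx.
Proof. by rewrite !unitmx_mul unitmx_tr Fu Gu. Qed.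

(** [F] is a change of frame: covectors become [u *m F^T], bilinear forms [F *m a *m F^T]. The
    inverse metric transforms contragrediently, so metric contractions do not see the frame; this
    makes the pointwise formulas independent of the chart. *)
Lemma congr_invmx : invmx (F *m G *m F^T) = (invmx F)^T *m invmx G *m invmx F.
Proof.
have Ftu : F^T \in unitmx by rewrite unitmx_tr.
apply: (can_inj (mulKmx congr_unit)); rewrite mulmxV ?congr_unit //.
rewrite !mulmxA trmx_inv mulmxK // mulmxK // mulmxV //.
Qed.

Lemma congr_mul_inv (u : 'rV[R]_n) :
  u *m F^T *m invmx (F *m G *m F^T) = u *m invmx G *m invmx F.
Proof.
by rewrite congr_invmx !mulmxA trmx_inv mulmxK ?unitmx_tr.
Qed.

Lemma congr_inner1 u v :
  inner1 (F *m G *m F^T) (u *m F^T) (v *m F^T) = inner1 G u v.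
Proof.
by rewrite !inner1E congr_mul_inv trmx_mul trmxK !mulmxA mulmxKV.
Qed.

Lemma congr_trace a :
  \tr (invmx (F *m G *m F^T) *m (F *m a *m F^T)) = \tr (invmx G *m a).
Proof.
rewrite congr_invmx !mulmxA mulmxKV // mxtrace_mulC !mulmxA trmx_inv mulmxV ?unitmx_tr //.
by rewrite mul1mx.
Qed.

Lemma congr_posdef : posdef G -> posdef (F *m G *m F^T).
Proof.
move=> [Gs Gp]; split; first by rewrite !trmx_mul trmxK Gs !mulmxA.
move=> v v0; have := Gp (v *m F); rewrite trmx_mul !mulmxA; apply.
by apply: contra_neq v0 => E; rewrite -(mulmxK Fu v) E mul0mx.
Qed.

End ChangeOfBasis.

Lemma congr_inner2 G F a b : posdef G -> F \in unitmx ->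
  inner2 (F *m G *m F^T) (F *m a *m F^T) (F *m b *m F^T) = inner2 G a b.
Proof.
move=> Gp Fu; have Gu := posdef_unit Gp.
have Hp := congr_posdef Fu Gp.
rewrite !inner2E ?posdef_invmx_sym // congr_invmx // !trmx_mul trmxK !mulmxA.
rewrite !mulmxKV // trmx_inv.
rewrite -!mulmxA (mulmxA F^T) mulmxV ?unitmx_tr // mul1mx !mulmxA mxtrace_mulC.
by rewrite !mulmxA mulmxV ?unitmx_tr // mul1mx.
Qed.

End InnerProducts.

(** * Levi-Civita connection, divergence and volume density in coordinates *)

Section CoordinateTensors.
Variables (R : realType) (n : nat).
Local Notation V := 'rV[R]_n.
Variables (W : set V) (G : V -> 'M[R]_n).
Implicit Types (eta zeta xi : V -> V) (y z : V).
Hypothesis Wo : open W.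
Hypothesis GC : forall k i j, Ck k W (fun y => G y i j).
Hypothesis Gp : forall y, W y -> posdef (G y).

Definition nabla1_mx (eta : V -> V) (y : V) : 'M[R]_n := \matrix_(i, j) nabla1 G eta y i j.

Definition cov_mx (xi : V -> V) (y : V) : 'M[R]_n :=
  \matrix_(i, k) cov_deriv (christoffel G) (fun k z => xi z 0 k) i k y.

Definition div1 (eta : V -> V) (y : V) : R := \tr (invmx (G y) *m nabla1_mx eta y).

Definition sharp (eta : V -> V) (y : V) : V := eta y *m invmx (G y).

Definition flat (xi : V -> V) (y : V) : V := xi y *m G y.

Definition diff_row (eta : V -> V) (y : V) := forall j, differentiable (fun z => eta z 0 j) y.
Definition diff_mx (h : V -> 'M[R]_n) (y : V) := forall i j, differentiable (fun z => h z i j) y.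

Let Gs y i j : W y -> G y i j = G y j i.
Proof. by move=> /Gp[E _]; rewrite -{1}E mxE. Qed.

Let Gu y : W y -> G y \in unitmx.
Proof. by move=> /Gp /posdef_unit. Qed.

Lemma metric_diff y : W y -> diff_mx G y.
Proof. by move=> Wy i j; exact: (CkS_differentiable Wo (GC 1 i j) Wy). Qed.

Lemma pd_metric_sym y l i j : W y -> pd l (fun z => G z i j) y = pd l (fun z => G z j i) y.
Proof. by move=> Wy; apply: (pd_eq _ Wo Wy) => z /Gs. Qed.

Lemma invmx_metric_Ck k i j : Ck k W (fun y => invmx (G y) i j).
Proof. by apply: Ck_invmx. Qed.

Lemma invmx_metric_diff y : W y -> diff_mx (fun y => invmx (G y)) y.
Proof. by move=> Wy i j; exact: (CkS_differentiable Wo (invmx_metric_Ck 1 i j) Wy). Qed.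

Lemma christoffel_Ck m k i j : Ck m W (christoffel G k i j).
Proof.
rewrite /christoffel; apply: CkM => //; first exact: Ck_cst.
apply: Ck_sum => // l; apply: CkM => //; first exact: invmx_metric_Ck.
by apply: CkB => //; first apply: CkD => //; [exact: (GC m.+1 _ _).2..].
Qed.

Lemma christoffel_diff y k i j : W y -> differentiable (christoffel G k i j) y.
Proof. by move=> Wy; exact: (CkS_differentiable Wo (christoffel_Ck 1 k i j) Wy). Qed.

Lemma christoffel_sym y k i j : W y -> christoffel G k i j y = christoffel G k j i y.
Proof.
move=> Wy; rewrite /christoffel; congr (_ * _); apply: eq_bigr => l _.
by rewrite (pd_metric_sym l i j Wy) [X in X - _]addrC.
Qed.

(** Christoffel symbol of the first kind Gamma_{q,ij}. It is free of the inverse metric, which makes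
    metric compatibility and the transformation law easier to check. *)
Definition christoffel1 (y : V) (i j q : 'I_n) : R := 2^-1 *
  (pd i (fun z => G z j q) y + pd j (fun z => G z i q) y - pd q (fun z => G z i j) y).

Lemma christoffel_lower y i j q : W y ->
  \sum_p G y q p * christoffel G p i j y = christoffel1 y i j q.
Proof.
move=> Wy; rewrite /christoffel1.
pose b l := pd i (fun z => G z j l) y + pd j (fun z => G z i l) y - pd l (fun z => G z i j) y.
transitivity (2^-1 * (G y *m invmx (G y) *m (\col_l b l)) q 0); last first.
  by rewrite mulmxV ?Gu // mul1mx mxE.
rewrite -mulmxA mxE mulr_sumr; apply: eq_bigr => p _.
by rewrite /christoffel mulrCA; congr (_ * (_ * _)); rewrite mxE; apply: eq_bigr => l _; rewrite mxE.
Qed.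

(** Metric compatibility: d_i g_qj = Gamma_{q,ij} + Gamma_{j,iq}. *)
Lemma christoffel1_compat y i j q : W y ->
  pd i (fun z => G z q j) y - christoffel1 y i j q = christoffel1 y i q j.
Proof.
move=> Wy; rewrite /christoffel1 (pd_metric_sym i j q Wy) (pd_metric_sym j i q Wy) (pd_metric_sym q i j Wy).
rewrite (pd_metric_sym j q i Wy) (pd_metric_sym q j i Wy).
move: (pd i _ y) (pd j _ y) (pd q _ y) => a b c.
by field.
Qed.

Lemma nabla1_mx_eq (eta eta' : V -> V) y : W y -> (forall z, W z -> eta z = eta' z) ->
  nabla1_mx eta y = nabla1_mx eta' y.
Proof.
move=> Wy E; apply/matrixP => i j; rewrite !mxE /nabla1 (E _ Wy); congr (_ - _).
by apply: (pd_eq _ Wo Wy) => z Wz; rewrite E.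
Qed.

Lemma flat_sharp (eta : V -> V) y : W y -> flat (sharp eta) y = eta y.
Proof. by move=> Wy; rewrite /flat /sharp mulmxKV // Gu. Qed.

(** The connection is metric, so it commutes with lowering an index. This carries the vector field
    identity [divergence_bochner] over to 1-forms. *)
Lemma nabla1_flat xi y : W y -> diff_row xi y ->
  nabla1_mx (flat xi) y = cov_mx xi y *m G y.
Proof.
move=> Wy dxi; apply/matrixP => i j; rewrite !mxE /nabla1.
have -> : (fun z => flat xi z 0 j) = (fun z => \sum_k xi z 0 k * G z k j).
  by apply/funext => z; rewrite mxE.
have dG := metric_diff Wy.
rewrite pd_sum; last by move=> k; exact: differentiable_mul.
have -> : \sum_p christoffel G p i j y * flat xi y 0 p =
          \sum_q xi y 0 q * christoffel1 y i j q.
  under eq_bigr do rewrite mxE mulr_sumr.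
  rewrite exchange_big /=; apply: eq_bigr => q _.
  rewrite -christoffel_lower // mulr_sumr; apply: eq_bigr => p _.
  by rewrite mulrCA [christoffel _ _ _ _ _ * _]mulrC.
transitivity (\sum_k (pd i (fun z => xi z 0 k) y * G y k j + xi y 0 k * christoffel1 y i k j)).
  rewrite -sumrB; apply: eq_bigr => k _.
  by rewrite pdM // -addrA -mulrBr christoffel1_compat.
rewrite big_split /=; under [RHS]eq_bigr do rewrite mxE mulrDl.
rewrite big_split /=; congr (_ + _).
under [RHS]eq_bigr do rewrite mulr_suml.
rewrite exchange_big /=; apply: eq_bigr => k _.
rewrite -christoffel_lower // mulr_sumr; apply: eq_bigr => p _.
by rewrite (Gs j p Wy) mulrCA mulrC; congr (_ * _); exact: mulrC.
Qed.

Lemma nabla1_sharp eta y : W y -> diff_row (sharp eta) y ->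
  nabla1_mx eta y = cov_mx (sharp eta) y *m G y.
Proof.
move=> Wy d; rewrite -nabla1_flat //; apply: nabla1_mx_eq => // z Wz.
by rewrite flat_sharp.
Qed.

Lemma div1_flat xi y : W y -> diff_row xi y ->
  div1 (flat xi) y = \sum_i cov_deriv (christoffel G) (fun k z => xi z 0 k) i i y.
Proof.
move=> Wy d; rewrite /div1 nabla1_flat // mxtrace_mulC mulmxK ?Gu //.
by apply: eq_bigr => i _; rewrite mxE.
Qed.

Lemma div1_sharp eta y : W y -> diff_row (sharp eta) y ->
  div1 eta y = \tr (cov_mx (sharp eta) y).
Proof.
by move=> Wy d; rewrite /div1 nabla1_sharp // mxtrace_mulC mulmxK ?Gu.
Qed.

Lemma div1_eq (eta eta' : V -> V) y : W y -> (forall z, W z -> eta z = eta' z) ->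
  div1 eta y = div1 eta' y.
Proof. by move=> Wy E; rewrite /div1 (nabla1_mx_eq Wy E). Qed.

Lemma sharp_diff eta y : W y -> diff_row eta y -> diff_row (sharp eta) y.
Proof.
move=> Wy de j.
under [X in differentiable X _]funext do rewrite mxE.
apply: differentiable_bigsum => k; apply: differentiable_mul => //.
exact: invmx_metric_diff.
Qed.

Lemma sharp_Ck m eta j : (forall j, Ck m W (fun y => eta y 0 j)) ->
  Ck m W (fun y => sharp eta y 0 j).
Proof.
move=> eC; under [X in Ck _ _ X]funext do rewrite mxE.
by apply: Ck_sum => // k; apply: CkM => //; exact: invmx_metric_Ck.
Qed.

Lemma nabla1_Ck m eta i j : (forall j, Ck m.+1 W (fun y => eta y 0 j)) ->
  Ck m W (fun y => nabla1_mx eta y i j).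
Proof.
move=> eC; under [X in Ck _ _ X]funext do rewrite mxE /nabla1.
apply: CkB => //; first exact: (eC j).2.
apply: Ck_sum => // k; apply: CkM => //; first exact: christoffel_Ck.
exact: CkW.
Qed.

Lemma nabla1D eta zeta y : diff_row eta y -> diff_row zeta y ->
  nabla1_mx (fun z => eta z + zeta z) y = nabla1_mx eta y + nabla1_mx zeta y.
Proof.
move=> de dz; apply/matrixP => i j; rewrite !mxE /nabla1.
under [X in pd _ X]funext do rewrite mxE.
rewrite pdD //; under eq_bigr do rewrite mxE mulrDr.
rewrite big_split /=; move: (pd i _ y) (pd i _ y) (\sum_p _) (\sum_p _) => *; ring.
Qed.

Lemma nabla1Mf (f : V -> R) eta y : differentiable f y -> diff_row eta y ->
  nabla1_mx (fun z => f z *: eta z) y =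
  (\col_i pd i f y) *m eta y + f y *: nabla1_mx eta y.
Proof.
move=> df de; apply/matrixP => i j; rewrite !mxE /nabla1.
under [X in pd _ X]funext do rewrite mxE.
rewrite pdM // big_ord1 mxE mulrBr -addrA; congr (_ + (_ - _)).
by rewrite mulr_sumr; apply: eq_bigr => p _; rewrite mxE mulrCA.
Qed.

Lemma div1D eta zeta y : diff_row eta y -> diff_row zeta y ->
  div1 (fun z => eta z + zeta z) y = div1 eta y + div1 zeta y.
Proof. by move=> de dz; rewrite /div1 nabla1D // mulmxDr linearD. Qed.

Lemma div1Mf (f : V -> R) eta y : W y -> differentiable f y -> diff_row eta y ->
  div1 (fun z => f z *: eta z) y =
  \sum_i pd i f y * sharp eta y 0 i + f y * div1 eta y.
Proof.
move=> Wy df de; rewrite /div1 nabla1Mf // mulmxDr linearD /= -scalemxAr linearZ /=.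
congr (_ + _); rewrite mulmxA mxtrace_mulC mulmxA -/(sharp eta y).
rewrite /mxtrace big_ord1 mxE; apply: eq_bigr => i _.
by rewrite [X in _ * X]mxE mulrC.
Qed.

(** Jacobi's formula. Differentiating the Leibniz expansion replaces one row at a time by its
    derivative; expanding along that row gives the adjugate. *)
Lemma pd_det y l : W y ->
  pd l (fun z => \det (G z)) y =
  \det (G y) * \tr (invmx (G y) *m (\matrix_(i, j) pd l (fun z => G z i j) y)).
Proof.
move=> Wy; have dG := metric_diff Wy.
have dprod (s : 'I_n -> 'I_n) : differentiable (fun z => \prod_i G z i (s i)) y.
  by apply: differentiable_bigprod => i; exact: dG.
transitivity (\sum_i \sum_j pd l (fun z => G z i j) y * cofactor (G y) i j).
  rewrite /determinant pd_sum; last first.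
    by move=> s; apply: differentiable_mul; [exact: differentiable_cst|exact: dprod].
  pose Gi i : 'M[R]_n := \matrix_(k, j) if k == i then pd l (fun z => G z i j) y else G y k j.
  transitivity (\sum_i \det (Gi i)); last first.
    apply: eq_bigr => i _; rewrite (expand_det_row _ i); apply: eq_bigr => j _.
    rewrite mxE eqxx; congr (_ * _); rewrite /cofactor; congr (_ * \det _).
    by apply/matrixP => a b; rewrite !mxE eq_sym (negbTE (neq_lift _ _)).
  rewrite /determinant exchange_big /=; apply: eq_bigr => s _.
  rewrite pdMl; last exact: dprod.
  rewrite pd_bigprod ?index_enum_uniq //.
  rewrite mulr_sumr; apply: eq_bigr => i _; congr (_ * _).
  rewrite [RHS](bigD1 i) //= mxE eqxx; congr (_ * _).
  by apply: eq_bigr => k /negbTE ki; rewrite mxE ki.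
have -> : \det (G y) * \tr (invmx (G y) *m \matrix_(i, j) pd l (fun z => G z i j) y) =
   \tr (\adj (G y) *m \matrix_(i, j) pd l (fun z => G z i j) y).
  rewrite -linearZ /= scalemxAl; congr (\tr (_ *m _)).
  have d0 : \det (G y) \is a GRing.unit by rewrite -unitmxE Gu.
  by rewrite /invmx Gu // scalerA mulrV // scale1r.
rewrite exchange_big /=; apply: eq_bigr => j _; rewrite mxE; apply: eq_bigr => i _.
by rewrite !mxE mulrC.
Qed.

(** Of the three derivatives in the Christoffel symbol two cancel in the trace, because the inverse
    metric is symmetric. *)
Lemma christoffel_trace y l : W y ->
  \sum_i christoffel G i i l y =
  2^-1 * \tr (invmx (G y) *m (\matrix_(i, j) pd l (fun z => G z i j) y)).
Proof.
move=> Wy; rewrite /christoffel -mulr_sumr; congr (_ * _).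
have gs i k : invmx (G y) i k = invmx (G y) k i.
  by rewrite -{1}(posdef_invmx_sym (Gp Wy)) mxE.
have -> : \tr (invmx (G y) *m \matrix_(i, j) pd l (fun z => G z i j) y) =
    \sum_i \sum_k invmx (G y) i k * pd l (fun z => G z i k) y.
  apply: eq_bigr => i _; rewrite mxE; apply: eq_bigr => k _.
  by rewrite mxE (pd_metric_sym l k i Wy).
apply/eqP; rewrite -subr_eq0 -sumrB; apply/eqP.
transitivity (\sum_i \sum_k invmx (G y) i k * pd i (fun z => G z l k) y -
              \sum_i \sum_k invmx (G y) i k * pd k (fun z => G z i l) y).
  rewrite -sumrB; apply: eq_bigr => i _; rewrite -!sumrB; apply: eq_bigr => k _.
  move: (pd i _ y) (pd l _ y) (pd k _ y) => *; ring.
apply/eqP; rewrite subr_eq0; apply/eqP; rewrite [RHS]exchange_big /=.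
apply: eq_bigr => i _; apply: eq_bigr => k _.
by rewrite gs (pd_metric_sym i l k Wy).
Qed.

Definition vol (y : V) : R := Num.sqrt (\det (G y)).

Lemma vol_gt0 y : W y -> 0 < vol y.
Proof. by move=> /Gp/posdef_det_gt0; rewrite sqrtr_gt0. Qed.

Lemma vol_Ck m : Ck m W vol.
Proof.
apply: Ck_sqrt => // [z /Gp/posdef_det_gt0//|].
by apply: Ck_det => //; exact: GC.
Qed.

Lemma vol_diff y : W y -> differentiable vol y.
Proof. by move=> Wy; exact: (CkS_differentiable Wo (vol_Ck 1) Wy). Qed.

Lemma pd_vol y l : W y -> pd l vol y = vol y * \sum_i christoffel G i i l y.
Proof.
move=> Wy; have d0 := posdef_det_gt0 (Gp Wy).
have [ds dsE] := is_derive1_sqrt d0.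
rewrite /vol pd_comp_real //; last first.
  by apply: (CkS_differentiable Wo (Ck_det Wo (GC 1)) Wy).
rewrite derive1E dsE pd_det // christoffel_trace // mulrA [RHS]mulrA.
congr (_ * _); rewrite -{2}(sqr_sqrtr (ltW d0)).
have : Num.sqrt (\det (G y)) != 0 by rewrite gt_eqF // sqrtr_gt0.
by move: (Num.sqrt _) => s s0; field.
Qed.

(** Voss-Weyl formula: weighted by the volume density, a divergence is a sum of plain partial
    derivatives, so it integrates to zero over R^n when the support is compact. *)
Lemma vol_div1 eta y : W y -> diff_row eta y ->
  vol y * div1 eta y = \sum_i pd i (fun z => vol z * sharp eta z 0 i) y.
Proof.
move=> Wy de; have ds := sharp_diff Wy de; have dv := vol_diff Wy.
rewrite div1_sharp // /mxtrace mulr_sumr.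
under [RHS]eq_bigr do rewrite pdM // pd_vol //.
rewrite [RHS]big_split /= addrC.
under eq_bigr do rewrite mxE mulrDr.
rewrite big_split /=; congr (_ + _).
under eq_bigr do rewrite mulr_sumr.
rewrite exchange_big /=; apply: eq_bigr => l _.
rewrite -mulrA mulr_suml mulr_sumr; apply: eq_bigr => i _.
by [].
Qed.

End CoordinateTensors.

Section Contraction.
Variables (R : realType) (n : nat).

(* The divergence of this 1-form is the term integrated by parts in <beta h, phi>
   (c = 1/2) and, for h = nabla phi, in Bochner's formula (c = 1). *)
Definition sharp_contract (c : R) (g : 'M[R]_n) (phi : 'rV[R]_n) (h : 'M[R]_n) : 'rV[R]_n :=
  phi *m invmx g *m h - (c * \tr (invmx g *m h)) *: phi.

(* The formal adjoint of [beta] is [phi |-> trace_shift (delta_star phi)]. *)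
Definition trace_shift (g h : 'M[R]_n) : 'M[R]_n := h - (2^-1 * \tr (invmx g *m h)) *: g.

Lemma congr_contraction (c : R) (g F : 'M[R]_n) phi h : g \in unitmx -> F \in unitmx ->
  sharp_contract c (F *m g *m F^T) (phi *m F^T) (F *m h *m F^T) = sharp_contract c g phi h *m F^T.
Proof.
move=> gu Fu; rewrite /sharp_contract congr_trace // congr_mul_inv // !mulmxA mulmxKV //.
by rewrite mulmxBl -scalemxAl.
Qed.

Lemma congr_trace_shift (g F h : 'M[R]_n) : g \in unitmx -> F \in unitmx ->
  trace_shift (F *m g *m F^T) (F *m h *m F^T) = F *m trace_shift g h *m F^T.
Proof.
move=> gu Fu; rewrite /trace_shift congr_trace // mulmxBr mulmxBl.
by rewrite -scalemxAr -scalemxAl.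
Qed.

Lemma trace_shift_inner (g h h' : 'M[R]_n) : posdef g ->
  inner2 g (trace_shift g h) h' =
  inner2 g h h' - 2^-1 * \tr (invmx g *m h) * \tr (invmx g *m h').
Proof.
move=> gp; rewrite /trace_shift -scaleNr inner2Dl // inner2Zl //.
by rewrite [inner2 g g _]inner2C // inner2_G // mulNr.
Qed.

End Contraction.

(** * Bochner's inequality and the formal adjoint of [beta] in coordinates *)

Section Bochner.
Variables (R : realType) (n : nat).
Local Notation V := 'rV[R]_n.
Variables (W : set V) (G : V -> 'M[R]_n).
Implicit Types (eta zeta xi phi : V -> V) (y z : V) (s : V -> 'M[R]_n).
Hypothesis Wo : open W.
Hypothesis GC : forall k i j, Ck k W (fun y => G y i j).
Hypothesis Gp : forall y, W y -> posdef (G y).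

Let Gu y : W y -> G y \in unitmx.
Proof. by move=> /Gp /posdef_unit. Qed.

Lemma delta_starE phi y : delta_star_coord G phi y =
  2^-1 *: (nabla1_mx G phi y + (nabla1_mx G phi y)^T).
Proof. by apply/matrixP => i j; rewrite !mxE. Qed.

Lemma trace_delta_star phi y : W y ->
  \tr (invmx (G y) *m delta_star_coord G phi y) = div1 G phi y.
Proof.
move=> Wy; rewrite delta_starE -scalemxAr linearZ /= mulmxDr linearD /=.
rewrite -[\tr (_ *m _^T)]mxtrace_tr trmx_mul trmxK (posdef_invmx_sym (Gp Wy)).
rewrite [\tr (_ *m invmx _)]mxtrace_mulC -/(div1 G phi y).
by move: (div1 G phi y) => u; field.
Qed.

(** This is [divergence_bochner] for xi = phi^sharp: lowering the index of its field Y gives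
    [sharp_contract 1] of phi and nabla phi. *)
Lemma bochner_divergence phi y : W y -> (forall k j, Ck k W (fun z => phi z 0 j)) ->
  div1 G (fun z => sharp_contract 1 (G z) (phi z) (nabla1_mx G phi z)) y =
  \tr (cov_mx G (sharp G phi) y *m cov_mx G (sharp G phi) y)
  - div1 G phi y ^+ 2
  + (sharp G phi y *m ricci_coord G y *m (sharp G phi y)^T) 0 0.
Proof.
move=> Wy phiC.
pose xi := sharp G phi; pose A := cov_mx G xi.
have xiC k j : Ck k W (fun z => xi z 0 j).
  by apply: (@sharp_Ck _ _ _ _ Wo GC Gp k) => l; exact: phiC.
have dxi z : W z -> diff_row xi z.
  by move=> Wz j; exact: (CkS_differentiable Wo (xiC 1 j) Wz).
have ddxi i k : differentiable (pd i (fun z => xi z 0 k)) y.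
  have H : Ck 1 W (pd i (fun z => xi z 0 k)) := (xiC 2 k).2 i.
  exact: (CkS_differentiable Wo H Wy).
have dGam k i j : differentiable (christoffel G k i j) y.
  exact: (christoffel_diff Wo GC Gp).
have swap i j k : pd i (pd j (fun z => xi z 0 k)) y = pd j (pd i (fun z => xi z 0 k)) y.
  exact: (pd_swap _ _ Wo Wy (xiC 2 k)).
pose xic (k : 'I_n) (z : V) : R := xi z 0 k.
have dA i k : differentiable (fun z => A z i k) y.
  under [X in differentiable X _]funext do rewrite mxE.
  by apply: cov_deriv_diff => // l; exact: dxi.
have B := divergence_bochner dGam (fun k i j => christoffel_sym Wo Gp k i j Wy)
  (fun k => dxi y Wy k) ddxi swap.
pose Yv z := xi z *m A z - \tr (A z) *: xi z.
have trA z : \tr (A z) = \sum_j cov_deriv (christoffel G) xic j j z.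
  by apply: eq_bigr => j _; rewrite mxE.
have YvE z i : Yv z 0 i = \sum_j xi z 0 j * cov_deriv (christoffel G) xic j i z
    - (\sum_j cov_deriv (christoffel G) xic j j z) * xi z 0 i.
  rewrite -trA /Yv [LHS]mxE [X in X + _]mxE [X in _ + X]mxE [X in - X]mxE; congr (_ - _).
  by apply: eq_bigr => j _; rewrite [A z j i]mxE.
have dYv : diff_row Yv y.
  move=> i; under [X in differentiable X _]funext do rewrite YvE.
  apply: differentiableB.
    apply: differentiable_bigsum => j; apply: differentiable_mul; first exact: dxi.
    by have := dA j i; under [X in differentiable X _]funext do rewrite mxE.
  apply: differentiable_mul; last exact: dxi.
  apply: differentiable_bigsum => j.
  by have := dA j j; under [X in differentiable X _]funext do rewrite mxE.
have YE z : W z -> sharp_contract 1 (G z) (phi z) (nabla1_mx G phi z) = flat G Yv z.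
  move=> Wz; rewrite (nabla1_sharp Wo GC Gp Wz (dxi _ Wz)) /sharp_contract -/(sharp G phi z).
  rewrite mul1r mxtrace_mulC mulmxK ?Gu // /flat /Yv mulmxBl mulmxA -scalemxAl.
  by rewrite -/(flat G xi z) (flat_sharp Gp _ Wz).
rewrite (div1_eq _ Wo Wy YE) (div1_flat Wo GC Gp Wy dYv).
rewrite (div1_sharp Wo GC Gp Wy (dxi y Wy)) -/xi -/A.
transitivity (\sum_i (pd i (fun z => Yv z 0 i) y +
    \sum_p christoffel G i i p y * Yv y 0 p)); first by [].
under eq_bigr => i _.
  under [X in pd i X]funext do rewrite YvE.
  under [X in _ + X]eq_bigr do rewrite YvE.
  over.
rewrite /= B trA; congr (_ - _ + _).
  apply: eq_bigr => i _; rewrite mxE; apply: eq_bigr => j _.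
  by rewrite [A y i j]mxE [A y j i]mxE.
rewrite [RHS]mxE exchange_big /=; apply: eq_bigr => k _.
rewrite [X in _ = X * _]mxE mulr_suml; apply: eq_bigr => j _.
rewrite [ricci_coord _ _ _ _]mxE [X in _ = _ * X]mxE.
by congr (_ * _); exact: mulrC.
Qed.

(** Let N = nabla phi. The two terms in k cancel, and <N, N^T> = 2 |S|^2 - |N|^2 reduces the claim
    to |S|^2 <= |N|^2, that is, to [inner2_sym_part_le]. *)
Lemma bochner_inequality phi y (k : R) (S : 'M[R]_n) : W y -> (forall k j, Ck k W (fun z => phi z 0 j)) ->
  ricci_coord G y = k *: G y ->
  S = delta_star_coord G phi y ->
  inner2 (G y) S S - k * inner1 (G y) (phi y) (phi y)
  + div1 G (fun z => sharp_contract 1 (G z) (phi z) (nabla1_mx G phi z)) y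
  <= 2 * inner2 (G y) (trace_shift (G y) S) S.
Proof.
move=> Wy phiC ein S_def; rewrite bochner_divergence // ein.
have dphi : diff_row phi y.
  by move=> j; exact: (CkS_differentiable Wo (phiC 1 j) Wy).
have dxi := sharp_diff Wo GC Gp Wy dphi.
have gp := Gp Wy.
rewrite trace_shift_inner // [in X in _ * X * _]S_def [in X in _ * _ * X]S_def trace_delta_star //.
pose N := nabla1_mx G phi y.
have SE : S = 2^-1 *: (N + N^T) by rewrite S_def delta_starE.
have NE : N = cov_mx G (sharp G phi) y *m G y by rewrite /N (nabla1_sharp Wo GC Gp).
have -> : (sharp G phi y *m (k *: G y) *m (sharp G phi y)^T) 0 0 =
    k * inner1 (G y) (phi y) (phi y).
  rewrite -scalemxAr -scalemxAl mxE; congr (_ * _).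
  rewrite -/(flat G _ y) (flat_sharp Gp _ Wy) inner1E /sharp trmx_mul.
  by rewrite (posdef_invmx_sym gp) mulmxA.
have -> : \tr (cov_mx G (sharp G phi) y *m cov_mx G (sharp G phi) y) = inner2 (G y) N N^T.
  rewrite inner2E ?(posdef_invmx_sym gp) // trmxK NE.
  by rewrite !mulmxA mulmxK ?Gu // [RHS]mxtrace_mulC !mulmxA mulmxV ?Gu // mul1mx.
have le := inner2_sym_part_le gp N.
rewrite -SE in le.
have -> : inner2 (G y) N N^T = 2 * inner2 (G y) S S - inner2 (G y) N N.
  rewrite SE inner2Zl // inner2Zr // !(inner2Dl gp, inner2Dr gp).
  rewrite (inner2C gp N^T N) (inner2_tr gp).
  by move: (inner2 (G y) N N^T) (inner2 (G y) N N) => u v; field.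
move: (inner1 _ _ _) (div1 _ _ _) (inner2 _ N N) (inner2 _ S S) le => a d u v; lra.
Qed.

(** Leibniz rule for the two parts of the contraction, with xi = phi^sharp: div (xi . s) = - <delta
    s, phi> + <s, nabla phi> and div ((tr s) phi) = <d tr s, phi> + (tr s) div phi. As s is
    symmetric, <s, nabla phi> = <s, delta^* phi>; the trace terms assemble into T. *)
Lemma beta_divergence s phi y : W y -> diff_row phi y -> diff_mx s y ->
  (forall z, W z -> (s z)^T = s z) ->
  inner1 (G y) (beta_coord G s y) (phi y) =
  inner2 (G y) (s y) (trace_shift (G y) (delta_star_coord G phi y))
  - div1 G (fun z => sharp_contract 2^-1 (G z) (phi z) (s z)) y.
Proof.
move=> Wy dphi ds ss.
pose xi := sharp G phi; pose A := cov_mx G xi y; pose gi := invmx (G y).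
have gp := Gp Wy.
have gis : gi^T = gi := posdef_invmx_sym gp.
have dxi : diff_row xi y := sharp_diff Wo GC Gp Wy dphi.
have dxs : diff_row (fun z => xi z *m s z) y.
  move=> j; under [X in differentiable X _]funext do rewrite mxE.
  by apply: differentiable_bigsum => l; apply: differentiable_mul.
have dgi := invmx_metric_diff Wo GC Gp Wy.
have dtr : differentiable (trace_coord G s) y.
  rewrite /trace_coord /mxtrace; apply: differentiable_bigsum => l.
  under [X in differentiable X _]funext do rewrite mxE.
  by apply: differentiable_bigsum => j; apply: differentiable_mul.
have dtr' : differentiable (fun z => - (2^-1 * trace_coord G s z)) y.
  by apply: differentiableN; apply: differentiable_mul => //; exact: differentiable_cst.
have div_split : div1 G (fun z => sharp_contract 2^-1 (G z) (phi z) (s z)) y =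
   div1 G (fun z => xi z *m s z) y
   - 2^-1 * (\sum_i pd i (trace_coord G s) y * xi y 0 i + trace_coord G s y * div1 G phi y).
  rewrite -[LHS]/(div1 G (fun z => xi z *m s z - (2^-1 * trace_coord G s z) *: phi z) y).
  under [X in div1 _ X]funext do rewrite -scaleNr.
  rewrite (div1D _ dxs); last first.
    move=> j; under [X in differentiable X _]funext do rewrite mxE.
    exact: differentiable_mul.
  rewrite (div1Mf _ Wy dtr' dphi).
  have -> : \sum_i pd i (fun z => - (2^-1 * trace_coord G s z)) y * sharp G phi y 0 i =
      - 2^-1 * \sum_i pd i (trace_coord G s) y * xi y 0 i.
    rewrite mulr_sumr; apply: eq_bigr => i _; rewrite mulrA; congr (_ * _).
    rewrite pdN ?pdMl ?mulNr //.
    by apply: differentiable_mul => //; exact: differentiable_cst.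
  move: (\sum_i _) (div1 _ _ _) (div1 _ _ _) (trace_coord _ _ _) => *; ring.
pose N := nabla1_mx G phi y.
have NE : N = A *m G y by rewrite /N (nabla1_sharp Wo GC Gp).
have div_xs : div1 G (fun z => xi z *m s z) y =
    - inner1 (G y) (delta_coord G s y) (phi y) + inner2 (G y) (s y) N.
  rewrite inner2E // -/gi.
  have -> : gi *m s y *m gi *m N^T = gi *m s y *m A^T.
    by rewrite NE trmx_mul (proj1 gp) -!mulmxA (mulmxA gi (G y)) mulVmx ?mul1mx // Gu.
  have sij i j z : W z -> s z i j = s z j i by move=> Wz; rewrite -{1}(ss z Wz) mxE.
  (* nabla_i (xi^k s_kj) = xi^k nabla_i s_jk + A_i^k s_kj: the connection terms on the contracted
     index k cancel. *)
  have -> : div1 G (fun z => xi z *m s z) y = \tr (gi *m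
     ((\matrix_(i, j) \sum_k xi y 0 k * nabla2 G s y i j k) + A *m s y)).
    congr (\tr (_ *m _)); apply/matrixP => i j.
    rewrite [LHS]mxE [RHS]mxE [X in _ = X + _]mxE [X in _ = _ + X]mxE /nabla1.
    under [X in pd i X]funext do rewrite mxE.
    rewrite pd_sum; last by move=> k; exact: differentiable_mul.
    under eq_bigr do rewrite pdM //.
    have -> : \sum_p christoffel G p i j y * (xi y *m s y) 0 p =
        \sum_k xi y 0 k * \sum_p christoffel G p i j y * s y p k.
      under eq_bigr do rewrite mxE mulr_sumr.
      rewrite exchange_big /=; apply: eq_bigr => k _; rewrite mulr_sumr.
      by apply: eq_bigr => p _; rewrite mulrCA (sij k p).
    have -> : \sum_k A i k * s y k j = \sum_k pd i (fun z => xi z 0 k) y * s y k j +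
        \sum_k xi y 0 k * \sum_p christoffel G p i k y * s y j p.
      under eq_bigr do rewrite [A i _]mxE mulrDl.
      rewrite big_split /=; congr (_ + _).
      under eq_bigr do rewrite mulr_suml.
      rewrite exchange_big /=; apply: eq_bigr => k _; rewrite mulr_sumr.
      by apply: eq_bigr => p _; rewrite (sij j p) // mulrCA mulrA.
    rewrite big_split /= -addrA [RHS]addrCA; congr (_ + _).
    rewrite -sumrB -big_split /=; apply: eq_bigr => k _.
    rewrite -mulrDr -mulrBr; congr (_ * _); rewrite /nabla2.
    have -> : pd i (fun z => s z k j) y = pd i (fun z => s z j k) y.
      by apply: (pd_eq _ Wo Wy) => z Wz; exact: sij.
    by rewrite big_split /= opprD -addrA addrNK.
  rewrite mulmxDr linearD /=; congr (_ + _); last first.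
    by rewrite -[RHS]mxtrace_tr !trmx_mul trmxK ss // gis mxtrace_mulC !mulmxA mxtrace_mulC !mulmxA.
  rewrite inner1E -/gi -mulmxA.
  have -> : gi *m (phi y)^T = (xi y)^T by rewrite trmx_mul gis.
  rewrite mxE -sumrN.
  transitivity (\sum_k \sum_i \sum_l xi y 0 k * (gi i l * nabla2 G s y i l k)).
    transitivity (\sum_l \sum_i \sum_k xi y 0 k * (gi i l * nabla2 G s y l i k)).
      rewrite exchange_big /=; apply: eq_bigr => i _; rewrite mxE; apply: eq_bigr => l _.
      by rewrite mxE mulr_sumr; apply: eq_bigr => k _; rewrite mulrCA.
    rewrite [RHS]exchange_big /=; apply: eq_bigr => i _.
    rewrite [RHS]exchange_big /=; apply: eq_bigr => l _; apply: eq_bigr => k _.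
    by congr (_ * (_ * _)); rewrite -{1}gis mxE.
  apply: eq_bigr => k _; rewrite [delta_coord _ _ _ _ _]mxE [(xi y)^T _ _]mxE mulNr opprK.
  by rewrite mulrC mulr_sumr; apply: eq_bigr => i _; rewrite mulr_sumr.
have inner_beta : inner1 (G y) (beta_coord G s y) (phi y) =
    inner1 (G y) (delta_coord G s y) (phi y) + 2^-1 * \sum_i pd i (trace_coord G s) y * xi y 0 i.
  rewrite !inner1E -/gi -!mulmxA.
  have -> : gi *m (phi y)^T = (xi y)^T by rewrite trmx_mul gis.
  rewrite [LHS]mxE [X in _ = X + _]mxE mulr_sumr -big_split /=.
  apply: eq_bigr => i _.
  by rewrite [beta_coord _ _ _ _ _]mxE [(xi y)^T _ _]mxE mulrDl mulrA.
rewrite inner_beta div_split div_xs (inner2C gp) trace_shift_inner //.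
rewrite trace_delta_star // -/(trace_coord G s y).
have -> : inner2 (G y) (delta_star_coord G phi y) (s y) = inner2 (G y) (s y) N.
  rewrite delta_starE -/N (inner2Zl gp) (inner2Dl gp) (inner2C gp N).
  rewrite (inner2C gp N^T) -{2}(ss y Wy) (inner2_tr gp).
  by move: (inner2 _ _ _) => u; field.
move: (inner1 _ _ _) (\sum_i _) (inner2 _ _ _) (trace_coord _ _ _) (div1 _ _ _) => a b c d e.
by field.
Qed.

End Bochner.

(** * Tensor fields on manifolds *)

Section CoordinateChange.
Variables (R : realType) (n : nat).
Local Notation V := 'rV[R]_n.
Variables (U W : set V) (tau : V -> V).
Hypotheses (Uo : open U) (Wo : open W).
Hypothesis UW : forall y, U y -> W (tau y).
Hypothesis tauC : forall j, Ck 2 U (fun z => tau z 0 j).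

Definition jac (z : V) : 'M[R]_n := \matrix_(i, a) pd i (fun w => tau w 0 a) z.

Lemma jac_diff y : U y -> diff_mx jac y.
Proof.
move=> Uy i a; under [X in differentiable X _]funext do rewrite mxE.
have H : Ck 1 U (pd i (fun w => tau w 0 a)) := (tauC a).2 i.
exact: (CkS_differentiable Uo H Uy).
Qed.

Lemma tau_diff y j : U y -> differentiable (fun z => tau z 0 j) y.
Proof. by move=> Uy; exact: (CkS_differentiable Uo (tauC j) Uy). Qed.

Variables (Gd Gc : V -> 'M[R]_n).
Hypothesis Gdp : forall y, W y -> posdef (Gd y).
Hypothesis Gcp : forall y, U y -> posdef (Gc y).
Hypothesis GcE : forall z, U z -> Gc z = jac z *m Gd (tau z) *m (jac z)^T.

(** Rewrites the connection term of nabla eta without the inverse metric, so that [nabla1_change]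
    has to transform only derivatives of the metric. *)
Lemma christoffel_contract (W' : set V) (G : V -> 'M[R]_n) (eta : V -> V) y i j :
  open W' -> (forall y, W' y -> posdef (G y)) -> W' y ->
  \sum_p christoffel G p i j y * eta y 0 p =
  \sum_q sharp G eta y 0 q * christoffel1 G y i j q.
Proof.
move=> W'o Gp Wy.
under [RHS]eq_bigr do rewrite -(christoffel_lower Gp) // mulr_sumr.
rewrite exchange_big /=; apply: eq_bigr => p _.
rewrite -{1}(flat_sharp Gp eta Wy) /flat [(_ *m _) _ _]mxE mulr_sumr.
by apply: eq_bigr => q _; rewrite mulrC -mulrA.
Qed.

Section AtPoint.
Variables (etad etac : V -> V) (y : V).
Hypothesis etacE : forall z, U z -> etac z = etad (tau z) *m (jac z)^T.
Hypothesis Uy : U y.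
Hypothesis dGd : diff_mx Gd (tau y).
Hypothesis detad : diff_row etad (tau y).
Hypothesis Ju : jac y \in unitmx.

Let J := jac y.
(** Second derivatives of the transition map: the terms that would spoil tensoriality and have to
    cancel. *)
Let H i j a := pd i (fun z => jac z j a) y.

Let H_sym i j a : H i j a = H j i a.
Proof.
have E k : (fun z => jac z k a) = pd k (fun w => tau w 0 a).
  by apply/funext => z; rewrite mxE.
by rewrite /H !E; exact: (pd_swap _ _ Uo Uy (tauC a)).
Qed.

Let dtau j : differentiable (fun z => tau z 0 j) y. Proof. exact: tau_diff. Qed.

Let dJ i j : differentiable (fun z => jac z i j) y. Proof. exact: jac_diff. Qed.

Let detat a : differentiable (fun z => etad (tau z) 0 a) y.
Proof. exact: (@differentiable_compV _ _ (fun w => etad w 0 a)). Qed.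

Let dGt a b : differentiable (fun z => Gd (tau z) a b) y.
Proof. exact: (@differentiable_compV _ _ (fun w => Gd w a b)). Qed.

Let pdJ i j : pd i (fun z => tau z 0 j) y = J i j.
Proof. by rewrite /J /jac mxE. Qed.

Lemma local1_change_diff : diff_row etac y.
Proof.
move=> j; apply: (@differentiable_eq _ _ U (fun z => \sum_a etad (tau z) 0 a * jac z j a)) => //.
  by move=> z Uz; rewrite etacE // [RHS]mxE; apply: eq_bigr => a _; rewrite [X in _ = _ * X]mxE.
by apply: differentiable_bigsum => a; exact: differentiable_mul.
Qed.

Let pd_etac i j : pd i (fun z => etac z 0 j) y =
  \sum_a ((\sum_e J i e * pd e (fun w => etad w 0 a) (tau y)) * J j a + etad (tau y) 0 a * H i j a).
Proof.
rewrite (@pd_eq _ _ U _ (fun z => \sum_a etad (tau z) 0 a * jac z j a)) //; last first.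
  by move=> z Uz; rewrite etacE // [LHS]mxE; apply: eq_bigr => a _; rewrite [X in _ * X = _]mxE.
rewrite pd_sum; last by move=> a; exact: differentiable_mul.
apply: eq_bigr => a _; rewrite pdM // -/J -/(H i j a); congr (_ * _ + _).
rewrite (@pd_comp _ _ (fun w => etad w 0 a)) //.
by apply: eq_bigr => e _; rewrite pdJ.
Qed.

(** In the derivative of the pulled back metric, [K] holds the second derivatives of [tau] and [D]
    the transformed first derivatives of [Gd]. *)
Let K i j l := \sum_a \sum_b H i j a * Gd (tau y) a b * J l b.
Let D i j l := \sum_e \sum_a \sum_b J i e * J j a * J l b * pd e (fun w => Gd w a b) (tau y).

Let pd_Gc i j l : pd i (fun z => Gc z j l) y = K i j l + D i j l + K i l j.
Proof.
have Gsym a b : Gd (tau y) a b = Gd (tau y) b a.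
  by have [E _] := Gdp (UW Uy); rewrite -{1}E mxE.
rewrite (@pd_eq _ _ U _ (fun z => \sum_b \sum_a jac z j a * Gd (tau z) a b * jac z l b)) //; last first.
  move=> z Uz; rewrite GcE // [LHS]mxE; apply: eq_bigr => b _.
  by rewrite [X in _ * X = _]mxE [X in X * _ = _]mxE mulr_suml.
have dt a b : differentiable (fun z => jac z j a * Gd (tau z) a b * jac z l b) y.
  by do 2 apply: differentiable_mul => //.
rewrite pd_sum; last by move=> b; exact: differentiable_bigsum.
transitivity (\sum_b \sum_a (H i j a * Gd (tau y) a b * J l b +
   J j a * (\sum_e J i e * pd e (fun w => Gd w a b) (tau y)) * J l b +
   J j a * Gd (tau y) a b * H i l b)).
  apply: eq_bigr => b _; rewrite pd_sum //; apply: eq_bigr => a _.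
  rewrite pdM //; last exact: differentiable_mul.
  rewrite pdM // (@pd_comp _ _ (fun w => Gd w a b)) // -!/J -/(H i j a) -/(H i l b).
  by under eq_bigr do rewrite pdJ; rewrite mulrDl.
under eq_bigr do rewrite !big_split /=.
rewrite !big_split /=; congr (_ + _ + _).
- by rewrite exchange_big.
- rewrite exchange_big /= /D [RHS]exchange_big /=; apply: eq_bigr => a _.
  rewrite [RHS]exchange_big /=; apply: eq_bigr => b _.
  rewrite mulr_sumr mulr_suml; apply: eq_bigr => e _.
  move: (pd e _ _) (J i e) (J j a) (J l b) => *; ring.
- apply: eq_bigr => b _; apply: eq_bigr => a _.
  rewrite (Gsym a b); move: (Gd _ _ _) (J j a) (H i l b) => *; ring.
Qed.

(** Tensoriality of the covariant derivative. The second derivatives of [tau] coming from d_i eta_j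
    and those coming from the Christoffel symbol are the same sum of [H i j a] weighted by the
    components of eta. *)
Lemma nabla1_change :
  nabla1_mx Gc etac y = J *m nabla1_mx Gd etad (tau y) *m J^T.
Proof.
have Wy := UW Uy.
have Gu := posdef_unit (Gdp Wy).
pose xid := sharp Gd etad (tau y); pose xic := sharp Gc etac y.
have xiE b : \sum_q xic 0 q * J q b = xid 0 b.
  transitivity ((xic *m J) 0 b); first by rewrite mxE.
  congr (_ 0 b); rewrite /xic /sharp etacE // GcE // -/J congr_mul_inv //.
  by rewrite mulmxKV.
have etadE a : \sum_b Gd (tau y) a b * xid 0 b = etad (tau y) 0 a.
  rewrite -[in RHS](flat_sharp Gdp etad Wy) [RHS]mxE; apply: eq_bigr => b _.
  by have [E _] := Gdp Wy; rewrite mulrC; congr (_ * _); rewrite -{1}E mxE.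
apply/matrixP => i j; rewrite [LHS]mxE /nabla1 pd_etac.
rewrite (christoffel_contract _ _ _ Uo Gcp Uy) -/xic.
have KE : \sum_q xic 0 q * K i j q = \sum_a etad (tau y) 0 a * H i j a.
  rewrite /K; under eq_bigr do rewrite mulr_sumr.
  rewrite exchange_big /=; apply: eq_bigr => a _.
  under eq_bigr do rewrite mulr_sumr.
  rewrite exchange_big /= -etadE mulr_suml; apply: eq_bigr => b _.
  rewrite -xiE mulr_sumr mulr_suml; apply: eq_bigr => q _.
  move: (Gd _ _ _) (H _ _ _) (xic _ _) (J _ _) => *; ring.
pose D3 := \sum_e \sum_a \sum_b J i e * J j a * (xid 0 b * christoffel1 Gd (tau y) e a b).
have contr (P : 'I_n -> 'I_n -> 'I_n -> R) :
    \sum_q xic 0 q * (\sum_e \sum_a \sum_b J i e * J j a * J q b * P e a b) =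
    \sum_e \sum_a \sum_b J i e * J j a * (xid 0 b * P e a b).
  under eq_bigr do rewrite mulr_sumr.
  rewrite exchange_big /=; apply: eq_bigr => e _.
  under eq_bigr do rewrite mulr_sumr.
  rewrite exchange_big /=; apply: eq_bigr => a _.
  under eq_bigr do rewrite mulr_sumr.
  rewrite exchange_big /=; apply: eq_bigr => b _.
  rewrite -xiE mulr_suml mulr_sumr; apply: eq_bigr => q _.
  move: (P e a b) (J i e) (J j a) (J q b) (xic 0 q) => *; ring.
have D2 q : D j i q =
    \sum_e \sum_a \sum_b J i e * J j a * J q b * pd a (fun w => Gd w e b) (tau y).
  rewrite /D exchange_big /=; apply: eq_bigr => e _; apply: eq_bigr => a _.
  by apply: eq_bigr => b _; rewrite [J j a * _]mulrC.
have D3' q : D q i j =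
    \sum_e \sum_a \sum_b J i e * J j a * J q b * pd b (fun w => Gd w e a) (tau y).
  rewrite /D exchange_big /=; apply: eq_bigr => e _.
  rewrite exchange_big /=; apply: eq_bigr => a _; apply: eq_bigr => b _.
  move: (pd b _ _) (J i e) (J j a) (J q b) => *; ring.
have DE : \sum_q xic 0 q * (2^-1 * (D i j q + D j i q - D q i j)) = D3.
  transitivity (2^-1 * (\sum_q xic 0 q * D i j q + \sum_q xic 0 q * D j i q
      - \sum_q xic 0 q * D q i j)).
    rewrite -big_split -sumrB mulr_sumr /=; apply: eq_bigr => q _.
    move: (D i j q) (D j i q) (D q i j) (xic 0 q) => *; ring.
  under [X in _ + X - _]eq_bigr do rewrite D2.
  under [X in _ - X]eq_bigr do rewrite D3'.
  rewrite !contr -big_split -sumrB mulr_sumr /=; apply: eq_bigr => e _.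
  rewrite -big_split -sumrB mulr_sumr /=; apply: eq_bigr => a _.
  rewrite -big_split -sumrB mulr_sumr /=; apply: eq_bigr => b _.
  rewrite /christoffel1.
  move: (pd e _ _) (pd a _ _) (pd b _ _) (J i e) (J j a) (xid 0 b) => *; ring.
have -> : \sum_q xic 0 q * christoffel1 Gc y i j q =
    \sum_a etad (tau y) 0 a * H i j a + D3.
  rewrite -KE -DE -big_split /=; apply: eq_bigr => q _.
  rewrite -mulrDr; congr (_ * _).
  rewrite /christoffel1 !pd_Gc.
  (* [H] is symmetric in its first two indices, so four of the six [K] terms cancel and [K i j q]
     occurs twice, against the factor 1/2. *)
  have k1 : K j i q = K i j q by apply: eq_bigr => a _; apply: eq_bigr => b _; rewrite (H_sym j i).
  have k2 : K q i j = K i q j by apply: eq_bigr => a _; apply: eq_bigr => b _; rewrite (H_sym q i).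
  have k3 : K q j i = K j q i by apply: eq_bigr => a _; apply: eq_bigr => b _; rewrite (H_sym q j).
  rewrite k1 k2 k3; move: (K i j q) (K i q j) (K j q i) (D i j q) (D j i q) (D q i j) => *.
  by field.
rewrite big_split /= opprD addrA addrK.
rewrite [RHS]mxE.
under [RHS]eq_bigr do rewrite [X in X * _]mxE [X in _ * X]mxE.
transitivity (\sum_a \sum_e J i e * nabla1 Gd etad (tau y) e a * J j a); last first.
  by apply: eq_bigr => a _; rewrite mulr_suml; apply: eq_bigr => e _; rewrite [nabla1_mx _ _ _ _ _]mxE.
rewrite /D3 [X in _ - X]exchange_big /= -sumrB; apply: eq_bigr => a _.
rewrite mulr_suml -sumrB; apply: eq_bigr => e _.
rewrite /nabla1 (christoffel_contract _ _ _ Wo Gdp Wy) -/xid -mulr_sumr.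
move: (pd e _ _) (\sum_q _) (J _ _) (J _ _) => *; ring.
Qed.

End AtPoint.
End CoordinateChange.

(** * Charts, frames and the covariant derivative on the manifold *)

Section ManifoldTensors.
Variables (R : realType) (n : nat) (M : ptopologicalType) (X : smooth_manifold R n M).
Local Notation V := 'rV[R]_n.
Local Notation chart := (chart R n M).
Implicit Types (c d e : chart) (x : M) (eta phi : M -> V) (h : M -> 'M[R]_n).

Definition transition c d (y : V) : V := d (cinv c y).

Lemma chart_image_open c (A : set M) : atlas X c -> open A -> open (c @` (cdom c `&` A)).
Proof.
move=> /atlas_chart[_ Ico cK _ iC] Ao.
have -> : c @` (cdom c `&` A) = [set y | (c @` cdom c) y /\ A (cinv c y)].
  apply/seteqP; split => [y [x [cx Ax] <-]|y [[x cx <-]]] /=.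
    by split; [exists x|rewrite cK].
  by rewrite cK // => Ax; exists x.
rewrite openE => y [cy Ay]; apply: filterI; first exact: open_nbhs_nbhs.
by have := iC _ cy; apply; exact: open_nbhs_nbhs.
Qed.

Lemma cinvK c x : atlas X c -> cdom c x -> cinv c (c x) = x.
Proof. by move=> /atlas_chart[_ _ cK _ _]; exact: cK. Qed.

Lemma cdom_open c : atlas X c -> open (cdom c).
Proof. by move=> /atlas_chart[]. Qed.

Lemma transition_Ck c d k i : atlas X c -> atlas X d ->
  Ck k (c @` (cdom c `&` cdom d)) (fun y => transition c d y 0 i).
Proof. by move=> ca da; have [] := atlas_compatible ca da => H _; exact: H. Qed.

Lemma transition_diff c d x j : atlas X c -> atlas X d -> cdom c x -> cdom d x ->
  differentiable (fun y => transition c d y 0 j) (c x).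
Proof.
move=> ca da cx dx; apply: (CkS_differentiable _ (transition_Ck 1 j ca da)).
  by apply: chart_image_open => //; exact: cdom_open.
by exists x.
Qed.

(** Chain rule; rows are directions of derivation, so Jacobians compose from left to right. With [d]
    between [c] and [c] it gives the invertibility in [jac_unit]. *)
Lemma jac_chain c d e x : atlas X c -> atlas X d -> atlas X e ->
  cdom c x -> cdom d x -> cdom e x ->
  jac (transition c e) (c x) = jac (transition c d) (c x) *m jac (transition d e) (d x).
Proof.
move=> ca da ea cx dx ex; apply/matrixP => i j; rewrite !mxE.
pose U := c @` (cdom c `&` cdom d).
have Uo : open U by apply: chart_image_open => //; exact: cdom_open.
have Ux : U (c x) by exists x.
rewrite (@pd_eq _ _ U _ (fun y => transition d e (transition c d y) 0 j)) //; last first.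
  by move=> _ [z [cz dz] <-]; rewrite /transition !cinvK.
have tx : transition c d (c x) = d x by rewrite /transition cinvK.
rewrite (@pd_comp _ _ (fun y => transition d e y 0 j)) => [|k|].
- by apply: eq_bigr => k _; rewrite !mxE tx.
- exact: transition_diff.
- by rewrite tx; exact: transition_diff.
Qed.

Lemma jac_self c x : atlas X c -> cdom c x -> jac (transition c c) (c x) = 1%:M.
Proof.
move=> ca cx; apply/matrixP => i j; rewrite !mxE.
have Uo : open (c @` cdom c) by have [] := atlas_chart ca.
rewrite (@pd_eq _ _ (c @` cdom c) _ (fun y : V => y 0 j)) ?pd_coord //.
by move=> _ [z cz <-]; rewrite /transition cinvK.
Qed.

Lemma jac_unit c d x : atlas X c -> atlas X d -> cdom c x -> cdom d x ->
  jac (transition c d) (c x) \in unitmx.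
Proof.
move=> ca da cx dx; have := jac_self ca cx.
by rewrite (jac_chain ca da ca cx dx cx) => /mulmx1_unit[].
Qed.

Lemma frameE c x : atlas X c -> cdom c x ->
  frame X c (c x) = jac (transition c (chart_at X x)) (c x).
Proof.
move=> ca cx; have da := chart_at_atlas X x; have dx := chart_at_dom X x.
rewrite /frame cinvK //; apply/matrixP => i j; rewrite [RHS]mxE.
rewrite jacobianE //; apply: differentiable_rV => k.
exact: transition_diff.
Qed.

Lemma frame_unit c x : atlas X c -> cdom c x -> frame X c (c x) \in unitmx.
Proof.
move=> ca cx; rewrite frameE //; apply: jac_unit => //.
  exact: chart_at_atlas.
exact: chart_at_dom.
Qed.

(** The chart chosen at x is what identifies the tangent space at x with R^n, so in it the
    components at x are the values themselves. *)
Lemma frame_own x : frame X (chart_at X x) (chart_at X x x) = 1%:M.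
Proof.
by rewrite frameE ?jac_self //; [exact: chart_at_atlas|exact: chart_at_dom|exact: chart_at_atlas|exact: chart_at_dom].
Qed.

Lemma frame_change c d x : atlas X c -> atlas X d -> cdom c x -> cdom d x ->
  frame X c (c x) = jac (transition c d) (c x) *m frame X d (d x).
Proof.
move=> ca da cx dx; rewrite !frameE //; apply: jac_chain => //.
  exact: chart_at_atlas.
exact: chart_at_dom.
Qed.

Lemma local1E c eta x : atlas X c -> cdom c x ->
  local1 X c eta (c x) = eta x *m (frame X c (c x))^T.
Proof. by move=> ca cx; rewrite /local1 cinvK. Qed.

Lemma local2E c h x : atlas X c -> cdom c x ->
  local2 X c h (c x) = frame X c (c x) *m h x *m (frame X c (c x))^T.
Proof. by move=> ca cx; rewrite /local2 cinvK. Qed.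

Lemma local1_own eta x : local1 X (chart_at X x) eta (chart_at X x x) = eta x.
Proof.
rewrite local1E ?frame_own ?trmx1 ?mulmx1 //.
  exact: chart_at_atlas.
exact: chart_at_dom.
Qed.

Lemma local2_own h x : local2 X (chart_at X x) h (chart_at X x x) = h x.
Proof.
rewrite local2E ?frame_own ?trmx1 ?mulmx1 ?mul1mx //.
  exact: chart_at_atlas.
exact: chart_at_dom.
Qed.

Section Change.
Variables (c d : chart) (x : M).
Hypotheses (ca : atlas X c) (da : atlas X d) (cx : cdom c x) (dx : cdom d x).

Lemma local1_change eta :
  local1 X c eta (c x) = local1 X d eta (d x) *m (jac (transition c d) (c x))^T.
Proof. by rewrite !local1E // (frame_change ca da cx dx) trmx_mul mulmxA. Qed.

Lemma local2_change h :
  local2 X c h (c x) = jac (transition c d) (c x) *m local2 X d h (d x) *m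
     (jac (transition c d) (c x))^T.
Proof. by rewrite !local2E // (frame_change ca da cx dx) trmx_mul !mulmxA. Qed.

End Change.

Variables (Z : set M) (g : M -> 'M[R]_n).
Hypothesis Zc : closed Z.
Hypothesis gR : riemannian_metric X Z g.

Definition reg c := c @` (cdom c `\` Z).

Lemma reg_open c : atlas X c -> open (reg c).
Proof. by move=> ca; apply: chart_image_open => //; exact: closed_openC. Qed.

Lemma reg_in c x : cdom c x -> ~ Z x -> reg c (c x).
Proof. by move=> cx Zx; exists x. Qed.

Lemma metric_Ck c : atlas X c -> forall k i j, Ck k (reg c) (fun y => local2 X c g y i j).
Proof. by move=> ca k i j; exact: gR.1. Qed.

Lemma metric_posdef c : atlas X c -> forall y, reg c y -> posdef (local2 X c g y).
Proof.
move=> ca y [x [cx Zx] <-]; rewrite local2E //; apply: congr_posdef.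
  exact: frame_unit.
exact: gR.2.
Qed.

Definition diff1 eta x := diff_row (local1 X (chart_at X x) eta) (chart_at X x x).

Definition nabla eta x : 'M[R]_n :=
  nabla1_mx (local2 X (chart_at X x) g) (local1 X (chart_at X x) eta) (chart_at X x x).

Definition div eta x : R :=
  div1 (local2 X (chart_at X x) g) (local1 X (chart_at X x) eta) (chart_at X x x).

Lemma divE eta x : div eta x = \tr (invmx (g x) *m nabla eta x).
Proof. by rewrite /div /div1 local2_own. Qed.

Section NablaLocal.
Variables (c : chart) (x : M).
Hypotheses (ca : atlas X c) (cx : cdom c x) (Zx : ~ Z x).

Let d := chart_at X x.
Let da : atlas X d. Proof. exact: chart_at_atlas. Qed.
Let dx : cdom d x. Proof. exact: chart_at_dom. Qed.
Let U := c @` (cdom c `&` (cdom d `\` Z)).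
Let Uo : open U.
Proof.
apply: chart_image_open => //; apply: openI; first exact: cdom_open.
exact: closed_openC.
Qed.
Let Ux : U (c x). Proof. by exists x. Qed.
Let UW y : U y -> reg d (transition c d y).
Proof. by move=> [z [cz [dz Zz]] <-]; rewrite /transition cinvK //; exact: reg_in. Qed.
Let Ud : U `<=` c @` (cdom c `&` cdom d).
Proof. by move=> _ [z [cz [dz _]] <-]; exists z. Qed.
Let tauC j : Ck 2 U (fun y => transition c d y 0 j).
Proof. by apply: (Ck_subset Ud); exact: transition_Ck. Qed.
Let tx : transition c d (c x) = d x. Proof. by rewrite /transition cinvK. Qed.
Let L1 eta z : U z -> local1 X c eta z =
  local1 X d eta (transition c d z) *m (jac (transition c d) z)^T.
Proof. by move=> [w [cw [dw _]] <-]; rewrite (local1_change ca da cw dw) /transition cinvK. Qed.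
Let L2 h z : U z -> local2 X c h z =
  jac (transition c d) z *m local2 X d h (transition c d z) *m (jac (transition c d) z)^T.
Proof. by move=> [w [cw [dw _]] <-]; rewrite (local2_change ca da cw dw) /transition cinvK. Qed.
Let Ju : jac (transition c d) (c x) \in unitmx. Proof. exact: jac_unit. Qed.
Let Gcp y : U y -> posdef (local2 X c g y).
Proof. by move=> [z [cz [dz Zz]] <-]; apply: metric_posdef => //; exact: reg_in. Qed.

Lemma diff1_chart eta : diff1 eta x -> diff_row (local1 X c eta) (c x).
Proof.
move=> de; apply: (local1_change_diff Uo tauC (L1 eta) Ux).
by rewrite tx.
Qed.

(** [nabla] is computed at each point in the chart chosen there, and neighbouring points may use
    different charts. Here one formula holds over a whole chart, so that it can be differentiated
    and integrated. *)
Lemma nabla_local eta : diff1 eta x ->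
  local2 X c (nabla eta) (c x) = nabla1_mx (local2 X c g) (local1 X c eta) (c x).
Proof.
move=> de; have Wo := reg_open da.
have rx : reg d (d x) by exact: reg_in.
rewrite (nabla1_change Uo Wo UW tauC (metric_posdef da) Gcp (L2 g) (L1 eta) Ux) ?tx //.
  by rewrite local2E // frameE.
exact: (metric_diff Wo (metric_Ck da)).
Qed.

Lemma div_local eta : diff1 eta x ->
  div eta x = div1 (local2 X c g) (local1 X c eta) (c x).
Proof.
move=> de; rewrite divE /div1 -nabla_local //.
rewrite !local2E // congr_trace //; last exact: frame_unit.
by apply: posdef_unit; exact: gR.2.
Qed.

End NablaLocal.

Lemma delta_star_nabla eta x : delta_star X g eta x = 2^-1 *: (nabla eta x + (nabla eta x)^T).
Proof. exact: delta_starE. Qed.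

End ManifoldTensors.

(** * Smooth sections with compact support in the regular set *)

Section TestSections.
Variables (R : realType) (n : nat) (M : ptopologicalType) (X : smooth_manifold R n M).
Local Notation V := 'rV[R]_n.
Local Notation chart := (chart R n M).
Implicit Types (c d e : chart) (x : M) (eta phi : M -> V) (h s : M -> 'M[R]_n).
Variables (Z : set M) (g : M -> 'M[R]_n).
Hypothesis Zc : closed Z.
Hypothesis gR : riemannian_metric X Z g.

Let ca_ x : atlas X (chart_at X x). Proof. exact: chart_at_atlas. Qed.
Let cx_ x : cdom (chart_at X x) x. Proof. exact: chart_at_dom. Qed.
Let gu x : ~ Z x -> g x \in unitmx.
Proof. by move=> Zx; apply: posdef_unit; exact: gR.2. Qed.

Lemma smooth1_diff1 phi x : smooth1 X Z phi -> ~ Z x -> diff1 X phi x.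
Proof.
move=> sp Zx j; have H : Ck 1 (reg Z (chart_at X x)) (fun y => local1 X (chart_at X x) phi y 0 j).
  exact: sp.
by apply: (CkS_differentiable (reg_open Zc (ca_ x)) H); exact: reg_in.
Qed.

Lemma smooth2_eq h h' : (forall x, ~ Z x -> h x = h' x) -> smooth2 X Z h -> smooth2 X Z h'.
Proof.
move=> E sh c ca i j k; apply: Ck_eq (sh c ca i j k); first exact: (reg_open Zc ca).
by move=> _ [x [cx Zx] <-]; rewrite !local2E // (E _ Zx).
Qed.

Lemma smooth2_nabla phi : smooth1 X Z phi -> smooth2 X Z (nabla X g phi).
Proof.
move=> sp c ca i j k; have ro := reg_open Zc ca.
apply: (@Ck_eq _ _ _ _ (fun y => nabla1_mx (local2 X c g) (local1 X c phi) y i j)) => //.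
  move=> _ [x [cx Zx] <-]; rewrite (nabla_local Zc gR) //.
  exact: smooth1_diff1.
apply: (nabla1_Ck ro (metric_Ck gR ca) (metric_posdef gR ca)) => l.
exact: sp.
Qed.

Lemma smooth2_lin (a b : R) h h' : smooth2 X Z h -> smooth2 X Z h' ->
  smooth2 X Z (fun x => a *: h x + b *: h' x).
Proof.
move=> sh sh' c ca i j k; have ro := reg_open Zc ca.
apply: (@Ck_eq _ _ _ _ (fun y => a * local2 X c h y i j + b * local2 X c h' y i j)) => //.
  move=> y ry; rewrite /local2 mulmxDr mulmxDl -!scalemxAr -!scalemxAl [RHS]mxE.
  by congr (_ + _); rewrite [RHS]mxE.
by apply: CkD => //; apply: CkM => //; [exact: Ck_cst|exact: sh|exact: Ck_cst|exact: sh'].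
Qed.

Lemma smooth1_lin (a b : R) (h h' : M -> V) : smooth1 X Z h -> smooth1 X Z h' ->
  smooth1 X Z (fun x => a *: h x + b *: h' x).
Proof.
move=> sh sh' c ca i k; have ro := reg_open Zc ca.
apply: (@Ck_eq _ _ _ _ (fun y => a * local1 X c h y 0 i + b * local1 X c h' y 0 i)) => //.
  move=> y ry; rewrite /local1 mulmxDl -!scalemxAl [RHS]mxE.
  by congr (_ + _); rewrite [RHS]mxE.
by apply: CkD => //; apply: CkM => //; [exact: Ck_cst|exact: sh|exact: Ck_cst|exact: sh'].
Qed.

Lemma smooth2_tr h : smooth2 X Z h -> smooth2 X Z (fun x => (h x)^T).
Proof.
move=> sh c ca i j k; have := sh c ca j i k; apply: Ck_eq; first exact: (reg_open Zc ca).
move=> y ry.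
have -> : local2 X c (fun x => (h x)^T) y = (local2 X c h y)^T.
  by rewrite /local2 !trmx_mul trmxK mulmxA.
by rewrite [RHS]mxE.
Qed.

Lemma smooth2_delta_star phi : smooth1 X Z phi -> smooth2 X Z (delta_star X g phi).
Proof.
move=> sp; have sn := smooth2_nabla sp.
apply: smooth2_eq (smooth2_lin 2^-1 2^-1 sn (smooth2_tr sn)) => x _.
by rewrite delta_star_nabla scalerDr.
Qed.

Lemma trace_Ck c h k : atlas X c -> smooth2 X Z h ->
  Ck k (reg Z c) (fun y => \tr (invmx (local2 X c g y) *m local2 X c h y)).
Proof.
move=> ca sh; have ro := reg_open Zc ca; rewrite /mxtrace; apply: Ck_sum => // i.
under [X in Ck _ _ X]funext do rewrite mxE.
apply: Ck_sum => // j; apply: CkM => //; last exact: sh.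
exact: (invmx_metric_Ck ro (metric_Ck gR ca) (metric_posdef gR ca)).
Qed.

Lemma smooth2_trace_shift h : smooth2 X Z h ->
  smooth2 X Z (fun x => trace_shift (g x) (h x)).
Proof.
move=> sh c ca i j k; have ro := reg_open Zc ca.
apply: (@Ck_eq _ _ _ _ (fun y => trace_shift (local2 X c g y) (local2 X c h y) i j)) => //.
  move=> _ [x [cx Zx] <-]; rewrite !local2E //.
  by rewrite congr_trace_shift ?gu //; exact: frame_unit.
rewrite /trace_shift.
under [X in Ck _ _ X]funext => y.
  rewrite mxE [X in _ + X]mxE [X in - X]mxE.
  over.
apply: CkB => //; first exact: sh.
apply: CkM => //; last exact: gR.1.
by apply: CkM => //; [exact: Ck_cst|exact: trace_Ck].
Qed.

Lemma local1_contraction (a : R) c phi h y : atlas X c -> reg Z c y ->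
  local1 X c (fun x => sharp_contract a (g x) (phi x) (h x)) y =
  sharp_contract a (local2 X c g y) (local1 X c phi y) (local2 X c h y).
Proof.
move=> ca [x [cx Zx] <-]; rewrite !local1E // !local2E //.
by rewrite congr_contraction ?gu //; exact: frame_unit.
Qed.

Lemma smooth1_contraction (a : R) phi h : smooth1 X Z phi -> smooth2 X Z h ->
  smooth1 X Z (fun x => sharp_contract a (g x) (phi x) (h x)).
Proof.
move=> sp sh c ca i k; have ro := reg_open Zc ca.
apply: (@Ck_eq _ _ _ _ (fun y =>
    sharp_contract a (local2 X c g y) (local1 X c phi y) (local2 X c h y) 0 i)) => //.
  by move=> y ry; rewrite local1_contraction.
rewrite /sharp_contract.
under [X in Ck _ _ X]funext => y.
  rewrite mxE [X in X + _]mxE [X in _ + X]mxE [X in - X]mxE.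
  over.
apply: CkB => //.
  apply: Ck_sum => // j; apply: CkM => //; last exact: sh.
  under [X in Ck _ _ X]funext do rewrite mxE.
  apply: Ck_sum => // l; apply: CkM => //; first exact: sp.
  exact: (invmx_metric_Ck ro (metric_Ck gR ca) (metric_posdef gR ca)).
apply: CkM => //; last exact: sp.
by apply: CkM => //; [exact: Ck_cst|exact: trace_Ck].
Qed.

(** M is Hausdorff, so the complement of K is open and phi vanishes near x, not only at x. *)
Lemma nabla_support phi (K : set M) x : compact K -> (forall y, ~ K y -> phi y = 0) ->
  ~ K x -> nabla X g phi x = 0.
Proof.
move=> Kc phi0 Kx.
have Kcl : closed K by apply: compact_closed => //; exact: manifold_hausdorff X.
set c := chart_at X x.
pose W := c @` (cdom c `&` ~` K).
have Wo : open W by apply: chart_image_open; [exact: ca_|exact: closed_openC].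
have Wx : W (c x) by exists x => //; split => //; exact: cx_.
rewrite /nabla -/c (@nabla1_mx_eq _ _ W _ Wo _ (fun=> 0)) //.
  apply/matrixP => i j; rewrite !mxE /nabla1.
  under [X in pd i X]funext do rewrite mxE.
  rewrite pd_cst big1 ?subr0 // => p _; by rewrite mxE mulr0.
by move=> _ [z [cz Kz] <-]; rewrite local1E ?phi0 ?mul0mx //; exact: ca_.
Qed.

Definition test1 := test_section (m := one_forms X Z g).
Definition test2 := test_section (m := sym2_tensors X Z g).

Lemma test2_delta_star phi : test1 phi -> test2 (delta_star X g phi).
Proof.
move=> [sp [K [Kc KZ K0]]]; split.
- by move=> x Zx; rewrite delta_star_nabla linearZ /= linearD /= trmxK addrC.
- exact: smooth2_delta_star.
- exists K; split => // x Kx; rewrite delta_star_nabla.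
  by rewrite (nabla_support Kc K0) // trmx0 addr0 scaler0.
Qed.

Lemma test2_trace_shift h : test2 h -> test2 (fun x => trace_shift (g x) (h x)).
Proof.
move=> [hs sh [K [Kc KZ K0]]]; split.
- move=> x Zx; rewrite /trace_shift linearB linearZ /= hs //.
  by have [gs _] := gR.2 x Zx; rewrite gs.
- exact: smooth2_trace_shift.
- by exists K; split => // x /K0->; rewrite /trace_shift mulmx0 linear0 mulr0 scale0r subr0.
Qed.

Lemma test1_contraction (a : R) phi h : test1 phi -> smooth2 X Z h ->
  test1 (fun x => sharp_contract a (g x) (phi x) (h x)).
Proof.
move=> [sp [K [Kc KZ K0]]] sh; split; first exact: smooth1_contraction.
by exists K; split => // x /K0->; rewrite /sharp_contract !mul0mx scaler0 subr0.
Qed.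

Lemma diff_chart1 phi c x : atlas X c -> cdom c x -> ~ Z x -> smooth1 X Z phi ->
  diff_row (local1 X c phi) (c x).
Proof.
move=> ca cx Zx sp j; have H : Ck 1 (reg Z c) (fun y => local1 X c phi y 0 j).
  exact: sp.
by apply: (CkS_differentiable (reg_open Zc ca) H); exact: reg_in.
Qed.

Lemma beta_pointwise s phi x : test2 s -> test1 phi -> ~ Z x ->
  inner1 (g x) (beta X g s x) (phi x) =
  inner2 (g x) (s x) (trace_shift (g x) (delta_star X g phi x))
  - div X g (fun y => sharp_contract 2^-1 (g y) (phi y) (s y)) x.
Proof.
move=> [ss sm _] [sp _] Zx; set c := chart_at X x.
have ro := reg_open Zc (ca_ x).
have rx : reg Z c (c x) by apply: reg_in => //; exact: cx_.
have ds : diff_mx (local2 X c s) (c x).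
  move=> i j; have H : Ck 1 (reg Z c) (fun y => local2 X c s y i j).
    exact: (sm c (ca_ x) i j 1%N).
  exact: (CkS_differentiable ro H).
have sl z : reg Z c z -> (local2 X c s z)^T = local2 X c s z.
  by move=> [w [cw Zw] <-]; rewrite (local2E _ (ca_ x) cw) !trmx_mul trmxK ss // !mulmxA.
have := beta_divergence ro (metric_Ck gR (ca_ x)) (metric_posdef gR (ca_ x)) rx
  (diff_chart1 (ca_ x) (cx_ x) Zx sp) ds sl.
rewrite /c !local1_own !local2_own => ->; congr (_ - _).
apply: (div1_eq _ ro) => // z rz.
by rewrite (local1_contraction _ _ _ (ca_ x) rz).
Qed.

Lemma bochner_pointwise phi x (k : R) : test1 phi -> ~ Z x -> ricci X g x = k *: g x ->
  inner2 (g x) (delta_star X g phi x) (delta_star X g phi x)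
  - k * inner1 (g x) (phi x) (phi x)
  + div X g (fun y => sharp_contract 1 (g y) (phi y) (nabla X g phi y)) x
  <= 2 * inner2 (g x) (trace_shift (g x) (delta_star X g phi x)) (delta_star X g phi x).
Proof.
move=> [sp _] Zx ein; set c := chart_at X x.
have ro := reg_open Zc (ca_ x).
have rx : reg Z c (c x) by apply: reg_in => //; exact: cx_.
have ein' : ricci_coord (local2 X c g) (c x) = k *: local2 X c g (c x).
  by rewrite local2_own -ein.
have := bochner_inequality ro (metric_Ck gR (ca_ x)) (metric_posdef gR (ca_ x)) rx
  (fun k j => sp c (ca_ x) j k) ein' (erefl : delta_star X g phi x = _).
rewrite /c !local1_own !local2_own; apply: le_trans; rewrite lerD2l le_eqVlt; apply/orP; left.
(* The coordinate inequality takes the covariant derivative in the single chart [c], whereas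
   [nabla X g phi] uses a chart depending on the point; [nabla_local] identifies the two near x. *)
apply/eqP; apply: (div1_eq _ ro) => // z rz.
rewrite (local1_contraction _ _ _ (ca_ x) rz); congr (sharp_contract _ _ _ _).
case: rz => w [cw Zw] <-; apply: (nabla_local Zc gR) => //.
exact: smooth1_diff1.
Qed.

End TestSections.

(** * Lebesgue measure on R^n *)

Section BorelSets.

Lemma open_borel (T : ptopologicalType) (A : set T) : open A -> measurable (A : set (borel T)).
Proof. by move=> Ao; exact: sub_gen_smallest. Qed.

Lemma closed_borel (T : ptopologicalType) (A : set T) : closed A -> measurable (A : set (borel T)).
Proof.
by move=> Ac; rewrite -[A]setCK; apply: measurableC; apply: open_borel; exact: closed_openC.
Qed.

Lemma open_preimage (T U : topologicalType) (D : set T) (f : T -> U) (B : set U) :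
  open D -> (forall x, D x -> {for x, continuous f}) -> open B ->
  open (D `&` f @^-1` B).
Proof.
move=> Do fc Bo; rewrite openE => x [Dx fx]; apply: filterI; first exact: open_nbhs_nbhs.
by have := fc x Dx; apply; exact: open_nbhs_nbhs.
Qed.

Lemma continuous_borel (T U : ptopologicalType) (D : set T) (f : T -> U) :
  open D -> (forall x, D x -> {for x, continuous f}) ->
  measurable_fun (D : set (borel T)) (f : borel T -> borel U).
Proof.
move=> Do fc; apply: (@measurability _ _ (borel T) (borel U) D f (@open U)) => //.
by move=> _ [B Bo <-]; apply: open_borel; exact: open_preimage.
Qed.

Lemma continuous_borel_real (R : realType) (T : ptopologicalType) (D : set T) (f : T -> R) :
  open D -> (forall x, D x -> {for x, continuous f}) ->
  measurable_fun (D : set (borel T)) (f : borel T -> measurableTypeR R).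
Proof.
move=> Do fc; apply: (measurability _ (RGenOpens.measurableE R)).
move=> _ [_ [x [y ->]] <-]; apply: open_borel; apply: open_preimage => //.
Qed.

End BorelSets.

(** * Borel sets of R^(n+1) and the product structure *)

Section RationalCubes.
Variable R : realType.

Definition cube m (p : 'rV[rat]_m * rat) : set 'rV[R]_m :=
  [set y | forall i, `|y 0 i - ratr (p.1 0 i)| < ratr p.2].

Lemma rV_norm_lt m (v : 'rV[R]_m) (e : R) : 0 < e ->
  (`|v| < e) <-> (forall i, `|v 0 i| < e).
Proof.
move=> e0; split=> [ve i|]; last exact: norm_rV_lt.
exact: le_lt_trans (le_coord_norm _ _) ve.
Qed.

(** Rational cubes form a countable base. A cube is moreover a product of intervals, which is what
    [measurable_cons_row] exploits. *)
Lemma open_cubes m (U : set 'rV[R]_m) : open U ->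
  U = \bigcup_(p in [set: 'rV[rat]_m * rat]) (if `[< cube p `<=` U >] then cube p else set0).
Proof.
move=> Uo; apply/seteqP; split => [y Uy|y [p _]]; last by case: asboolP => // H; exact: H.
have [e e0 eU] := open_normP Uo Uy.
have e2 : 0 < e / 2 by rewrite divr_gt0.
have [r] := rat_in_itvoo e2; rewrite in_itv /= => /andP[r0 re].
have /choice[q qP] (i : 'I_m) : exists q : rat, `|y 0 i - ratr q| < ratr r.
  have : y 0 i - ratr r < y 0 i + ratr r by rewrite ltrD2l (lt_trans _ r0) // oppr_lt0.
  move=> /rat_in_itvoo[q]; rewrite in_itv /= => /andP[q1 q2].
  by exists q; rewrite ltr_distlC -ltrBlDr q1 /= ltrBlDr.
exists (\row_i q i, r) => //; case: asboolP => [_|[]] /=.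
  by move=> i; rewrite mxE.
move=> z zc; apply: eU; apply/rV_norm_lt => // i; rewrite !mxE.
have := zc i; rewrite /= mxE => zi.
have -> : z 0 i - y 0 i = (z 0 i - ratr (q i)) - (y 0 i - ratr (q i)) by ring.
apply: le_lt_trans (ler_normB _ _) _; rewrite (splitr e); apply: ltrD.
  exact: lt_trans zi re.
exact: lt_trans (qP i) re.
Qed.

Lemma cube_open m (p : 'rV[rat]_m * rat) : open (cube p).
Proof.
rewrite openE => y py.
suff : \forall z \near (y : 'rV[R]_m), forall i : 'I_m, `|(z : 'rV[R]_m) 0 i - ratr (p.1 0 i)| < ratr p.2 by [].
apply: (@filter_forall _ _ (fun i (z : 'rV[R]_m) => `|z 0 i - ratr (p.1 0 i)| < ratr p.2) (nbhs y)) => i.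
apply: open_nbhs_nbhs; split; last exact: py.
suff : open ([set: 'rV[R]_m] `&`
    (fun y : 'rV[R]_m => `|y 0 i - ratr (p.1 0 i)|) @^-1` [set x | x < ratr p.2]).
  by rewrite setTI.
apply: open_preimage; [exact: openT|move=> w _|exact: open_lt].
apply: continuous_comp; last exact: norm_continuous.
by apply: continuousB; [exact: coord_continuous|exact: cst_continuous].
Qed.

Definition cons_row n (p : R * 'rV[R]_n) : 'rV[R]_n.+1 := row_mx (const_mx p.1 : 'rV[R]_1) p.2.

(** An open set is a countable union of cubes, and the preimage of a cube is a measurable
    rectangle. *)
Lemma measurable_cons_row n :
  measurable_fun setT (cons_row (n := n) : measurableTypeR R * borel 'rV[R]_n -> borel 'rV[R]_n.+1).
Proof.
apply: (@measurability _ _ (measurableTypeR R * borel 'rV[R]_n)%type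
  (borel 'rV[R]_n.+1) setT (cons_row (n := n)) (@open 'rV[R]_n.+1)) => //.
move=> _ [U Uo <-]; rewrite setTI (open_cubes Uo) preimage_bigcup.
apply: countable_bigcupT_measurable => [|p]; first exact: countableP.
case: asboolP => _; last by rewrite preimage_set0.
have -> : cons_row (n := n) @^-1` (cube p) =
    [set s : R | `|s - ratr (p.1 0 (lshift n (0 : 'I_1)))| < ratr p.2] `*`
    cube (\row_j p.1 0 (rshift 1 j), p.2).
  apply/seteqP; split => [[s v] /= H|[s v] [/= H1 H2] i].
    split => /= [|j].
      by have := H (lshift n (0 : 'I_1)); rewrite /cons_row /= (row_mxEl (const_mx s : 'rV_1) v) mxE.
    by have := H (rshift 1 j); rewrite /cons_row /= (row_mxEr (const_mx s : 'rV_1) v) mxE.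
  rewrite /cons_row /=; have := splitP (i : 'I_(1 + n)).
  case=> j ij.
    have -> : i = lshift n (0 : 'I_1) by apply: val_inj; rewrite /= ij ord1.
    by rewrite (row_mxEl (const_mx s : 'rV_1) v) mxE.
  have -> : i = rshift 1 j by apply: val_inj.
  by rewrite (row_mxEr (const_mx s : 'rV_1) v); have := H2 j; rewrite /= mxE.
apply: measurableX; last by apply: open_borel; exact: cube_open.
apply: open_measurable.
have -> : [set s : R | `|s - ratr (p.1 0 (lshift n (0 : 'I_1)))| < ratr p.2] =
  setT `&` (fun s => `|s - ratr (p.1 0 (lshift n (0 : 'I_1)))|) @^-1` [set x | x < ratr p.2].
  by rewrite setTI.
apply: open_preimage; [exact: openT|move=> y _|exact: open_lt].
apply: continuous_comp; last exact: norm_continuous.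
by apply: continuousB; [exact: cvg_id|exact: cst_continuous].
Qed.

End RationalCubes.

Section LebesgueRn.
Variable R : realType.
Local Open Scope ereal_scope.

Lemma norm_ball_open n (r : R) : open [set y : 'rV[R]_n | (`|y| < r)%R].
Proof.
have -> : [set y : 'rV[R]_n | (`|y| < r)%R] =
  setT `&` (fun y : 'rV[R]_n => `|y|%R) @^-1` [set x | (x < r)%R] by rewrite setTI.
by apply: open_preimage; [exact: openT|move=> y _; exact: norm_continuous|exact: open_lt].
Qed.

Lemma norm_balls_cover n : [set: 'rV[R]_n] = \bigcup_k [set y | (`|y| < k%:R)%R].
Proof.
apply/seteqP; split => // y _.
exists (Num.truncn `|y|).+1 => //=; exact: truncnS_gt.
Qed.

(** [integral_Rn] is an iteration and gives no direct access to limit theorems; a measure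
    representing it does. That measure is the image of the product of one-dimensional Lebesgue
    measure with the measure for n. Finiteness on balls yields the sigma-finiteness that Tonelli's
    theorem asks for at the next stage. *)
Lemma lebesgue_Rn n : exists L : {sigma_finite_measure set (borel 'rV[R]_n) -> \bar R},
  (forall f : borel 'rV[R]_n -> \bar R, measurable_fun setT f -> (forall y, 0 <= f y) ->
    \int[L]_y f y = integral_Rn f) /\
  (forall r : R, L [set y | (`|y| < r)%R] < +oo).
Proof.
elim: n => [|n [L [LE Lf]]].
  (* R^0 has one point, and the iterated integral over it is evaluation there. *)
  exists (\d_ ((0%R : 'rV[R]_0) : borel 'rV[R]_0)); split => [f mf f0|r].
    by rewrite integral_dirac // diracT mul1e.
  apply: le_lt_trans (ltry 1); rewrite /= diracE.
  by case: (_ \in _); rewrite lee_fin.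
pose prod : {measure set (measurableTypeR R * borel 'rV[R]_n) -> \bar R} :=
  (lebesgue_measure \x L).
have mc := @measurable_cons_row R n.
pose cr : (measurableTypeR R * borel 'rV[R]_n)%type -> borel 'rV[R]_n.+1 := cons_row (n := n).
pose P' : {measure set (borel 'rV[R]_n.+1) -> \bar R} := pushforward prod cr.
pose P := P' mc.
have mball m (r : R) : measurable ([set y | (`|y| < r)%R] : set (borel 'rV[R]_m)).
  by apply: open_borel; exact: norm_ball_open.
have Pfin (r : R) : P [set y | (`|y| < r)%R] < +oo.
  apply: (@le_lt_trans _ _ (prod (`](- r)%R, r[%classic `*` [set v : 'rV[R]_n | (`|v| < r)%R]))).
    rewrite -[P _]/(prod (cr @^-1` [set y | (`|y| < r)%R])).
    apply: le_measure; rewrite ?inE.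
    - by rewrite -[X in measurable X]setTI; exact: (mc measurableT _ (mball _ _)).
    - by apply: measurableX => //; exact: mball.
    move=> [s v] /= H; have r0 : (0 < r)%R by apply: le_lt_trans H.
    move/(rV_norm_lt _ r0) : H => H; split => /=.
      have := H (lshift n (ord0 : 'I_1)); rewrite /cr /cons_row /= (row_mxEl (const_mx s : 'rV_1) v) mxE.
      by rewrite in_itv /= -ltr_norml.
    apply/(rV_norm_lt _ r0) => i.
    by have := H (rshift 1 i); rewrite /cr /cons_row /= (row_mxEr (const_mx s : 'rV_1) v).
  have -> : prod (`](- r)%R, r[%classic `*` [set v : 'rV[R]_n | (`|v| < r)%R]) =
      lebesgue_measure (`](- r)%R, r[%classic : set R) * L [set v : 'rV[R]_n | (`|v| < r)%R].
    by apply: product_measure1E => //; exact: mball.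
  rewrite lebesgue_measure_itv /=; case: ifP => [|_]; last by rewrite mul0e.
  rewrite lte_fin => rr; rewrite -EFinD; apply: lte_mul_pinfty => //.
  by rewrite lee_fin opprK addr_ge0 //; move: rr; lra.
have Psf : sigma_finite setT P.
  exists (fun k => [set y | (`|y| < k%:R)%R]); first exact: norm_balls_cover.
  by move=> k; split; [exact: mball|exact: Pfin].
pose H2 := isSFinite.Build _ _ _ _ (sfinite_measure_sigma_finite Psf).
pose H3 := isSigmaFinite.Build _ _ _ _ Psf.
pose L' := HB.pack_for (SigmaFiniteMeasure.type (borel 'rV[R]_n.+1) R) (Measure.sort P) H2 H3.
exists L'; split => [f mf f0|]; last exact: Pfin.
transitivity (\int[P]_y f y); first by [].
rewrite /P /P' ge0_integral_pushforward // preimage_setT fubini_tonelli1 //=; last exact: measurableT_comp.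
apply: eq_integral => t _; rewrite /fubini_F -LE //.
exact: (measurableT_comp mf (measurable_fun_pair2 _ mc)).
Qed.

End LebesgueRn.

Section Translation.
Variable R : realType.
Local Open Scope ereal_scope.

(** Uniqueness of Lebesgue measure: its image under the translation agrees with it on half-open
    intervals. *)
Lemma lebesgue_integral_shift (a : R) (f : measurableTypeR R -> \bar R) :
  measurable_fun setT f -> (forall t, 0 <= f t) ->
  \int[lebesgue_measure]_t f (t + a)%R = \int[lebesgue_measure]_t f t.
Proof.
move=> mf f0.
pose s : measurableTypeR R -> measurableTypeR R := fun t => (t + a)%R.
have ms : measurable_fun setT s by apply: measurable_funD.
pose P' : {measure set (measurableTypeR R) -> \bar R} := pushforward lebesgue_measure s.
pose P := P' ms.
have E A : measurable A -> lebesgue_measure A = P A.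
  move=> mA; apply: lebesgue_measure_unique => //= _ [[x y]] _ <-.
  rewrite -[P _]/(lebesgue_measure (s @^-1` `]x, y]%classic)).
  have -> : s @^-1` `]x, y]%classic = `](x - a)%R, (y - a)%R]%classic.
    by apply/seteqP; split => t /=; rewrite !in_itv /= /s lterBDr lerBrDr.
  rewrite !lebesgue_measure_itv /= !lte_fin ltrD2r; case: ifP => // _.
  by rewrite -!EFinB; congr (_%:E); ring.
transitivity (\int[P]_t f t); last by apply: eq_measure_integral => A mA _; exact/esym/E.
by rewrite /P /P' ge0_integral_pushforward.
Qed.

Lemma integral_Rn_shift n (v : 'rV[R]_n) (f : borel 'rV[R]_n -> \bar R) :
  measurable_fun setT f -> (forall y, 0 <= f y) ->
  integral_Rn (fun y : 'rV[R]_n => f (y + v)%R) = integral_Rn f.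
Proof.
elim: n v f => [|n IH] v f mf f0 /=.
  by congr f; apply/rowP => -[].
have mfc : measurable_fun setT
    (f \o (cons_row (n := n) : measurableTypeR R * borel 'rV[R]_n -> borel 'rV[R]_n.+1)).
  by apply: measurableT_comp => //; exact: measurable_cons_row.
pose F (t : measurableTypeR R) := integral_Rn (fun w : 'rV[R]_n => f (cons_row (t, w))).
have mF : measurable_fun setT F.
  have [L [LE _]] := lebesgue_Rn R n.
  have := @measurable_fun_fubini_tonelli_F _ _ _ _ R L _ mfc (fun=> f0 _).
  congr (measurable_fun _ _); apply/funext => t; rewrite /fubini_F /F -LE //.
  exact: (measurable_fun_pair2 t mfc).
rewrite -[RHS]/(\int[lebesgue_measure]_t F t).
pose a := v ord0 (lshift n (ord0 : 'I_1)) : R.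
pose v' : 'rV[R]_n := rsubmx (v : 'rV[R]_(1 + n)).
rewrite -(lebesgue_integral_shift a) //; last first.
  move=> t; rewrite /F; have [L [LE _]] := lebesgue_Rn R n.
  rewrite -LE => [| |w]; [by apply: integral_ge0 => w _; exact: f0| |exact: f0].
  exact: (measurable_fun_pair2 t mfc).
apply: eq_integral => t _.
have mft : measurable_fun setT (fun w : borel 'rV[R]_n => f (cons_row ((t + a)%R, w))).
  exact: (@measurable_fun_pair2 _ _ _ _ _ _ _ ((t + a)%R : measurableTypeR R) mfc).
rewrite /F -(IH v' _ mft (fun=> f0 _)).
congr integral_Rn; apply/funext => w; congr f.
rewrite /cons_row /= -[in LHS](hsubmxK (v : 'rV[R]_(1 + n))).
rewrite (@add_row_mx _ 1 1 n); congr (@row_mx _ 1 1 n _ _).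
by apply/matrixP => i j; rewrite !ord1 !mxE.
Qed.

End Translation.

(** * Change of variables for a measure given by a density *)

Section Transfer.
Context d1 d2 (T1 : measurableType d1) (T2 : measurableType d2) (R : realType).
Variables (m1 : {measure set T1 -> \bar R}) (m2 : {measure set T2 -> \bar R}).
Variables (D1 : set T1) (D2 : set T2) (psi : T2 -> T1) (w : T2 -> R).
Hypotheses (mD1 : measurable D1) (mD2 : measurable D2).
Hypothesis psiD : forall y, D2 y -> D1 (psi y).
Hypothesis mpsi : measurable_fun D2 psi.
Hypothesis mw : measurable_fun D2 w.
Hypothesis w0 : forall y, D2 y -> 0 <= w y.
Local Open Scope ereal_scope.
Hypothesis m1E : forall A, measurable A -> A `<=` D1 ->
  m1 A = \int[m2]_(y in D2) (\1_A (psi y) * w y)%:E.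

Import HBNNSimple.

Let mpsi_comp d3 (T3 : measurableType d3) (h : T1 -> T3) :
  measurable_fun D1 h -> measurable_fun D2 (h \o psi).
Proof.
move=> mh; apply: (measurable_comp mD1) => //.
by move=> _ [y Dy <-]; exact: psiD.
Qed.

Let transfer_nnsfun (f : {nnsfun T1 >-> R}) :
  \int[m1]_(x in D1) (f x)%:E = \int[m2]_(y in D2) (f (psi y) * w y)%:E.
Proof.
under [LHS]eq_integral do rewrite fimfunE -fsumEFin//.
rewrite [LHS]ge0_integral_fsum//; last 2 first.
  - by move=> r; apply/measurable_EFinP/measurable_funTS/measurableT_comp.
  - by move=> r x _; exact: nnfun_muleindic_ge0.
under [RHS]eq_integral do rewrite fimfunE mulr_fsuml -fsumEFin//.
have mi r : measurable_fun D2 (fun y => \1_(f @^-1` [set r]) (psi y) : R).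
  apply: (@mpsi_comp _ (measurableTypeR R) (\1_(f @^-1` [set r]) : T1 -> R)).
  by apply: measurable_funTS.
rewrite [RHS]ge0_integral_fsum//; last 2 first.
  - move=> r; apply/measurable_EFinP; apply: measurable_funM => //.
    by apply: measurable_funM => //.
  - move=> r y Dy; rewrite EFinM mule_ge0 ?lee_fin ?w0 //.
    have := nnfun_muleindic_ge0 f r (psi y); by rewrite -EFinM lee_fin.
apply: eq_fsbigr => r _.
(* A value r < 0 is not taken by the nonnegative [f], so both sides vanish; homogeneity of the
   integral is then applied to r >= 0. *)
have [r0|r0] := leP 0%R r; last first.
  have f0 : f @^-1` [set r] = set0.
    apply/seteqP; split => // x /= fx; have : (0 <= f x)%R by exact: fun_ge0.
    by rewrite fx leNgt r0.
  by rewrite !f0 !integral0_eq // => x _; rewrite indic0 mulr0 ?mul0r.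
under [LHS]eq_integral do rewrite EFinM.
rewrite ge0_integralZl//; last by apply/measurable_EFinP/measurable_funTS.
under [RHS]eq_integral do rewrite -mulrA EFinM.
rewrite ge0_integralZl//; last 2 first.
  - by apply/measurable_EFinP; exact: measurable_funM.
  - by move=> y Dy; rewrite lee_fin mulr_ge0 ?w0.
congr (_ * _); rewrite integral_indic // m1E //; last exact: measurableI.
apply: eq_integral => y; rewrite inE => Dy; congr (_ * _)%:E.
by rewrite !indicE in_setI (mem_set (psiD Dy)) andbT.
Qed.

(** [m1E] is the case of indicator functions. Linearity extends it to simple functions, monotone
    convergence on both sides to nonnegative ones. *)
Lemma ge0_integral_transfer (F : T1 -> \bar R) :
  measurable_fun D1 F -> (forall x, D1 x -> 0 <= F x) ->
  \int[m1]_(x in D1) F x = \int[m2]_(y in D2) (F (psi y) * (w y)%:E).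
Proof.
move=> mF F0; pose g := nnsfun_approx mD1 mF.
have cvgg x : D1 x -> (g n x)%:E @[n --> \oo] --> F x.
  by move=> Dx; exact: cvg_nnsfun_approx.
transitivity (limn (fun n => \int[m1]_(x in D1) (g n x)%:E)).
  rewrite -monotone_convergence //.
  - by apply: eq_integral => x; rewrite inE => Dx; apply/esym/cvg_lim => //; exact: cvgg.
  - by move=> n; apply/measurable_EFinP/measurable_funTS.
  - by move=> n x _; rewrite lee_fin; exact: fun_ge0.
  - by move=> x _ a b ab; rewrite lee_fin; exact/lefP/nd_nnsfun_approx.
transitivity (limn (fun n => \int[m2]_(y in D2) (g n (psi y) * w y)%:E)).
  by congr (limn _); apply/funext => n; exact: transfer_nnsfun.
rewrite -monotone_convergence //.
- apply: eq_integral => y; rewrite inE => Dy; apply/cvg_lim => //.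
  under eq_fun do rewrite EFinM.
  by apply: cvgeMr => //; exact/cvgg/psiD.
- move=> n; apply/measurable_EFinP; apply: measurable_funM => //.
  by apply: mpsi_comp; exact: measurable_funTS.
- by move=> n y Dy; rewrite lee_fin mulr_ge0 ?w0 // fun_ge0.
- move=> y Dy a b ab; rewrite lee_fin ler_wpM2r ?w0 //.
  exact/lefP/nd_nnsfun_approx.
Qed.

Lemma integral_transfer (F : T1 -> R) : measurable_fun D1 F ->
  \int[m1]_(x in D1) (F x)%:E = \int[m2]_(y in D2) (F (psi y) * w y)%:E.
Proof.
move=> mF; have mF' : measurable_fun D1 (EFin \o F) by exact/measurable_EFinP.
rewrite integralE [RHS]integralE.
rewrite !ge0_integral_transfer //; try by [exact: measurable_funepos|exact: measurable_funeneg].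
congr (_ - _); apply: eq_integral => y; rewrite inE => Dy.
  by rewrite !funeposE /= -!EFin_max -EFinM maxr_pMl ?w0 // mul0r.
by rewrite !funenegE /= -!EFin_max -EFinM maxr_pMl ?w0 // mul0r mulNr.
Qed.

End Transfer.

Lemma bounded_integrable d (T : measurableType d) (R : realType)
    (m : {measure set T -> \bar R}) (D A : set T) (h : T -> R) (B : R) :
  measurable D -> measurable A -> A `<=` D -> (m A < +oo)%E -> measurable_fun D h ->
  (forall x, D x -> `|h x| <= B) -> (forall x, D x -> ~ A x -> h x = 0) ->
  m.-integrable D (EFin \o h).
Proof.
move=> mD mA AD mAoo mh hB h0; apply/integrableP; split; first exact/measurable_EFinP.
apply: (@le_lt_trans _ _ (\int[m]_(x in D) (`|B|%:E * (\1_A x)%:E))%E).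
  apply: ge0_le_integral => //.
  - by apply: measurableT_comp => //; exact/measurable_EFinP.
  - apply: emeasurable_funM => //.
    by apply/measurable_EFinP/measurable_funTS.
  - move=> x Dx /=; rewrite -EFinM lee_fin indicE; case: (boolP (x \in A)) => Ax.
      by rewrite mulr1; apply: le_trans (hB x Dx) (ler_norm _).
    rewrite h0 ?normr0 ?mulr0 //; by rewrite notin_setE in Ax.
rewrite ge0_integralZl //; last by apply/measurable_EFinP/measurable_funTS.
rewrite integral_indic // setIidl //.
by rewrite lte_mul_pinfty // lee_fin.
Qed.

(** * Integrals of partial derivatives over R^n *)

Section PartialIntegration.
Variables (R : realType) (n : nat).
Local Notation V := 'rV[R]_n.
Local Notation e_ i := (delta_mx 0 i : V).

Definition lebesgue_rV : {sigma_finite_measure set (borel V) -> \bar R} :=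
  projT1 (cid (lebesgue_Rn R n)).

Lemma integral_lebesgue_rV (f : borel V -> \bar R) : measurable_fun setT f ->
  (forall y, 0 <= f y)%E -> (\int[lebesgue_rV]_y f y)%E = integral_Rn f.
Proof. by move=> mf f0; rewrite /lebesgue_rV; case: cid => L [/= LE _]; exact: LE. Qed.

Lemma lebesgue_rV_ball (r : R) : (lebesgue_rV [set y : V | (`|y| < r)%R] < +oo)%E.
Proof. by rewrite /lebesgue_rV; case: cid => L [/= _]; apply. Qed.

Lemma norm_ball_measurable (r : R) : measurable ([set y : V | `|y| < r] : set (borel V)).
Proof. by apply: open_borel; exact: norm_ball_open. Qed.

Lemma continuous_support_bounded (h : V -> R) (r : R) : continuous h ->
  (forall y, r <= `|y| -> h y = 0) -> exists B, forall y, `|h y| <= B.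
Proof.
move=> hc h0.
(* For r < 0 the function is identically zero; the extreme value theorem used otherwise needs a
   nonempty ball. *)
have [r0|r0] := ltP r 0.
  by exists 0 => y; rewrite h0 ?normr0 // (le_trans (ltW r0)).
have Kc : compact [set y : V | `|y| <= r].
  apply: bounded_closed_compact.
    exists r; split; first exact: num_real.
    by move=> x rx y /= yr; apply: le_trans yr (ltW rx).
  have -> : [set y : V | `|y| <= r] = (fun y : V => `|y|) @^-1` [set x | x <= r] by [].
  apply: closed_comp => [y _|]; first exact: norm_continuous.
  exact: closed_le.
have K0 : [set y : V | `|y| <= r] !=set0 by exists 0; rewrite /= normr0.
have [|c _ cP] := @EVT_max_rV R n (fun y => `|h y|) _ K0 Kc.
  apply: continuous_subspaceT => y; apply: continuous_comp; first exact: hc.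
  exact: norm_continuous.
exists `|h c| => y; have [yr|yr] := leP `|y| r; first by apply: cP; rewrite inE.
by rewrite h0 ?normr0 // ltW.
Qed.

Lemma support_integrable (h : V -> R) (r : R) : continuous h ->
  (forall y, r <= `|y| -> h y = 0) ->
  lebesgue_rV.-integrable setT (EFin \o (h : borel V -> R)).
Proof.
move=> hc h0; have [B hB] := continuous_support_bounded hc h0.
apply: (@bounded_integrable _ _ _ _ _ [set y : borel V | `|y : V| < r] _ B) => //.
- exact: norm_ball_measurable.
- exact: lebesgue_rV_ball.
- by apply: continuous_borel_real => //; [exact: openT|move=> x _; exact: hc].
- by move=> y _ /negP; rewrite -leNgt; exact: h0.
Qed.

Lemma measurable_shift (v : V) :
  measurable_fun setT ((fun y : V => y + v) : borel V -> borel V).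
Proof.
apply: continuous_borel; first exact: openT.
move=> y _; apply: continuousD; [exact: cvg_id|exact: cst_continuous].
Qed.

Lemma integral_lebesgue_rV_shift (f : borel V -> R) (v : V) : measurable_fun setT f ->
  (\int[lebesgue_rV]_y (f ((y : V) + v))%:E = \int[lebesgue_rV]_y (f y)%:E)%E.
Proof.
move=> mf.
have H (F : borel V -> \bar R) : measurable_fun setT F -> (forall y, 0 <= F y)%E ->
    (\int[lebesgue_rV]_y F ((y : V) + v)%R = \int[lebesgue_rV]_y F y)%E.
  move=> mF F0; rewrite !integral_lebesgue_rV //; first exact: integral_Rn_shift.
  by apply: (measurableT_comp mF); exact: measurable_shift.
have mf' : measurable_fun setT (EFin \o f) by exact/measurable_EFinP.
rewrite integralE [RHS]integralE -(H _ (measurable_funepos mf') (fun y => funepos_ge0 _ y)).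
rewrite -(H _ (measurable_funeneg mf') (fun y => funeneg_ge0 _ y)).
by congr (_ - _)%E; apply: eq_integral => y _; rewrite ?funeposE ?funenegE.
Qed.

(** The difference quotients of f along e_i have integral zero by translation invariance. They are
    bounded by any bound of [pd i f] and supported in the ball of radius r + 1, so dominated
    convergence passes to the derivative. *)
Lemma pd_integral_eq0 (f : V -> R) (r : R) i : Ck 1 setT f ->
  (forall y, r <= `|y| -> f y = 0) ->
  (\int[lebesgue_rV]_y (pd i f y)%:E = 0)%E.
Proof.
move=> fC f0.
have fc : continuous f.
  by move=> y; have := CkW openT fC; apply.
have pc : continuous (pd i f) by move=> y; exact: fC.2.
have p0 y : r + 1 <= `|y| -> pd i f y = 0.
  move=> ry; pose U := [set z : V | r < `|z|].
  have Uo : open U.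
    have -> : U = setT `&` (fun z : V => `|z|) @^-1` [set x | r < x] by rewrite setTI.
    by apply: open_preimage; [exact: openT|move=> z _; exact: norm_continuous|exact: open_gt].
  have Uy : U y by rewrite /U /=; apply: lt_le_trans ry; rewrite ltrDl.
  rewrite (pd_eq _ Uo Uy (g := fun=> 0)) ?pd_cst // => z Uz.
  by apply: f0; exact: ltW.
have [B pB] := continuous_support_bounded pc p0.
have B0 : 0 <= B by apply: le_trans (pB 0).
(* Increments of length at most 1, so that all quotients are supported in the ball of radius r +
   1. *)
pose s (k : nat) : R := k.+1%:R^-1.
have s0 k : 0 < s k by rewrite invr_gt0 ltr0n.
have s1 k : s k <= 1 by rewrite invf_le1 ?ltr0n // ler1n.
pose u k (y : V) : R := (s k)^-1 * (f (y + s k *: e_ i) - f y).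
have df y : derivable f y (e_ i) by exact: fC.1.
have e1 : `|e_ i| <= 1.
  apply: norm_rV_le => // l; rewrite mxE eqxx /=.
  by case: (l == i); rewrite ?normr1 ?normr0.
have uB k y : `|u k y| <= B.
  rewrite /u normrM gtr0_norm ?invr_gt0 // mulrC ler_pdivrMr //.
  have := @pd_line_bound R n f y i (s k) 0 B (fun _ _ => df _).
  rewrite mul0r subr0 (gtr0_norm (s0 k)); apply => t _.
  by rewrite subr0.
have u0 k (y : V) : ~ (`|y| < r + 1) -> u k y = 0.
  move=> /negP; rewrite -leNgt => ry; rewrite /u !f0 ?subrr ?mulr0 //.
    by apply: le_trans ry; rewrite lerDl.
  have : `|y| <= `|y + s k *: e_ i| + `|s k *: e_ i|.
    by apply: le_trans (ler_normB _ _); rewrite addrK.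
  have : `|s k *: e_ i| <= 1.
    by rewrite normrZ gtr0_norm // -[leRHS]mulr1 ler_pM // ltW.
  move: ry; lra.
have fs k : continuous (fun y : V => f (y + s k *: e_ i)).
  move=> y; apply: (@continuous_comp V V R (fun y : V => y + s k *: e_ i) f); last exact: fc.
  by apply: continuousD; [exact: cvg_id|exact: cst_continuous].
have uc k : continuous (u k).
  move=> y; apply: (@continuousM R V (fun=> (s k)^-1)); first exact: cst_continuous.
  by apply: continuousB; [exact: fs|exact: fc].
have mu k : measurable_fun setT (u k : borel V -> R).
  by apply: continuous_borel_real; [exact: openT|move=> y _; exact: uc].
have mf : measurable_fun setT (f : borel V -> R).
  by apply: continuous_borel_real; [exact: openT|move=> y _; exact: fc].
have Iu k : (\int[lebesgue_rV]_y (u k y)%:E = 0)%E.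
  under eq_integral do rewrite EFinM EFinB.
  have If : lebesgue_rV.-integrable setT (EFin \o (f : borel V -> R)).
    exact: (support_integrable fc f0).
  have Ifs : lebesgue_rV.-integrable setT (EFin \o (fun y : borel V => f ((y : V) + s k *: e_ i))).
    apply: (@support_integrable (fun y : V => f (y + s k *: e_ i)) (r + 1)) => // y ry.
    apply: f0; have : `|y| <= `|y + s k *: e_ i| + `|s k *: e_ i|.
      by apply: le_trans (ler_normB _ _); rewrite addrK.
    have : `|s k *: e_ i| <= 1.
      by rewrite normrZ gtr0_norm // -[leRHS]mulr1 ler_pM // ltW.
    move: ry; lra.
  rewrite integralZl //; last exact: integrableB.
  rewrite integralB //=.
  rewrite (integral_lebesgue_rV_shift (s k *: e_ i) mf) subee ?mule0 //.
  exact: integrable_fin_num.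
have cvu y : u k y @[k --> \oo] --> pd i f y.
  apply/cvgrPdist_le => eps eps0.
  have /cvgrPdist_le /(_ _ eps0)/nbhs_ballP[d /= d0 dP] := pc y.
  near=> k.
  have sk : s k < d.
    by near: k; exact: near_infty_natSinv_lt (PosNum d0).
  have := @pd_line_bound R n f y i (s k) (pd i f y) eps (fun _ _ => df _).
  rewrite (gtr0_norm (s0 k)) => /(_ _)/wrap[t ts|].
    rewrite -opprB normrN; apply: dP; rewrite -ball_normE /ball_ /= opprD addNKr normrN normrZ.
    apply: le_lt_trans sk; rewrite -[leRHS]mulr1 ler_pM //.
  move=> H; rewrite -opprB normrN.
  have -> : u k y - pd i f y = (s k)^-1 * (f (y + s k *: e_ i) - f y - pd i f y * s k).
    rewrite [RHS]mulrBr; congr (_ - _); rewrite mulrCA mulVf ?mulr1 // gt_eqF //.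
  by rewrite normrM gtr0_norm ?invr_gt0 // mulrC ler_pdivrMr.
pose g (y : borel V) : R := B * \1_[set y : borel V | `|y : V| < r + 1] y.
have ig : lebesgue_rV.-integrable setT (EFin \o g).
  apply: (@bounded_integrable _ _ _ _ _ [set y : borel V | `|y : V| < r + 1] _ B) => //.
  - exact: norm_ball_measurable.
  - exact: lebesgue_rV_ball.
  - by apply: measurable_funM => //; apply: measurable_indic; exact: norm_ball_measurable.
  - by move=> y _; rewrite /g indicE; case: (_ \in _); rewrite ?mulr1 ?mulr0 ?normr0 // ger0_norm.
  - by move=> y _ ny; rewrite /g indicE memNset ?mulr0.
have mp : measurable_fun setT (pd i f : borel V -> R).
  by apply: continuous_borel_real; [exact: openT|move=> y _; exact: pc].
have [| | | | |_ _ H] := @dominated_convergence _ _ _ lebesgue_rV _ measurableT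
  (fun k (y : borel V) => (u k y)%:E) (fun y : borel V => (pd i f y)%:E) (EFin \o g).
- by move=> k; exact/measurable_EFinP.
- exact/measurable_EFinP.
- by apply: aeW => y _; apply: cvg_EFin; [exact: nearW|exact: cvu].
- exact: ig.
- apply: aeW => y k _; rewrite /= lee_fin /g indicE.
  have [ry|ry] := boolP (y \in _); first by rewrite mulr1 uB.
  by rewrite u0 ?normr0 ?mulr0 //; rewrite notin_setE in ry.
move: H; rewrite (_ : (fun _ => _) = fun=> 0%E); last by apply/funext => k; rewrite Iu.
by move=> H; rewrite -(cvg_lim (@ereal_hausdorff R) H); exact: lim_cst.
Unshelve. all: by end_near. Qed.

End PartialIntegration.

(** * The Riemannian volume and the divergence theorem *)

Section RiemannianVolume.
Variables (R : realType) (n : nat) (M : ptopologicalType).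
Variables (X : smooth_manifold R n M) (Z : set M) (g : M -> 'M[R]_n).
Hypothesis Zc : closed Z.
Hypothesis gR : riemannian_metric X Z g.
Variable mu : {measure set (borel M) -> \bar R}.
Hypothesis mu_vol : riemannian_volume X Z g mu.
Local Notation V := 'rV[R]_n.

Lemma cinv_reg c y : atlas X c -> reg Z c y -> cdom c (cinv c y) /\ ~ Z (cinv c y).
Proof. by move=> ca [x [cx Zx] <-]; rewrite (cinvK ca cx). Qed.

Lemma cinv_measurable c : atlas X c ->
  measurable_fun (reg Z c : set (borel V)) (cinv c : borel V -> borel M).
Proof.
move=> ca; apply: continuous_borel; first exact: reg_open Zc _ ca.
move=> _ [x [cx Zx] <-].
have [_ _ _ _] := atlas_chart ca; apply; by exists x.
Qed.

Lemma chart_vol_measurable c : atlas X c ->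
  measurable_fun (reg Z c : set (borel V)) (vol (local2 X c g) : borel V -> R).
Proof.
move=> ca; have ro := reg_open Zc ca.
apply: continuous_borel_real => // y ry.
exact: (vol_Ck ro (metric_Ck gR ca) (metric_posdef gR ca) 0%N).
Qed.

Lemma chart_domain_measurable c : atlas X c -> measurable (cdom c `\` Z : set (borel M)).
Proof.
move=> ca; apply: (@measurableD _ (borel M)); last exact: closed_borel.
by apply: open_borel; exact: cdom_open ca.
Qed.

(** Restates [mu_vol] as an integral for the measure [lebesgue_rV]. On [reg Z c] the indicator of
    the image of A is that of A composed with [cinv c]; elsewhere it is zero. *)
Lemma volume_chart c (A : set (borel M)) : atlas X c -> measurable A -> A `<=` cdom c `\` Z ->
  (mu A = \int[lebesgue_rV R n]_(y in reg Z c)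
    (\1_A (cinv c y) * vol (local2 X c g) y)%:E)%E.
Proof.
move=> ca mA AU; have ro := reg_open Zc ca.
have mr : measurable (reg Z c : set (borel V)) by exact: open_borel ro.
rewrite integral_mkcond integral_lebesgue_rV; last 2 first.
- apply/(measurable_restrictT _ mr)/measurable_EFinP.
  apply: measurable_funM; last exact: chart_vol_measurable.
  apply: (@measurableT_comp _ _ _ (borel V) (borel M) (measurableTypeR R) (\1_A : borel M -> R)).
    by apply: measurable_indic.
  exact: cinv_measurable.
- move=> y; rewrite patchE; case: ifP => // yr; rewrite lee_fin mulr_ge0 //.
  by rewrite sqrtr_ge0.
rewrite (mu_vol ca mA AU); congr integral_Rn; apply/funext => y.
rewrite patchE; case: ifP => [|/negbT]; rewrite ?(inE,notin_setE) => ry.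
  congr (_ * _)%:E; rewrite !indicE; congr ((nat_of_bool _)%:R); apply/idP/idP; rewrite !inE.
    by move=> [x Ax <-]; rewrite (cinvK ca) //; case: (AU _ Ax).
  by case: ry => x [cx Zx] <-; rewrite (cinvK ca cx) => Ax; exists x.
rewrite indicE memNset ?mul0r // => -[x Ax yx]; apply: ry; exists x => //; exact: AU.
Qed.

Lemma integral_chart c (F : M -> R) : atlas X c ->
  measurable_fun (cdom c `\` Z : set (borel M)) (F : borel M -> R) ->
  (\int[mu]_(x in cdom c `\` Z) (F x)%:E =
   \int[lebesgue_rV R n]_(y in reg Z c) (F (cinv c y) * vol (local2 X c g) y)%:E)%E.
Proof.
move=> ca mF; apply: (integral_transfer (T1 := borel M) (T2 := borel V)) => //.
- exact: chart_domain_measurable ca.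
- by apply: open_borel; exact: reg_open Zc _ ca.
- by move=> y; exact: cinv_reg.
- exact: cinv_measurable.
- exact: chart_vol_measurable.
- by move=> y _; exact: sqrtr_ge0.
- by move=> A mA AU; exact: volume_chart.
Qed.

Lemma compact_fset_cover (K : set M) (O : M -> set M) : compact K ->
  (forall x, K x -> open (O x) /\ O x x) ->
  exists2 s : seq M, (forall x, x \in s -> K x) & K `<=` \big[setU/set0]_(x <- s) O x.
Proof.
rewrite compact_cover => Kc KO.
have [||D DK KD] := Kc M K O; first by move=> x /KO[].
  by move=> x Kx; exists x => //; case: (KO x Kx).
exists (finmap.enum_fset D) => [x xD|]; first by have := DK x xD; rewrite inE.
by rewrite -bigcup_fset.
Qed.

(** Near x the density is at most [v (c x) + 1] and the coordinates stay in a ball of R^n, which has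
    finite measure. *)
Lemma volume_locally_finite x : ~ Z x ->
  exists O, [/\ open O, O x & (mu (O : set (borel M)) < +oo)%E].
Proof.
move=> Zx; pose c := chart_at X x.
have ca : atlas X c by exact: chart_at_atlas.
have cx : cdom c x by exact: chart_at_dom.
have ro := reg_open Zc ca; have rcx := reg_in cx Zx.
pose v := vol (local2 X c g); pose b := v (c x) + 1.
have vc : {for c x, continuous v}.
  exact: (vol_Ck ro (metric_Ck gR ca) (metric_posdef gR ca) 0%N).
have [e e0 eP] : exists2 e : R, 0 < e & forall y, `|y - c x| < e -> v y <= b.
  have /cvgrPdist_lt /(_ 1 ltr01)/nbhs_ballP[e /= e0 eP] := vc.
  exists e => // y ye; have := eP y; rewrite -ball_normE /ball_ /= distrC => /(_ ye).
  by rewrite ltr_distlC => /andP[_ /ltW].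
pose O := (cdom c `\` Z) `&` c @^-1` ball (c x) e.
have Uo : open (cdom c `\` Z).
  by rewrite setDE; apply: openI; [exact: cdom_open ca|exact: closed_openC].
have Oo : open O.
  apply: (@open_preimage M V _ c (ball (c x) e)) => //; last exact: ball_open.
  by move=> z [cz _]; case: (atlas_chart ca) => _ _ _ + _; exact.
have OP z : O z -> `|c z - c x| < e by case=> _ /=; rewrite -ball_normE /ball_ /= distrC.
exists O; split => //; first by split=> //=; exact: ballxx.
have mO := open_borel Oo.
have OU : O `<=` cdom c `\` Z by move=> z [].
rewrite (volume_chart ca mO OU).
pose r := `|c x| + e.
apply: (@le_lt_trans _ _ (\int[lebesgue_rV R n]_(y in reg Z c)
    (b%:E * (\1_[set y : borel V | (`|y : V| < r)%R] y)%:E))%E).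
  apply: ge0_le_integral => //.
  - exact: open_borel ro.
  - by move=> y _; rewrite lee_fin mulr_ge0 // sqrtr_ge0.
  - apply/measurable_EFinP/measurable_funM; last exact: chart_vol_measurable.
    apply: (@measurableT_comp _ _ _ (borel V) (borel M) (measurableTypeR R) (\1_O : borel M -> R)).
      by apply: measurable_indic.
    exact: cinv_measurable.
  - apply: emeasurable_funM => //; apply/measurable_EFinP/measurable_funTS.
    by apply: measurable_indic; exact: norm_ball_measurable.
  - move=> y [z [cz Zz] zy]; rewrite -zy (cinvK ca cz) -EFinM lee_fin !indicE.
    have b0 : 0 <= b by rewrite addr_ge0 // sqrtr_ge0.
    have [Oz|_] := boolP (z \in O); last by rewrite mul0r mulr_ge0.
    rewrite inE in Oz; have ze := OP _ Oz.
    rewrite mul1r mem_set ?mulr1; first exact: eP.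
    rewrite /= /r -[c z](subrK (c x)) addrC; apply: le_lt_trans (ler_normD _ _) _.
    by rewrite ltrD2l.
rewrite ge0_integralZl //; last 3 first.
- exact: open_borel ro.
- apply/measurable_EFinP/measurable_funTS; apply: measurable_indic; exact: norm_ball_measurable.
- by rewrite lee_fin addr_ge0 // sqrtr_ge0.
rewrite integral_indic //; [|exact: open_borel|exact: norm_ball_measurable].
rewrite lte_mul_pinfty ?lee_fin ?addr_ge0 ?sqrtr_ge0 //.
apply: le_lt_trans (lebesgue_rV_ball n r); apply: le_measure; rewrite ?inE //.
  by apply: measurableI; [exact: norm_ball_measurable|exact: open_borel ro].
exact: norm_ball_measurable.
Qed.

Lemma volume_compact_finite (K : set M) : compact K -> K `<=` ~` Z ->
  (mu (K : set (borel M)) < +oo)%E.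
Proof.
move=> Kc KZ.
have H x : exists O, ~ Z x -> [/\ open O, O x & (mu (O : set (borel M)) < +oo)%E].
  have [Zx|Zx] := pselect (Z x); first by exists set0.
  by have [U HU] := volume_locally_finite Zx; exists U.
have [ O HO] := choice H.
have [x Kx|s sK Ks] := compact_fset_cover (O := O) Kc; first by case: (HO x (KZ x Kx)).
have mO x : x \in s -> measurable (O x : set (borel M)).
  by move=> /sK/KZ/HO[ Oo _ _]; exact: open_borel.
have mK : measurable (K : set (borel M)).
  by apply: closed_borel; exact: (compact_closed (manifold_hausdorff X)).
have ms : measurable (\big[setU/set0]_(x <- s) O x : set (borel M)).
  elim: (s) mO => [|x t IH] mO; first by rewrite big_nil.
  rewrite big_cons; apply: (@measurableU _ (borel M)); first by apply: mO; rewrite mem_head.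
  by apply: IH => y yt; apply: mO; rewrite inE yt orbT.
apply: (@le_lt_trans _ _ (mu (\big[setU/set0]_(x <- s) O x : set (borel M)))).
  by apply: le_measure => //; rewrite inE.
elim: (s) sK {Ks ms} mO => [|x t IH] sK mO; first by rewrite big_nil measure0.
have mx := mO _ (mem_head _ _).
have tK y : y \in t -> K y by move=> yt; apply: sK; rewrite inE yt orbT.
have mt y : y \in t -> measurable (O y : set (borel M)).
  by move=> yt; apply: mO; rewrite inE yt orbT.
have mU : measurable (\big[setU/set0]_(x <- t) O x : set (borel M)).
  elim: (t) mt => [|z u IHu] mt; first by rewrite big_nil.
  rewrite big_cons; apply: (@measurableU _ (borel M)); first by apply: mt; rewrite mem_head.
  by apply: IHu => y yt; apply: mt; rewrite inE yt orbT.
rewrite big_cons; apply: le_lt_trans (measureU2 _ mx mU) _.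
by rewrite lte_add_pinfty ?IH //; case: (HO x (KZ x (sK x (mem_head _ _)))).
Qed.

Hypothesis M_compact : compact [set: M].

(** M being compact, finitely many chosen charts cover it, and a finite union of measurable pieces
    is harmless. *)
Lemma measurable_charts d (T : measurableType d) (f : borel M -> T) :
  (forall c, atlas X c -> measurable_fun (cdom c `\` Z : set (borel M)) f) ->
  measurable_fun (~` Z : set (borel M)) f.
Proof.
move=> mf.
have [x _|s _ sM] := compact_fset_cover (O := fun x => cdom (chart_at X x)) M_compact.
  by split; [exact/cdom_open/chart_at_atlas|exact: chart_at_dom].
have -> : ~` Z = \big[setU/set0]_(x <- s) (cdom (chart_at X x) `\` Z).
  rewrite -!bigcup_seq in sM *; apply/seteqP; split => [x Zx|x [y _ []] //].
  by have [y ys yx] := sM x I; exists y.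
elim: s {sM} => [|x s IH]; first by rewrite big_nil; exact: measurable_fun_set0.
have mD y := chart_domain_measurable (chart_at_atlas X y).
rewrite big_cons; apply/measurable_funU => //.
  by elim: s {IH} => [|y s IH]; rewrite ?big_nil ?big_cons //; exact: (@measurableU _ (borel M)).
split; [apply: mf; exact: chart_at_atlas|exact: IH].
Qed.

End RiemannianVolume.

(** * Divergence theorem inside one chart *)

Section LocalDivergence.
Variables (R : realType) (n : nat) (M : ptopologicalType).
Variables (X : smooth_manifold R n M) (Z : set M) (g : M -> 'M[R]_n).
Hypothesis Zc : closed Z.
Hypothesis gR : riemannian_metric X Z g.
Variable mu : {measure set (borel M) -> \bar R}.
Hypothesis mu_vol : riemannian_volume X Z g mu.
Local Notation V := 'rV[R]_n.

Lemma compact_image_bounded (T : topologicalType) (U : normedModType R) (K : set T) (f : T -> U) :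
  compact K -> (forall x, K x -> {for x, continuous f}) ->
  exists B : R, forall x, K x -> `|f x| <= B.
Proof.
move=> Kc fc; have [|B [_ /(_ (B + 1))]] := @compact_bounded R U (f @` K).
  apply: continuous_compact => //; apply: continuous_in_subspaceT => x; rewrite inE; exact: fc.
rewrite ltrDl ltr01 => /(_ isT) HB; exists (B + 1) => x Kx; apply: HB; by exists x.
Qed.

Lemma continuous_chart (T : topologicalType) c (F : M -> T) x : atlas X c -> cdom c x ->
  {for c x, continuous (F \o cinv c)} -> {for x, continuous F}.
Proof.
move=> ca cx Fc; have cc : {for x, continuous c}.
  by case: (atlas_chart ca) => _ _ _ + _; apply.
have cF : {for x, continuous ((F \o cinv c) \o c)} by exact: continuous_comp cc Fc.
rewrite /prop_for /continuous_at -{2}(cinvK ca cx).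
apply: cvg_trans cF; apply: near_eq_cvg; near=> z => /=.
rewrite (cinvK ca) //; near: z; apply: open_nbhs_nbhs; split => //; exact: cdom_open ca.
Unshelve. all: by end_near. Qed.

Lemma continuous_regular_measurable (F : M -> R) : (forall x, ~ Z x -> {for x, continuous F}) ->
  measurable_fun (~` Z : set (borel M)) (F : borel M -> R).
Proof. by move=> Fc; apply: continuous_borel_real => //; exact: closed_openC. Qed.

Lemma compact_support_integrable (F : M -> R) (K : set M) : compact K -> K `<=` ~` Z ->
  (forall x, ~ Z x -> {for x, continuous F}) -> (forall x, ~ K x -> F x = 0) ->
  mu.-integrable (~` Z : set (borel M)) (EFin \o (F : borel M -> R)).
Proof.
move=> Kc KZ Fc F0; have [x Kx|B FB] := compact_image_bounded Kc (f := (F : M -> R^o)).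
  exact/Fc/KZ.
have mK : measurable (K : set (borel M)).
  by apply: closed_borel; exact: (compact_closed (manifold_hausdorff X)).
apply: (@bounded_integrable _ (borel M) _ _ _ K _ `|B|) => //.
- by apply: open_borel; exact: closed_openC.
- exact: (volume_compact_finite Zc gR mu_vol Kc KZ).
- exact: continuous_regular_measurable.
- move=> x _; have [Kx|/F0->] := pselect (K x); last by rewrite normr0.
  by apply: le_trans (FB x Kx) (ler_norm _).
- by move=> x _; exact: F0.
Qed.

Lemma vol_div_local c Y y : atlas X c -> (forall x, ~ Z x -> diff1 X Y x) -> reg Z c y ->
  div X g Y (cinv c y) * vol (local2 X c g) y =
  \sum_i pd i (fun z => vol (local2 X c g) z * sharp (local2 X c g) (local1 X c Y) z 0 i) y.
Proof.
move=> ca dY [x [cx Zx] <-]; have rx := reg_in cx Zx.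
rewrite (cinvK ca cx) (div_local Zc gR ca cx Zx (dY _ Zx)) mulrC.
apply: (vol_div1 (reg_open Zc ca) (metric_Ck gR ca) (metric_posdef gR ca) rx).
by apply: (diff1_chart Zc) (dY _ Zx).
Qed.

(** Divide the Voss-Weyl formula by the positive density: one continuous derivative of Y suffices,
    which suits the C^1 partition of unity used later. *)
Lemma div_continuous c Y x : atlas X c -> cdom c x -> ~ Z x ->
  (forall x, ~ Z x -> diff1 X Y x) ->
  (forall j, Ck 1 (reg Z c) (fun y => local1 X c Y y 0 j)) ->
  {for x, continuous (div X g Y)}.
Proof.
move=> ca cx Zx dY YC; have ro := reg_open Zc ca; have rx := reg_in cx Zx.
have GC := metric_Ck gR ca; have Gp := metric_posdef gR ca.
have wC i : Ck 1 (reg Z c)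
    (fun z => vol (local2 X c g) z * sharp (local2 X c g) (local1 X c Y) z 0 i).
  by apply: CkM => //; [exact: vol_Ck|exact: sharp_Ck].
apply: (continuous_chart ca cx).
apply: (continuous_eq ro rx (f := fun y => (\sum_i pd i
    (fun z => vol (local2 X c g) z * sharp (local2 X c g) (local1 X c Y) z 0 i) y)
  * (vol (local2 X c g) y)^-1)).
  by move=> y ry; rewrite -vol_div_local // mulfK // gt_eqF // (vol_gt0 Gp ry).
apply: (@continuousM R V (fun y => \sum_i pd i
    (fun z => vol (local2 X c g) z * sharp (local2 X c g) (local1 X c Y) z 0 i) y)).
  by apply: continuous_at_sum => i; exact: (wC i).2.
apply: continuousV; first by rewrite gt_eqF // (vol_gt0 Gp rx).
by apply: (vol_Ck ro GC Gp 0%N); exact: reg_in.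
Qed.

(** In the chart the integrand is a sum of partial derivatives of the [w i]. Extended by zero beyond
    the compact image of K, these are C^1 on R^n, and each integral vanishes by
    [pd_integral_eq0]. *)
Lemma local_divergence c Y (K : set M) : atlas X c -> compact K -> K `<=` cdom c `\` Z ->
  (forall x, ~ K x -> Y x = 0) ->
  (forall j, Ck 1 (reg Z c) (fun y => local1 X c Y y 0 j)) ->
  (forall x, ~ Z x -> diff1 X Y x) ->
  (\int[mu]_(x in ~` Z) (div X g Y x)%:E = 0)%E.
Proof.
move=> ca Kc KU Y0 YC dY; have ro := reg_open Zc ca.
have GC := metric_Ck gR ca; have Gp := metric_posdef gR ca.
pose G := local2 X c g; pose eta := local1 X c Y.
pose w i y := vol G y * sharp G eta y 0 i.
have wC i : Ck 1 (reg Z c) (w i).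
  by apply: CkM => //; [exact: vol_Ck|exact: sharp_Ck].
pose L : set V := c @` K.
have Lc : compact L.
  apply: continuous_compact => //; apply: continuous_in_subspaceT => x; rewrite inE => /KU[cx _].
  by case: (atlas_chart ca) => _ _ _ + _; apply.
have Lo : open (~` L) by apply: closed_openC; apply: compact_closed => //; exact: norm_hausdorff.
have Lr : L `<=` reg Z c by move=> _ [x /KU Ux <-]; exists x.
have w0 i y : reg Z c y -> ~ L y -> w i y = 0.
  move=> [x [cx Zx] <-] Lx; rewrite /w /sharp mxE big1 ?mulr0 // => k _.
  rewrite /eta local1E // Y0 ?mul0mx ?mxE ?mul0r // => Kx; apply: Lx; by exists x.
pose f i y : R := if `[< reg Z c y >] then w i y else 0.
have fL i y : ~ L y -> f i y = 0 by rewrite /f; case: asboolP => // ry; exact: w0.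
have fw i y : reg Z c y -> w i y = f i y by rewrite /f; case: asboolP.
have fC i : Ck 1 setT (f i).
  apply: Ck_local => y _; have [Ly|Ly] := pselect (L y).
    exists (reg Z c); split => //; first exact: Lr.
    by apply: (Ck_eq ro _ (wC i)) => z; exact: fw.
  exists (~` L); split => //; apply: (Ck_eq Lo (f := fun=> 0)); last exact: Ck_cst.
  by move=> z /fL->.
have pf i y : reg Z c y -> pd i (w i) y = pd i (f i) y.
  by move=> ry; apply: (pd_eq _ ro ry) => z; exact: fw.
have p0 i y : ~ L y -> pd i (f i) y = 0.
  by move=> Ly; rewrite (pd_eq _ Lo Ly (g := fun=> 0)) ?pd_cst // => z /fL.
have [r rL] : exists r : R, forall y, r <= `|y| -> ~ L y.
  have [|r rP] := @compact_image_bounded V V L id Lc; first by move=> y _; exact: cvg_id.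
  by exists (r + 1) => y ry /rP; rewrite leNgt (lt_le_trans _ ry) // ltrDl.
have div0 x : ~ K x -> div X g Y x = 0.
  by move=> Kx; rewrite divE (nabla_support _ _ Kc Y0 Kx) mulmx0 mxtrace0.
have divw y : reg Z c y -> div X g Y (cinv c y) * vol G y = \sum_i pd i (f i) y.
  by move=> ry; rewrite vol_div_local //; apply: eq_bigr => i _; exact: pf.
have pc i : continuous (pd i (f i)) by move=> y; exact: (fC i).2.
have -> : (\int[mu]_(x in ~` Z) (div X g Y x)%:E =
           \int[mu]_(x in cdom c `\` Z) (div X g Y x)%:E)%E.
  rewrite integral_mkcond [RHS]integral_mkcond; apply: eq_integral => x _.
  rewrite !patchE; case: ifPn; rewrite ?(inE,notin_setE) => Zx.
    case: ifPn; rewrite ?(inE,notin_setE) // => Ux; rewrite div0 // => /KU Kx; exact: Ux.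
  by rewrite memNset // => -[].
rewrite (integral_chart Zc gR mu_vol ca); last first.
  apply: continuous_borel_real => [|x [cx Zx]].
    by rewrite setDE; apply: openI; [exact: cdom_open ca|exact: closed_openC].
  exact: (div_continuous ca cx Zx dY YC).
transitivity (\int[lebesgue_rV R n]_y (\sum_i (pd i (f i) y)%:E))%E.
  rewrite integral_mkcond; apply: eq_integral => y _; rewrite patchE sumEFin.
  case: ifPn; rewrite ?(inE,notin_setE) => ry; first by rewrite divw.
  by rewrite big1 // => i _; rewrite p0 // => /Lr.
rewrite (@integral_sum _ (borel V) _ (lebesgue_rV R n) _ measurableT _
  (fun i (y : borel V) => (pd i (f i) y)%:E)); last first.
  by move=> i; apply: (@support_integrable _ _ (pd i (f i)) r) => // y /rL; exact: p0.
by rewrite big1 // => i _; apply: (pd_integral_eq0 (r := r)) => // y /rL; exact: fL.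
Qed.

End LocalDivergence.

(** * Bump functions of class C^1 *)

Section Bump.
Variable R : realType.

(** The square of the positive part is C^1 with derivative [2 * Num.max 0 u]. The divergence theorem
    asks no more regularity of a partition of unity, so this polynomial cutoff replaces a smooth
    one. *)
Definition pos2 (u : R) : R := Num.max 0 u ^+ 2.

Lemma pos2_gt0 u : (0 < pos2 u) = (0 < u).
Proof.
rewrite /pos2; have [u0|u0] := leP u 0.
  by rewrite expr0n ltxx.
by rewrite exprn_gt0.
Qed.

Lemma pos2_le0 u : u <= 0 -> pos2 u = 0.
Proof. by move=> u0; rewrite /pos2 max_l // expr0n. Qed.

Lemma pos2_taylor (u h : R) :
  `|pos2 (u + h) - pos2 u - 2 * Num.max 0 u * h| <= h ^+ 2.
Proof.
rewrite /pos2; case: (leP u 0) => u0; case: (leP (u + h) 0) => uh.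
- by rewrite expr0n /= mulr0 mul0r !subr0 normr0 sqr_ge0.
- rewrite expr0n /= mulr0 mul0r !subr0 ger0_norm ?sqr_ge0 // ler_sqr ?nnegrE; lra.
- rewrite ler_norml; apply/andP; split; nra.
- rewrite ler_norml; apply/andP; split; nra.
Qed.

Lemma is_derive_pos2 (u : R) : is_derive u 1 pos2 (2 * Num.max 0 u).
Proof.
suff H : (fun h : R => h^-1 *: (pos2 (h *: 1 + u) - pos2 u)) @ 0^' --> 2 * Num.max 0 u.
  by apply: DeriveDef; [apply/cvg_ex; exists (2 * Num.max 0 u)|exact: cvg_lim].
apply/cvgrPdist_lt => eps e0; near=> h.
have h0 : h != 0 by near: h; exact: nbhs_dnbhs_neq.
have -> : 2 * Num.max 0 u - h^-1 *: (pos2 (h *: 1 + u) - pos2 u) =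
  - (h^-1 * (pos2 (u + h) - pos2 u - 2 * Num.max 0 u * h)).
  rewrite /GRing.scale /= mulr1 [h + u]addrC; move: (pos2 _) (pos2 _) (Num.max _ _) => a b m.
  by field.
rewrite normrN normrM normfV mulrC ltr_pdivrMr ?normr_gt0 //.
apply: le_lt_trans (pos2_taylor _ _) _.
rewrite -real_normK ?num_real // expr2 ltr_pM2r ?normr_gt0 //.
near: h; apply: nbhs_dnbhs; apply/nbhs_ballP; exists eps => //= z.
by rewrite -ball_normE /ball_ /= sub0r normrN.
Unshelve. all: by end_near. Qed.

Variable n : nat.
Local Notation V := 'rV[R]_n.

Lemma max0_continuous (W : set V) (f : V -> R) :
  Ck 0 W f -> Ck 0 W (fun y => Num.max 0 (f y)).
Proof.
move=> fc x Wx.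
have -> : (fun y => Num.max 0 (f y)) = (fun y => 2^-1 * (f y + `|f y|)).
  apply/funext => y; have [f0|f0] := leP (f y) 0.
    by rewrite ler0_norm // subrr mulr0.
  by rewrite gtr0_norm //; field.
apply: (@continuousM R V (fun=> 2^-1)); first exact: cst_continuous.
apply: continuousD; first exact: fc.
by apply: (@continuous_comp V R R f (fun t => `|t|)); [exact: fc|exact: norm_continuous].
Qed.

Lemma pos2_C1 (W : set V) (f : V -> R) : open W -> Ck 1 W f -> Ck 1 W (fun y => pos2 (f y)).
Proof.
move=> Wo fC; have df y : W y -> differentiable f y.
  by move=> Wy; apply: (CkS_differentiable Wo fC).
have dq u : derivable pos2 u 1 by have [] := is_derive_pos2 u.
apply: CkS_intro => [y Wy|i].
  apply: (@differentiable_comp _ _ _ _ f pos2); first exact: df.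
  by apply/derivable1_diffP; exact: dq.
apply: (@Ck_eq _ _ _ _ (fun y => 2 * Num.max 0 (f y) * pd i f y) _ Wo).
  move=> y Wy; rewrite pd_comp_real //; last exact: df.
  by rewrite derive1E; have [_ ->] := is_derive_pos2 (f y).
apply: CkM => //; last exact: fC.2.
apply: CkM => //; first exact: Ck_cst.
by apply: max0_continuous; apply: CkW.
Qed.

(** The norm is the maximum of the coordinates, so for e > 0 this product of one-variable bumps is
    positive exactly on the open ball of radius e about a. *)
Definition bump_rV (a : V) (e : R) (y : V) : R := \prod_i pos2 (e ^+ 2 - (y 0 i - a 0 i) ^+ 2).

Lemma bump_C1 a e : Ck 1 setT (bump_rV a e).
Proof.
apply: Ck_prod => [|i]; first exact: openT.
apply: pos2_C1; first exact: openT.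
apply: CkB; [exact: openT|exact: Ck_cst|].
have H : Ck 1 setT (fun y : V => y 0 i - a 0 i).
  by apply: CkB; [exact: openT|exact: Ck_coord|exact: Ck_cst].
by under [X in Ck _ _ X]funext do rewrite expr2; apply: CkM => //; exact: openT.
Qed.

Lemma bump_ge0 a e y : 0 <= bump_rV a e y.
Proof. by apply: prodr_ge0 => i _; exact: sqr_ge0. Qed.

Lemma bump_gt0 a e y : `|y - a| < e -> 0 < bump_rV a e y.
Proof.
move=> ye; apply: prodr_gt0 => i _; rewrite pos2_gt0 subr_gt0.
have := le_lt_trans (le_coord_norm (y - a) i) ye; rewrite !mxE => H.
by rewrite -[ltLHS]real_normK ?num_real // ltr_sqr ?nnegrE // (le_trans _ (ltW H)).
Qed.

Lemma bump_eq0 a e y : 0 < e -> e <= `|y - a| -> bump_rV a e y = 0.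
Proof.
move=> e0 ye; have [i yi] : exists i, e <= `|y 0 i - a 0 i|.
  apply: contrapT => /forallNP H; move: ye; rewrite leNgt => /negP; apply.
  by apply: norm_rV_lt => // i; rewrite !mxE ltNge; exact/negP/H.
rewrite /bump_rV (bigD1 i) //= pos2_le0 ?mul0r // subr_le0.
by rewrite -[leRHS]real_normK ?num_real // ler_sqr ?nnegrE // ltW.
Qed.

End Bump.

(** * Partition of unity and the global divergence theorem *)

Section Divergence.
Variables (R : realType) (n : nat) (M : ptopologicalType).
Variables (X : smooth_manifold R n M) (Z : set M) (g : M -> 'M[R]_n).
Hypothesis Zc : closed Z.
Local Notation V := 'rV[R]_n.

Definition C1_fun (f : M -> R) := forall c, atlas X c -> Ck 1 (reg Z c) (fun y => f (cinv c y)).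

Definition C1_form (Y : M -> V) :=
  forall c, atlas X c -> forall j, Ck 1 (reg Z c) (fun y => local1 X c Y y 0 j).

Let M_closed (K : set M) : compact K -> open (~` K).
Proof. by move=> Kc; apply: closed_openC; apply: compact_closed => //; exact: manifold_hausdorff X. Qed.

Lemma reg_meet_open c (A : set M) : atlas X c -> open A -> open (c @` (cdom c `&` (A `\` Z))).
Proof.
move=> ca Ao; apply: (chart_image_open ca); rewrite setDE; apply: openI => //.
exact: closed_openC.
Qed.

(** A coordinate bump extended by zero. At a point of Z the data are trivial: having the statement
    for every x lets [choice] select a family indexed by M. *)
Lemma regular_bump x : exists chi : M -> R, exists O K : set M,
  [/\ open O, ~ Z x -> O x, compact K & K `<=` cdom (chart_at X x) `\` Z] /\
  [/\ forall p, 0 <= chi p, forall p, O p -> 0 < chi p, forall p, ~ K p -> chi p = 0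
    & C1_fun chi].
Proof.
have [Zx|Zx] := pselect (Z x).
  exists (fun=> 0), set0, set0; split; split => //; first exact: open0.
    exact: compact0.
  by move=> c ca; exact: Ck_cst.
pose c := chart_at X x.
have ca : atlas X c by exact: chart_at_atlas.
have cx : cdom c x by exact: chart_at_dom.
have ro := reg_open Zc ca; have rcx := reg_in cx Zx.
have [e1 e10 e1P] := open_normP ro rcx.
pose e := e1 / 2; have e0 : 0 < e by rewrite divr_gt0.
have ee1 : e < e1 by rewrite /e; lra.
pose chi p := if `[< (cdom c `\` Z) p >] then bump_rV (c x) e (c p) else 0.
pose L := [set y : V | `|y - c x| <= e].
have Lr y : L y -> reg Z c y by move=> Ly; apply: e1P; exact: le_lt_trans ee1.
have Lc : compact L.
  have bK : compact [set y : V | `|y| <= `|c x| + e].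
    apply: bounded_closed_compact.
      exists (`|c x| + e); split; first exact: num_real.
      by move=> t rt y /= yr; apply: le_trans yr (ltW rt).
    have -> : [set y : V | `|y| <= `|c x| + e] = (fun y : V => `|y|) @^-1` [set t | t <= `|c x| + e] by [].
    apply: closed_comp => [y _|]; first exact: norm_continuous.
    exact: closed_le.
  apply: (subclosed_compact _ bK).
    have -> : L = (fun y : V => `|y - c x|) @^-1` [set t | t <= e] by [].
    apply: closed_comp => [y _|]; last exact: closed_le.
    apply: (@continuous_comp V V R (fun y => y - c x)); last exact: norm_continuous.
    by apply: continuousD; [exact: cvg_id|exact: cst_continuous].
  move=> y Ly /=; rewrite -[y](subrK (c x)) addrC; apply: le_trans (ler_normD _ _) _.
  by rewrite lerD2l.
pose K := cinv c @` L.
have KU : K `<=` cdom c `\` Z by move=> _ [y /Lr/(cinv_reg ca) ry <-].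
have Kc : compact K.
  apply: continuous_compact => //; apply: continuous_in_subspaceT => y; rewrite inE => /Lr[z [cz _] <-].
  by case: (atlas_chart ca) => _ _ _ _; apply; exists z.
have chi0 p : ~ K p -> chi p = 0.
  move=> Kp; rewrite /chi; case: asboolP => // -[cp Zp]; apply: bump_eq0 => //.
  rewrite leNgt; apply/negP => H; apply: Kp; exists (c p); last exact: cinvK ca cp.
  exact: ltW.
pose O := (cdom c `\` Z) `&` c @^-1` [set y | `|y - c x| < e].
exists chi, O, K; split; split => //.
- apply: open_preimage.
  + by rewrite setDE; apply: openI; [exact: cdom_open ca|exact: closed_openC].
  + by move=> z [cz _]; case: (atlas_chart ca) => _ _ _ + _; exact.
  + have -> : [set y | `|y - c x| < e] = ball (c x) e.
      by apply/seteqP; split => y /=; rewrite -ball_normE /ball_ /= distrC.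
    exact: ball_open.
- by move=> _; split => //=; rewrite subrr normr0.
- by move=> p; rewrite /chi; case: asboolP => // _; exact: bump_ge0.
- by move=> p [Up pe]; rewrite /chi; case: asboolP => // _; exact: bump_gt0.
move=> d da; apply: Ck_local => _ [p [dp Zp] <-].
(* In another chart d the function is the bump composed with a transition where c is defined, and
   zero off the compact K. The two open sets cover the regular part of d. *)
have [cp|cp] := pselect (cdom c p).
  pose W := d @` (cdom d `&` (cdom c `\` Z)).
  have Wo : open W by apply: reg_meet_open => //; exact: cdom_open ca.
  exists W; split => //; first by exists p.
  apply: (Ck_eq Wo (f := fun y => bump_rV (c x) e (transition d c y))).
    move=> _ [q [dq [cq Zq]] <-]; rewrite /transition (cinvK da dq) /chi.
    by case: asboolP => // -[].
  apply: (Ck_comp Wo openT _ _ (bump_C1 (c x) e)) => // j.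
  apply: Ck_subset (transition_Ck 1 j da ca) => _ [q [dq [cq Zq]] <-]; by exists q.
pose W := d @` (cdom d `&` (~` K `\` Z)).
have Wo : open W by apply: reg_meet_open => //; exact: M_closed.
exists W; split => //; first by exists p => //; split => //; split => // /KU[].
apply: (Ck_eq Wo (f := fun=> 0)); last exact: Ck_cst.
by move=> _ [q [dq [Kq Zq]] <-]; rewrite (cinvK da dq) chi0.
Qed.

Lemma C1_form_diff1 Y x : C1_form Y -> ~ Z x -> diff1 X Y x.
Proof.
move=> YC Zx j; have ca := chart_at_atlas X x.
apply: (CkS_differentiable (reg_open Zc ca) (YC _ ca j)).
by apply: reg_in => //; exact: chart_at_dom.
Qed.

Lemma C1_form_smooth1 Y : smooth1 X Z Y -> C1_form Y.
Proof. by move=> sY c ca j; exact: sY. Qed.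

Lemma local1Z c (f : M -> R) (Y : M -> V) y j :
  local1 X c (fun p => f p *: Y p) y 0 j = f (cinv c y) * local1 X c Y y 0 j.
Proof. by rewrite /local1 -scalemxAl mxE. Qed.

Lemma C1_formZ f Y : C1_fun f -> C1_form Y -> C1_form (fun p => f p *: Y p).
Proof.
move=> fC YC c ca j; under [X in Ck _ _ X]funext do rewrite local1Z.
by apply: CkM; [exact: reg_open Zc _ ca|exact: fC|exact: YC].
Qed.

(** [sg] may vanish off K, but Y is zero there. On the open set where [sg] is positive the quotient
    is C^1, on the complement of K it is zero, and these open sets cover. *)
Lemma C1_form_divide (sg : M -> R) Y (K : set M) : compact K -> (forall p, ~ K p -> Y p = 0) ->
  (forall p, K p -> 0 < sg p) -> C1_fun sg -> C1_form Y ->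
  C1_form (fun p => (sg p)^-1 *: Y p).
Proof.
move=> Kc Y0 s0 sC YC c ca j; have ro := reg_open Zc ca.
apply: Ck_local => _ [p [cp Zp] <-]; have [Kp|Kp] := pselect (K p).
  pose W := reg Z c `&` (fun y => sg (cinv c y)) @^-1` [set t | 0 < t].
  have Wo : open W.
    apply: open_preimage => [//| |]; last by exact: (@open_gt R 0).
    by move=> y ry; have := CkW ro (sC c ca); apply.
  exists W; split => //.
    by split; [exact: reg_in|rewrite /= (cinvK ca cp); exact: s0].
  under [X in Ck _ _ X]funext do rewrite (local1Z _ (fun p => (sg p)^-1)).
  apply: CkM => //; last by apply: Ck_subset (YC c ca j) => y [].
  apply: CkV => //; first by move=> y [_ /= /gt_eqF->].
  by apply: Ck_subset (sC c ca) => y [].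
pose W := c @` (cdom c `&` (~` K `\` Z)).
have Wo : open W by apply: reg_meet_open => //; exact: M_closed.
exists W; split => //; first by exists p.
apply: (Ck_eq Wo (f := fun=> 0)); last exact: Ck_cst.
move=> _ [q [cq [Kq Zq]] <-]; rewrite (local1Z _ (fun p => (sg p)^-1)) local1E // (cinvK ca cq).
by rewrite Y0 // mul0mx mxE mulr0.
Qed.

Hypothesis gR : riemannian_metric X Z g.
Variable mu : {measure set (borel M) -> \bar R}.
Hypothesis mu_vol : riemannian_volume X Z g mu.

Lemma div_sum (s : seq M) (Y : M -> M -> V) p : ~ Z p -> (forall x, C1_form (Y x)) ->
  div X g (fun q => \sum_(x <- s) Y x q) p = \sum_(x <- s) div X g (Y x) p.
Proof.
move=> Zp YC; pose c := chart_at X p.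
have ca : atlas X c by exact: chart_at_atlas.
have cp : cdom c p by exact: chart_at_dom.
have ro := reg_open Zc ca; have rp := reg_in cp Zp.
(* Additivity of the divergence needs the partial sums to be differentiable, hence the joint
   induction. *)
have H : C1_form (fun q => \sum_(x <- s) Y x q) /\
    div X g (fun q => \sum_(x <- s) Y x q) p = \sum_(x <- s) div X g (Y x) p; last by case: H.
elim: s => [|x s [IHC IH]].
  split.
    move=> d da j; apply: (Ck_eq (reg_open Zc da) (f := fun=> 0)); last exact: Ck_cst.
    by move=> y _; rewrite /local1 big_nil mul0mx mxE.
  rewrite big_nil divE /nabla (_ : nabla1_mx _ _ _ = 0) ?mulmx0 ?mxtrace0 //.
  apply/matrixP => i j; rewrite !mxE /nabla1.
  rewrite (_ : (fun _ => _) = fun=> 0); last first.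
    by apply/funext => y; rewrite /local1 big_nil mul0mx mxE.
  rewrite pd_cst big1 ?subr0 // => l _.
  by rewrite /local1 big_nil mul0mx mxE mulr0.
have E : (fun q => \sum_(x' <- x :: s) Y x' q) = (fun q => Y x q + \sum_(x <- s) Y x q).
  by apply/funext => q; rewrite big_cons.
have EL d : local1 X d (fun q => Y x q + \sum_(x <- s) Y x q) =
    fun y => local1 X d (Y x) y + local1 X d (fun q => \sum_(x <- s) Y x q) y.
  by apply/funext => y; rewrite /local1 mulmxDl.
rewrite E big_cons -IH; split.
  move=> d da j; rewrite EL; under [X in Ck _ _ X]funext do rewrite mxE.
  by apply: CkD; [exact: reg_open Zc _ da|exact: YC|exact: IHC].
by rewrite /div EL div1D //; apply: C1_form_diff1.
Qed.

(** Finitely many bumps cover the support of Y. Dividing by their sum [sg] writes Y as a finite sum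
    of forms [Y' x], each with compact support in one chart, to which [local_divergence] applies. *)
Lemma divergence_theorem Y (K : set M) : compact K -> K `<=` ~` Z ->
  (forall x, ~ K x -> Y x = 0) -> C1_form Y ->
  mu.-integrable (~` Z) (EFin \o (div X g Y : borel M -> R)) /\
  (\int[mu]_(x in ~` Z) (div X g Y x)%:E = 0)%E.
Proof.
move=> Kc KZ Y0 YC.
have [chi /choice[ O /choice[L bP]]] := choice regular_bump.
have [x Kx|s sK Ks] := compact_fset_cover (O := O) Kc.
  by have [[ Oo Ox _ _] _] := bP x; split => //; exact/Ox/KZ.
pose sg p := \sum_(x <- s) chi x p.
have sg0 p : K p -> 0 < sg p.
  move=> /Ks; rewrite -bigcup_seq => -[x /= xs Oxp]; rewrite /sg (big_rem x) //=.
  have [_ [c0 cO _ _]] := bP x; apply: ltr_wpDr; last exact: cO.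
  by apply: sumr_ge0 => z _; have [_ [+ _ _ _]] := bP z; exact.
have sgC : C1_fun sg.
  move=> c ca; apply: Ck_sum => [|x]; first exact: reg_open Zc _ ca.
  by have [_ [_ _ _]] := bP x; exact.
pose Y' x p := chi x p *: ((sg p)^-1 *: Y p).
have Y'C x : C1_form (Y' x).
  apply: C1_formZ; first by have [_ [_ _ _]] := bP x.
  exact: (C1_form_divide Kc Y0 sg0 sgC YC).
have YE : Y = fun p => \sum_(x <- s) Y' x p.
  apply/funext => p; rewrite /Y' -scaler_suml scalerA.
  have [Kp|Kp] := pselect (K p); last by rewrite Y0 // scaler0.
  by rewrite -/(sg p) divff ?scale1r // gt_eqF // sg0.
have Y'L x p : ~ L x p -> Y' x p = 0.
  by move=> Lp; rewrite /Y'; have [_ [_ _ c0 _]] := bP x; rewrite (c0 _ Lp) scale0r.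
have dY' x q : ~ Z q -> diff1 X (Y' x) q by exact: C1_form_diff1.
have Ic x : (\int[mu]_(p in ~` Z) (div X g (Y' x) p)%:E = 0)%E.
  have [[_ _ Lc LU] _] := bP x.
  apply: (local_divergence Zc gR mu_vol (chart_at_atlas X x) Lc LU) => //.
  - exact: Y'L.
  - by move=> j; apply: Y'C; exact: chart_at_atlas.
  - by move=> p; exact: dY'.
have cont T : C1_form T -> forall p, ~ Z p -> {for p, continuous (div X g T)}.
  move=> TC p Zp; have ca := chart_at_atlas X p.
  apply: (div_continuous Zc gR ca (chart_at_dom X p) Zp) => [q Zq|j]; last exact: TC.
  exact: C1_form_diff1.
have supp T (A : set M) : compact A -> (forall p, ~ A p -> T p = 0) ->
    forall p, ~ A p -> div X g T p = 0.
  by move=> Ac T0 p Ap; rewrite divE (nabla_support _ _ Ac T0 Ap) mulmx0 mxtrace0.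
have IY' : forall x, mu.-integrable (~` Z) (EFin \o (div X g (Y' x) : borel M -> R)).
  move=> x; have [[_ _ Lc LU] _] := bP x.
  apply: (compact_support_integrable Zc gR mu_vol Lc).
  - by move=> p /LU[].
  - exact: cont.
  - exact: supp (Y'L x).
split; first by apply: (compact_support_integrable Zc gR mu_vol Kc KZ); [exact: cont|exact: supp Y0].
transitivity (\int[mu]_(p in ~` Z) (\sum_(x <- s) (div X g (Y' x) p)%:E))%E.
  apply: eq_integral => p; rewrite inE => Zp; rewrite sumEFin; congr (_%:E).
  by rewrite {1}YE div_sum.
rewrite (@integral_sum _ (borel M) _ mu (~` Z) _ _ (fun x (p : borel M) => (div X g (Y' x) p)%:E)).
- by rewrite big1.
- by apply: open_borel; exact: closed_openC.
- by move=> x; exact: IY'.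
Qed.

End Divergence.

(** * L^2 sections *)

(** What L^2 theory uses of a bundle, stated once for 1-forms and symmetric 2-tensors. The fibre
    conditions are imposed off Z, where g is a metric. The last field combines completeness of the
    fibres with measurability of the limit; it stands in for a measurable structure on the total
    space. *)
Record hilbert_bundle (R : realType) (M : ptopologicalType) (Z : set M)
    (E : metric_bundle R M) : Prop := HilbertBundle {
  fibre_innerC : forall x (u v : fibre E), ~ Z x -> fibre_inner x u v = fibre_inner x v u;
  fibre_inner_lin : forall x a (u v w : fibre E), ~ Z x ->
    fibre_inner x (a *: u + v) w = a * fibre_inner x u w + fibre_inner x v w;
  fibre_inner_ge0 : forall x (u : fibre E), ~ Z x -> 0 <= fibre_inner x u u;
  fibre_inner_eq0 : forall x (u : fibre E), ~ Z x -> fibre_inner x u u = 0 -> u = 0;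
  measurable_inner : forall u v : M -> fibre E, measurable_section u -> measurable_section v ->
    measurable_fun (~` Z : set (borel M)) (fun x : borel M => fibre_inner (x : M) (u x) (v x));
  measurable_section_lin : forall a (u v : M -> fibre E), measurable_section u ->
    measurable_section v -> measurable_section (fun x => a *: u x + v x);
  measurable_section_indic : forall (A : set (borel M)) (u : M -> fibre E), measurable A ->
    measurable_section u -> measurable_section (fun x => (\1_A x : R) *: u x);
  measurable_section_lim : forall u : nat -> M -> fibre E,
    (forall k, measurable_section (u k)) ->
    (forall x, ~ Z x -> forall e : R, 0 < e -> exists N, forall k l, (N <= k)%N -> (N <= l)%N ->
       fibre_inner x (u k x - u l x) (u k x - u l x) <= e) ->
    exists2 v, measurable_section v & forall x, ~ Z x ->
      (fun k => fibre_inner x (u k x - v x) (u k x - v x)) @ \oo --> (0 : R) }.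

(** Evaluate the polynomial at its vertex t = - b / c. The resulting discriminant inequality gives
    Cauchy-Schwarz, the bound on traces, and the estimate for approximate minimisers in
    [quadratic_minimizer]. *)
Lemma quadratic_ge0 (R : realType) (a b c : R) : 0 <= c ->
  (forall t : R, 0 <= a + 2 * b * t + c * t ^+ 2) -> b ^+ 2 <= a * c.
Proof.
rewrite le_eqVlt => /predU1P[<-|c0] H.
  rewrite mulr0; have [->|b0] := eqVneq b 0; first by rewrite expr0n.
  (* For c = 0 and b nonzero the polynomial is linear and takes the value -1 at this point. *)
  have := H (- (a + 1) / (2 * b)); rewrite mul0r addr0.
  have -> : a + 2 * b * (- (a + 1) / (2 * b)) = - 1 by field.
  by rewrite lerNr oppr0 ler10.
have := H (- b / c).
have -> : a + 2 * b * (- b / c) + c * (- b / c) ^+ 2 = (a * c - b ^+ 2) / c.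
  by field; rewrite gt_eqF.
by rewrite pmulr_lge0 ?invr_gt0 // subr_ge0.
Qed.

Section L2Theory.
Variables (R : realType) (M : ptopologicalType) (Z : set M) (E : metric_bundle R M).
Hypothesis Zc : closed Z.
Hypothesis HE : hilbert_bundle Z E.
Variable mu : {measure set (borel M) -> \bar R}.
Implicit Types (u v w : M -> fibre E).
Local Notation "<| u , v |>_ x" := (fibre_inner x u v) (at level 2, format "<| u ,  v |>_ x").
Local Notation L2 := (L2 Z mu (E := E)).
Local Notation ip := (L2_inner Z mu (E := E)).
Local Notation nm u := (L2_inner Z mu (E := E) u u).

Let mZ : measurable (~` Z : set (borel M)).
Proof. by apply: open_borel; exact: closed_openC. Qed.

Section Fibre.
Variable x : M.
Hypothesis Zx : ~ Z x.

Lemma fibre_inner0l (w : fibre E) : fibre_inner x 0 w = 0.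
Proof.
have := fibre_inner_lin HE 1 0 0 w Zx; rewrite scaler0 addr0 mul1r => /eqP.
by rewrite -subr_eq0 opprD addrA subrr sub0r oppr_eq0 => /eqP.
Qed.

Lemma fibre_innerZl a (u w : fibre E) : fibre_inner x (a *: u) w = a * fibre_inner x u w.
Proof. by have := fibre_inner_lin HE a u 0 w Zx; rewrite addr0 fibre_inner0l addr0. Qed.

Lemma fibre_innerDl (u v w : fibre E) :
  fibre_inner x (u + v) w = fibre_inner x u w + fibre_inner x v w.
Proof. by have := fibre_inner_lin HE 1 u v w Zx; rewrite scale1r mul1r. Qed.

Lemma fibre_innerNl (u w : fibre E) : fibre_inner x (- u) w = - fibre_inner x u w.
Proof. by rewrite -scaleN1r fibre_innerZl mulN1r. Qed.

Lemma fibre_innerDr (u v w : fibre E) :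
  fibre_inner x w (u + v) = fibre_inner x w u + fibre_inner x w v.
Proof. by rewrite ![fibre_inner x w _](fibre_innerC HE) // fibre_innerDl. Qed.

Lemma fibre_innerNr (u w : fibre E) : fibre_inner x w (- u) = - fibre_inner x w u.
Proof. by rewrite ![fibre_inner x w _](fibre_innerC HE) // fibre_innerNl. Qed.

Lemma fibre_innerZr a (u w : fibre E) : fibre_inner x w (a *: u) = a * fibre_inner x w u.
Proof. by rewrite ![fibre_inner x w _](fibre_innerC HE) // fibre_innerZl. Qed.

Lemma fibre_sqD (u v : fibre E) : fibre_inner x (u + v) (u + v) =
  fibre_inner x u u + 2 * fibre_inner x u v + fibre_inner x v v.
Proof.
rewrite fibre_innerDl !fibre_innerDr (fibre_innerC HE v u Zx).
by move: (fibre_inner x u u) (fibre_inner x u v) (fibre_inner x v v) => a b c; ring.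
Qed.

Lemma fibre_sqD_le (u v : fibre E) : fibre_inner x (u + v) (u + v) <=
  2 * fibre_inner x u u + 2 * fibre_inner x v v.
Proof.
have := fibre_inner_ge0 HE (u - v) Zx; rewrite !fibre_sqD.
rewrite fibre_innerNr fibre_innerNl fibre_innerNr.
by move: (fibre_inner x u u) (fibre_inner x u v) (fibre_inner x v v) => a b c; lra.
Qed.

Lemma fibre_inner_le (u v : fibre E) : `|fibre_inner x u v| <=
  fibre_inner x u u + fibre_inner x v v.
Proof.
have := fibre_inner_ge0 HE (u - v) Zx; have := fibre_inner_ge0 HE (u + v) Zx.
have := fibre_inner_ge0 HE u Zx; have := fibre_inner_ge0 HE v Zx; rewrite !fibre_sqD.
rewrite fibre_innerNr fibre_innerNl fibre_innerNr ler_norml.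
move: (fibre_inner x u u) (fibre_inner x u v) (fibre_inner x v v) => a b c.
by move=> ? ? ? ?; apply/andP; split; lra.
Qed.

End Fibre.

Lemma sqnorm_measurable u : measurable_section u ->
  measurable_fun (~` Z : set (borel M)) (fun x : borel M => (fibre_inner (x : M) (u x) (u x))%:E).
Proof. by move=> mu_; apply/measurable_EFinP; exact (measurable_inner HE mu_ mu_). Qed.

Lemma L2_sq_integrable u : L2 u -> mu.-integrable (~` Z : set (borel M))
  (EFin \o (fun x : borel M => fibre_inner (x : M) (u x) (u x))).
Proof.
move=> [mu_ u2]; apply/integrableP; split; first exact: sqnorm_measurable.
apply: le_lt_trans u2; rewrite le_eqVlt; apply/predU1P; left.
apply: eq_integral => x; rewrite inE => Zx /=.
by rewrite ger0_norm // (fibre_inner_ge0 HE).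
Qed.

Lemma L2_integrable u v : L2 u -> L2 v -> mu.-integrable (~` Z : set (borel M))
  (EFin \o (fun x : borel M => fibre_inner (x : M) (u x) (v x))).
Proof.
move=> Lu Lv; have I := integrableD mZ (L2_sq_integrable Lu) (L2_sq_integrable Lv).
apply: (le_integrable _ _ _ I) => //.
  apply/measurable_EFinP; exact (measurable_inner HE (proj1 Lu) (proj1 Lv)).
move=> x Zx /=; rewrite lee_fin; apply: le_trans (fibre_inner_le Zx _ _) (ler_norm _).
Qed.

Lemma sqnormE u : L2 u -> sqnorm Z mu u = (nm u)%:E.
Proof. by move=> Lu; rewrite /L2_inner fineK //; exact: (integrable_fin_num _ (L2_sq_integrable Lu)). Qed.

Lemma integrable_L2 u : measurable_section u -> mu.-integrable (~` Z : set (borel M))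
  (EFin \o (fun x : borel M => fibre_inner (x : M) (u x) (u x))) -> L2 u.
Proof.
move=> mu_ /integrableP[_ u2]; split => //; apply: le_lt_trans u2.
rewrite le_eqVlt; apply/predU1P; left; apply: eq_integral => x; rewrite inE => Zx /=.
by rewrite ger0_norm // (fibre_inner_ge0 HE).
Qed.

Lemma L2_lin a u v : L2 u -> L2 v -> L2 (fun x => a *: u x + v x).
Proof.
move=> Lu Lv; have mw : measurable_section (fun x => a *: u x + v x).
  exact (measurable_section_lin HE a (proj1 Lu) (proj1 Lv)).
apply: integrable_L2 => //.
have I := integrableD mZ (integrableZl mZ (2 * a ^+ 2) (L2_sq_integrable Lu))
  (integrableZl mZ 2 (L2_sq_integrable Lv)).
apply: (le_integrable mZ _ _ I) => [|x Zx /=]; first exact: sqnorm_measurable.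
rewrite lee_fin ger0_norm ?(fibre_inner_ge0 HE) //; apply: le_trans (ler_norm _).
apply: le_trans (fibre_sqD_le Zx _ _) _.
rewrite fibre_innerZl // fibre_innerZr // lerD2r.
by move: (fibre_inner _ _ _) => b; rewrite le_eqVlt; apply/predU1P; left; ring.
Qed.

Lemma L2_sub u v : L2 u -> L2 v -> L2 (fun x => u x - v x).
Proof.
move=> Lu Lv; have := L2_lin (-1) Lv Lu.
by congr L2; apply/funext => x; rewrite scaleN1r addrC.
Qed.

Lemma L2_add u v : L2 u -> L2 v -> L2 (fun x => u x + v x).
Proof.
move=> Lu Lv; have := L2_lin 1 Lu Lv.
by congr L2; apply/funext => x; rewrite scale1r.
Qed.

Lemma L2_innerC u v : ip u v = ip v u.
Proof. by apply: eq_Rintegral => x; rewrite inE => Zx; exact: (fibre_innerC HE). Qed.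

Lemma L2_inner_lin a u v w : L2 u -> L2 v -> L2 w ->
  ip (fun x => a *: u x + v x) w = a * ip u w + ip v w.
Proof.
move=> Lu Lv Lw; rewrite /L2_inner -RintegralZl //; last exact: L2_integrable.
rewrite -RintegralD //; last 2 first.
- exact: (integrableZl mZ a (L2_integrable Lu Lw)).
- exact: L2_integrable.
by apply: eq_Rintegral => x; rewrite inE => Zx; exact: (fibre_inner_lin HE).
Qed.

Lemma L2_innerB u v w : L2 u -> L2 v -> L2 w ->
  ip (fun x => u x - v x) w = ip u w - ip v w.
Proof.
move=> Lu Lv Lw; rewrite (_ : (fun x => u x - v x) = fun x => -1 *: v x + u x).
  by rewrite L2_inner_lin // mulN1r addrC.
by apply/funext => x; rewrite scaleN1r addrC.
Qed.

Lemma L2_inner_ge0 u : 0 <= nm u.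
Proof. by apply: Rintegral_ge0 => x Zx; exact: (fibre_inner_ge0 HE). Qed.

Lemma L2_CS u v : L2 u -> L2 v -> ip u v ^+ 2 <= nm u * nm v.
Proof.
move=> Lu Lv; apply: quadratic_ge0 => [|t]; first exact: L2_inner_ge0.
have Lw := L2_lin t Lv Lu.
have := L2_inner_ge0 (fun x => t *: v x + u x).
rewrite L2_inner_lin // [ip v _]L2_innerC [ip u _]L2_innerC !L2_inner_lin // [ip u v]L2_innerC.
move: (ip v v) (ip v u) (ip u u) => a b c.
by congr (_ <= _); ring.
Qed.

Lemma L2_nmD_le u v : L2 u -> L2 v -> nm (fun x => u x + v x) <= 2 * nm u + 2 * nm v.
Proof.
move=> Lu Lv; have Lw := L2_add Lu Lv.
have I1 := integrableZl mZ 2 (L2_sq_integrable Lu).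
have I2 := integrableZl mZ 2 (L2_sq_integrable Lv).
rewrite /L2_inner -!RintegralZl //; try exact: L2_sq_integrable.
rewrite -RintegralD //; apply: le_Rintegral => //.
- exact: L2_sq_integrable.
- exact: integrableD I1 I2.
- by move=> x Zx; exact: fibre_sqD_le.
Qed.

Lemma L2_nm_eq0 u : L2 u -> nm u = 0 -> {ae mu, forall x : borel M, ~ Z x -> u x = 0}.
Proof.
move=> Lu u0; have := sqnormE Lu; rewrite u0 => I0.
have I : (\int[mu]_(x in ~` Z) `|(fibre_inner (x : M) (u x) (u x))%:E| = 0)%E.
  rewrite -[RHS]I0; apply: eq_integral => x; rewrite inE => Zx /=.
  by rewrite ger0_norm // (fibre_inner_ge0 HE).
move/(ae_eq_integral_abs mu mZ (sqnorm_measurable (proj1 Lu))): I.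
by apply: filterS => x H Zx; apply: (fibre_inner_eq0 HE Zx); have /= [] := H Zx.
Qed.

Lemma L2_inner_ae u u' v : L2 u -> L2 u' -> L2 v ->
  {ae mu, forall x : borel M, ~ Z x -> u x = u' x} -> ip u v = ip u' v.
Proof.
move=> Lu Lu' Lv uu'; rewrite /L2_inner /Rintegral; congr fine; apply: ae_eq_integral => //.
- apply/measurable_EFinP; exact (measurable_inner HE (proj1 Lu) (proj1 Lv)).
- apply/measurable_EFinP; exact (measurable_inner HE (proj1 Lu') (proj1 Lv)).
- by move: uu'; apply: filterS => x H Zx; rewrite H.
Qed.

End L2Theory.

Lemma exp2_small (R : realType) (C e : R) : 0 < e -> exists N, forall k, (N <= k)%N -> C / 2 ^+ k <= e.
Proof.
move=> e0; exists (Num.truncn (`|C| / e)).+1 => k Nk.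
rewrite ler_pdivrMr ?exprn_gt0 // mulrC -ler_pdivrMr //.
apply: (@le_trans _ _ k%:R).
  apply: le_trans (_ : `|C| / e <= _); first by rewrite ler_pM2r ?invr_gt0 // ler_norm.
  by apply: le_trans (ltW (truncnS_gt _)) _; rewrite ler_nat.
by rewrite -natrX ler_nat; apply: ltnW; exact: ltn_expl.
Qed.

(** * Completeness of L^2 *)

Section Completeness.
Variables (R : realType) (M : ptopologicalType) (Z : set M) (E : metric_bundle R M).
Hypothesis Zc : closed Z.
Hypothesis HE : hilbert_bundle Z E.
Variable mu : {measure set (borel M) -> \bar R}.
Local Notation L2 := (L2 Z mu (E := E)).
Local Notation nm u := (L2_inner Z mu (E := E) u u).
Local Notation q x u := (fibre_inner x u u).

Let mZ : measurable (~` Z : set (borel M)).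
Proof. by apply: open_borel; exact: closed_openC. Qed.

Lemma fibre_sqN x (u : fibre E) : ~ Z x -> q x (- u) = q x u.
Proof. by move=> Zx; rewrite (fibre_innerNl HE) // (fibre_innerNr HE) // opprK. Qed.

(** Split off the first step by |a + b|^2 <= 2 |a|^2 + 2 |b|^2. The factor 2 is absorbed in passing
    from 2 / 2^(k+1) to 2 / 2^k, which is the reason for the weights 2^j. *)
Lemma fibre_telescope_le x (w : nat -> fibre E) k m : ~ Z x ->
  q x (w (k + m)%N - w k) <=
  2 / 2 ^+ k * \sum_(k <= j < k + m) 2 ^+ j * q x (w j.+1 - w j).
Proof.
move=> Zx; elim: m k => [|m IH] k.
  by rewrite addn0 subrr (fibre_inner0l HE) // big_geq // mulr0.
have km : (k < k + m.+1)%N by rewrite -addSnnS leq_addr.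
rewrite (big_ltn km).
have -> : w (k + m.+1)%N - w k = (w (k.+1 + m)%N - w k.+1) + (w k.+1 - w k).
  by rewrite addrA subrK addSnnS.
apply: le_trans (fibre_sqD_le HE Zx _ _) _.
have := IH k.+1; rewrite addSnnS exprS.
set p := \sum_(_ <= _ < _) _; set a := q _ _; set b := q _ _.
have e0 : (2 ^+ k : R) != 0 by rewrite expf_neq0.
have -> : 2 / (2 * 2 ^+ k) * p = p / 2 ^+ k by field.
have -> : 2 / 2 ^+ k * (2 ^+ k * b + p) = 2 * b + 2 * (p / 2 ^+ k) by field.
lra.
Qed.

Lemma geometric_le2 m : \sum_(0 <= k < m) (2^-1 : R) ^+ k <= 2.
Proof.
suff -> : \sum_(0 <= k < m) (2^-1 : R) ^+ k = 2 - 2 * 2^-1 ^+ m.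
  by rewrite gerBl mulr_ge0 // exprn_ge0.
elim: m => [|m IH]; first by rewrite big_geq // expr0; ring.
by rewrite big_nat_recr //= IH exprS; field.
Qed.

(* Along a fast subsequence w the function S = sum_j 2^j |w_(j+1) - w_j|^2 is
   integrable; where it is finite |w_l - w_k|^2 <= 2 S / 2^k for k <= l, so the
   pointwise limit exists and no dominated convergence is needed. *)
Lemma L2_complete (u : nat -> M -> fibre E) : (forall k, L2 (u k)) ->
  (forall e : R, 0 < e -> exists N, forall k l, (N <= k)%N -> (N <= l)%N ->
     nm (fun x => u k x - u l x) <= e) ->
  exists2 v, L2 v & forall e : R, 0 < e -> exists N, forall k, (N <= k)%N ->
     nm (fun x => u k x - v x) <= e.
Proof.
move=> Lu uC.
(* With the weight 2^j the j-th step contributes at most 2^j / 4^j = 2^-j to the integral of S, a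
   summable bound. *)
have [N NP] : exists N : nat -> nat, forall j k l, (N j <= k)%N -> (N j <= l)%N ->
    nm (fun x => u k x - u l x) <= (4 ^+ j)^-1.
  have /choice[N NP] : forall j, exists N, forall k l, (N <= k)%N -> (N <= l)%N ->
      nm (fun x => u k x - u l x) <= (4 ^+ j)^-1.
    by move=> j; apply: uC; rewrite invr_gt0 exprn_gt0.
  by exists N.
(* Taking a maximum makes [phi j.+1] exceed [N j] as well, so that the Cauchy bound of index j
   covers two consecutive terms. *)
pose phi j := (\max_(i < j.+1) N i)%N.
have phiN j : (N j <= phi j)%N by exact: (leq_bigmax (F := fun i : 'I_j.+1 => N i) ord_max).
have phiS j : (N j <= phi j.+1)%N.
  by have := leq_bigmax (F := fun i : 'I_j.+2 => N i) (widen_ord (leqnSn _) ord_max).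
pose w j := u (phi j); pose d j x := w j.+1 x - w j x.
have Lw j : L2 (w j) by exact: Lu.
have Ld j : L2 (d j) by exact: L2_sub.
have dN j : nm (d j) <= (4 ^+ j)^-1 by exact: NP.
pose f j (x : borel M) : \bar R := (2 ^+ j * q (x : M) (d j x))%:E.
have f0 j x : (~` Z) x -> (0 <= f j x)%E.
  by move=> Zx; rewrite lee_fin mulr_ge0 ?exprn_ge0 // (fibre_inner_ge0 HE).
have mf j : measurable_fun (~` Z : set (borel M)) (f j).
  apply/measurable_EFinP/measurable_funM => //.
  exact (measurable_inner HE (proj1 (Ld j)) (proj1 (Ld j))).
pose S (x : borel M) : \bar R := (\sum_(0 <= j <oo) f j x)%E.
have mS : measurable_fun (~` Z : set (borel M)) S.
  by apply: ge0_emeasurable_sum => // j x Zx _; exact: f0.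
have S0 x : ~ Z x -> (0 <= S x)%E by move=> Zx; apply: nneseries_ge0 => j _ _; exact: f0.
have IS : (\int[mu]_(x in ~` Z) S x <= 2%:E)%E.
  rewrite integral_nneseries //.
  apply: lime_le.
    by apply: is_cvg_nneseries => j _ _; apply: integral_ge0 => x; exact: f0.
  apply: nearW => m; rewrite (_ : 2%:E = (2 : R)%:E) //.
  apply: (@le_trans _ _ (\sum_(0 <= j < m) (2^-1 ^+ j)%:E)%E); last first.
    by rewrite sumEFin lee_fin geometric_le2.
  apply: lee_sum => j _; rewrite /f; under eq_integral do rewrite EFinM.
  rewrite (integralZl mZ (L2_sq_integrable HE (Ld j))).
  have := sqnormE Zc HE (Ld j); rewrite /sqnorm => ->.
  rewrite -EFinM lee_fin; apply: le_trans (ler_wpM2l (exprn_ge0 _ _) (dN j)) _ => //.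
  by rewrite -exprVn -exprMn (_ : 2 * 4^-1 = 2^-1 :> R) //; field.
pose A := ~` Z `&` [set x | (S x < +oo)%E].
have mA : measurable (A : set (borel M)) by exact: emeasurable_fun_infty_o.
have aeA : {ae mu, forall x : borel M, ~ Z x -> A x}.
  have : mu.-integrable (~` Z : set (borel M)) S.
    apply/integrableP; split => //; apply: le_lt_trans (ltry 2).
    apply: le_trans IS; rewrite le_eqVlt; apply/predU1P; left.
    by apply: eq_integral => x; rewrite inE => Zx; rewrite gee0_abs // S0.
  move=> /(integrable_ae mZ); apply: filterS => x H Zx; split => //=.
  by have := H Zx; rewrite ge0_fin_numE // S0.
(* Off the set A, which has full measure in the regular set, the sequence is replaced by zero. The
   sequence [w'] is then fibrewise Cauchy at every regular point, as [measurable_section_lim]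
   requires. *)
pose C x : R := if x \in A then 2 * fine (S x) else 0.
pose w' j x := (\1_A (x : borel M) : R) *: w j x.
have C0 x : ~ Z x -> 0 <= C x.
  by move=> Zx; rewrite /C; case: ifP => // _; rewrite mulr_ge0 // fine_ge0 // S0.
have wC x k m : ~ Z x -> q x (w' (k + m)%N x - w' k x) <= C x / 2 ^+ k.
  move=> Zx; rewrite /w' /C indicE; case: (boolP (x \in A)) => xA; last first.
    by rewrite !scale0r subrr (fibre_inner0l HE) // mul0r.
  rewrite !scale1r; apply: le_trans (fibre_telescope_le (w ^~ x) k m Zx) _.
  rewrite mulrAC ler_pM2r ?invr_gt0 ?exprn_gt0 // ler_pM2l //.
  rewrite -lee_fin fineK; last by rewrite ge0_fin_numE ?S0 //; move: xA; rewrite inE => -[].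
  rewrite -sumEFin; apply: (@le_trans _ _ (\sum_(0 <= j < k + m) f j x)%E).
    by apply: lee_sum_nneg_natl => // j _ _; exact: f0.
  by apply: nneseries_lim_ge => j _ _; exact: f0.
have wC' x k l : ~ Z x -> (k <= l)%N -> q x (w' l x - w' k x) <= C x / 2 ^+ k.
  by move=> Zx kl; rewrite -(subnKC kl); exact: wC.
have mw' k : measurable_section (w' k) by exact (measurable_section_indic HE mA (proj1 (Lw k))).
have [v mv vP] : exists2 v, measurable_section v & forall x, ~ Z x ->
    (fun k => q x (w' k x - v x)) @ \oo --> (0 : R).
  apply: (measurable_section_lim HE mw') => x Zx e e0.
  have [K KP] := exp2_small (C x) e0; exists K => k l Kk Kl.
  have [kl|/ltnW kl] := leqP k l.
    by rewrite -opprB fibre_sqN //; apply: le_trans (wC' _ _ _ Zx kl) (KP _ Kk).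
  by apply: le_trans (wC' _ _ _ Zx kl) (KP _ Kl).
(* Insert a late term between [w k x] and its limit: |a + b|^2 <= 2 |a|^2 + 2 |b|^2 doubles the
   constant 2 of [wC'] to 4. *)
have vC x k : A x -> q x (w k x - v x) <= 4 / 2 ^+ k * fine (S x).
  move=> [Zx Sx]; have xA : x \in A by rewrite inE.
  apply/ler_addgt0Pr => e e0.
  have /cvgrPdist_lt /(_ (e / 2)) := vP x Zx.
  rewrite divr_gt0 // => /(_ isT)[K _ KP].
  have := KP (maxn K k) (leq_maxl _ _); rewrite /= sub0r normrN ger0_norm ?(fibre_inner_ge0 HE) //.
  have := wC' x k (maxn K k) Zx (leq_maxr _ _); rewrite /C xA.
  rewrite /w' indicE xA !scale1r => H1 H2.
  have -> : w k x - v x = - (w (maxn K k) x - w k x) + (w (maxn K k) x - v x).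
    by rewrite opprB addrA subrK.
  apply: le_trans (fibre_sqD_le HE Zx _ _) _; rewrite fibre_sqN //.
  have -> : 4 / 2 ^+ k * fine (S x) = 2 * (2 * fine (S x) / 2 ^+ k) by ring.
  lra.
have mwv k : measurable_section (fun x => w k x - v x).
  have := measurable_section_lin HE (-1) mv (proj1 (Lw k)).
  by congr measurable_section; apply/funext => x; rewrite scaleN1r addrC.
have sqv k : (sqnorm Z mu (fun x => (w k x - v x)%R) <= (8 / 2 ^+ k)%:E)%E.
  apply: (@le_trans _ _ (\int[mu]_(x in ~` Z) ((4 / 2 ^+ k)%:E * S x))%E); last first.
    rewrite ge0_integralZl //.
    apply: (@le_trans _ _ ((4 / 2 ^+ k)%:E * 2%:E)%E).
      by rewrite lee_wpmul2l // lee_fin divr_ge0 ?exprn_ge0.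
    by rewrite -EFinM lee_fin le_eqVlt; apply/predU1P; left; ring.
  apply: ae_ge0_le_integral => //.
  - by move=> x Zx; rewrite lee_fin (fibre_inner_ge0 HE).
  - exact: sqnorm_measurable.
  - by move=> x Zx; rewrite mule_ge0 ?S0 // lee_fin divr_ge0 ?exprn_ge0.
  - by apply: measurable_funeM.
  - move: aeA; apply: filterS => x H Zx; have Ax := H Zx.
    rewrite -(@fineK _ (S x)) ?ge0_fin_numE ?S0 //; last by case: Ax.
    by rewrite -EFinM lee_fin; exact: vC.
have Lwv k : L2 (fun x => w k x - v x).
  by split; [exact: mwv|exact: le_lt_trans (sqv k) (ltry _)].
have Lv : L2 v.
  have := L2_sub Zc HE (Lw 0%N) (Lwv 0%N); congr (Defs.L2 _ _ _).
  by apply/funext => x; rewrite opprB addrC subrK.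
(* 18 = 2 + 2 * 8: the two errors are 1 / 4^j <= 1 / 2^j and 8 / 2^j, each doubled by
   [L2_nmD_le]. *)
exists v => // e e0; have [j jP] := exp2_small 18 e0.
exists (phi j) => k phik.
rewrite (_ : (fun x => u k x - v x) = (fun x => (u k x - w j x) + (w j x - v x))); last first.
  by apply/funext => x; rewrite addrA subrK.
apply: le_trans (L2_nmD_le Zc HE (L2_sub Zc HE (Lu k) (Lw j)) (Lwv j)) _.
apply: le_trans (jP j (leqnn j)).
have H1 : nm (fun x => u k x - w j x) <= (4 ^+ j)^-1.
  by apply: NP; [exact: leq_trans phik|exact: phiN].
have H2 : nm (fun x => w j x - v x) <= 8 / 2 ^+ j.
  by have := sqv j; rewrite (sqnormE Zc HE) // lee_fin.
have H3 : (4 ^+ j)^-1 <= (2 ^+ j)^-1 :> R.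
  by rewrite lef_pV2 ?posrE ?exprn_gt0 // lerXn2r ?nnegrE //; lra.
have -> : 18 / 2 ^+ j = 2 * (2 ^+ j)^-1 + 2 * (8 / 2 ^+ j) :> R by ring.
lra.
Qed.

End Completeness.

(** * Limits of measurable tensor fields *)

Section MatrixLimits.
Variable R : realType.

Lemma cvg_sum_ord m (f : 'I_m -> nat -> R) (l : 'I_m -> R) :
  (forall i, f i @ \oo --> l i) -> (fun k => \sum_i f i k) @ \oo --> \sum_i l i.
Proof.
by move=> fl; apply: cvg_big => [|i _]; [exact: add_continuous|exact: fl].
Qed.

Lemma cvg_sum_ord0 m (f : 'I_m -> nat -> R) :
  (forall i, f i @ \oo --> (0 : R)) -> (fun k => \sum_i f i k) @ \oo --> (0 : R).
Proof. by move=> /cvg_sum_ord; rewrite big1. Qed.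

Lemma cvg_mx_mul m p r s (P : 'M[R]_(r, m)) (Q : 'M[R]_(p, s)) (u : nat -> 'M[R]_(m, p)) (v : 'M[R]_(m, p)) :
  (forall i j, (fun k => u k i j) @ \oo --> v i j) ->
  forall i j, (fun k => (P *m u k *m Q) i j) @ \oo --> (P *m v *m Q) i j.
Proof.
move=> uv i j; rewrite mxE; under eq_fun do rewrite mxE; apply: cvg_sum_ord => l.
apply: cvgM; last exact: cvg_cst.
rewrite mxE; under eq_fun do rewrite mxE; apply: cvg_sum_ord => l'.
by apply: cvgM; [exact: cvg_cst|exact: uv].
Qed.

(** In the frame given by P and Q the form q is Euclidean, so every entry of [P *m u k *m Q] is a
    real Cauchy sequence; the inverses carry the limit back. *)
Lemma mx_cauchy_cvg m p (P : 'M[R]_m) (Q : 'M[R]_p) (q : 'M[R]_(m, p) -> R)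
    (u : nat -> 'M[R]_(m, p)) : P \in unitmx -> Q \in unitmx ->
  (forall a, q a = \sum_i \sum_j (P *m a *m Q) i j ^+ 2) ->
  (forall e, 0 < e -> exists N, forall k l, (N <= k)%N -> (N <= l)%N -> q (u k - u l) <= e) ->
  exists v : 'M[R]_(m, p), (forall i j, (fun k => u k i j) @ \oo --> v i j) /\
    (fun k => q (u k - v)) @ \oo --> (0 : R).
Proof.
move=> Pu Qu qE uC; pose w k := P *m u k *m Q.
have uE k : u k = invmx P *m w k *m invmx Q.
  by rewrite /w -!mulmxA mulKmx // mulmxV // mulmx1.
have wC i j : cvg ((fun k => w k i j) @ \oo).
  apply/cauchy_cvgP/cauchy_exP => e e0.
  have [|N NP] := uC ((e / 2) ^+ 2); first by rewrite exprn_gt0 // divr_gt0.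
  exists (w N i j); exists N => // k /= Nk; rewrite -ball_normE /ball_ /=.
  have e2 : e / 2 < e by lra.
  apply: le_lt_trans e2; rewrite distrC.
  have e20 : 0 <= e / 2 by rewrite ltW // divr_gt0.
  rewrite -ler_sqr ?nnegrE // real_normK ?num_real //.
  apply: le_trans (NP k N Nk (leqnn N)); rewrite qE mulmxBr mulmxBl.
  have dE : (P *m u k *m Q - P *m u N *m Q) i j = w k i j - w N i j.
    by rewrite [LHS]mxE [X in _ + X]mxE.
  rewrite (bigD1 i) //= (bigD1 j) //= -addrA dE lerDl addr_ge0 //.
    by apply: sumr_ge0 => *; exact: sqr_ge0.
  by apply: sumr_ge0 => *; apply: sumr_ge0 => *; exact: sqr_ge0.
pose z : 'M[R]_(m, p) := \matrix_(i, j) lim ((fun k => w k i j) @ \oo).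
pose v := invmx P *m z *m invmx Q.
have wz i j : (fun k => w k i j) @ \oo --> z i j by rewrite mxE; exact: wC.
have uv i j : (fun k => u k i j) @ \oo --> v i j.
  by under eq_fun do rewrite uE; exact: cvg_mx_mul.
exists v; split => //; under eq_fun do rewrite qE.
apply: cvg_sum_ord0 => i; apply: cvg_sum_ord0 => j.
have uv0 i' j' : (fun k => (u k - v) i' j') @ \oo --> (0 : 'M[R]_(m, p)) i' j'.
  under eq_fun do rewrite 2!mxE.
  rewrite [(0 : 'M[R]_(m, p)) i' j'](_ : _ = v i' j' - v i' j'); last by rewrite subrr mxE.
  by apply: cvgB; [exact: uv|exact: cvg_cst].
have H := @cvg_mx_mul m p m p P Q (fun k => u k - v) 0 uv0 i j.
rewrite mulmx0 mul0mx [(0 : 'M[R]_(m, p)) i j](_ : _ = 0) in H; last by rewrite mxE.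
have H2 := cvgM H H; rewrite mulr0 in H2.
by under eq_fun do rewrite expr2; exact: H2.
Qed.

(** In the application P and Q are frames, which depend on the arbitrary choice of [chart_at X x].
    Measurability is therefore asked of the products, that is, of the chart components. *)
Lemma measurable_mx_lim d (T : measurableType d) (U : set T) m p r s
    (P : T -> 'M[R]_(r, m)) (Q : T -> 'M[R]_(p, s)) (u : nat -> T -> 'M[R]_(m, p)) (v : T -> 'M[R]_(m, p)) :
  (forall k i j, measurable_fun U (fun x => (P x *m u k x *m Q x) i j)) ->
  (forall x, U x -> forall i j, (fun k => u k x i j) @ \oo --> v x i j) ->
  forall i j, measurable_fun U (fun x => (P x *m v x *m Q x) i j).
Proof.
move=> mu uv i j; apply: (@measurable_fun_cvg _ _ _ _ (fun k x => (P x *m u k x *m Q x) i j)) => //.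
by move=> x Ux; apply: cvg_mx_mul; exact: uv.
Qed.

End MatrixLimits.

Section TensorBundles.
Variables (R : realType) (n : nat) (M : ptopologicalType) (X : smooth_manifold R n M).
Variables (Z : set M) (g : M -> 'M[R]_n).
Hypothesis M_compact : compact [set: M].
Hypothesis Zc : closed Z.
Hypothesis gR : riemannian_metric X Z g.
Local Notation V := 'rV[R]_n.

Let gp x : ~ Z x -> posdef (g x). Proof. exact: gR.2. Qed.

Lemma chart_function_measurable c (f : V -> R) : atlas X c -> Ck 0 (reg Z c) f ->
  measurable_fun (cdom c `\` Z : set (borel M)) (fun x : borel M => f (c x)).
Proof.
move=> ca fc; apply: continuous_borel_real => [|x [cx Zx]].
  by rewrite setDE; apply: openI; [exact: cdom_open ca|exact: closed_openC].
apply: (@continuous_comp _ _ _ c f); first by case: (atlas_chart ca) => _ _ _ + _; exact.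
by apply: fc; exact: reg_in.
Qed.

Lemma invmx_metric_measurable c i j : atlas X c ->
  measurable_fun (cdom c `\` Z : set (borel M))
    (fun x : borel M => invmx (local2 X c g (c x)) i j).
Proof.
move=> ca; apply: (chart_function_measurable (f := fun y => invmx (local2 X c g y) i j) ca).
exact: (invmx_metric_Ck (reg_open Zc ca) (metric_Ck gR ca) (metric_posdef gR ca)).
Qed.

Lemma one_forms_hilbert : hilbert_bundle Z (one_forms X Z g).
Proof.
split => /=.
- by move=> x u v Zx; exact: inner1C (gp Zx) _ _.
- by move=> x a u v w Zx; rewrite inner1Dl inner1Zl.
- by move=> x u Zx; exact: inner1_ge0 (gp Zx) _.
- move=> x u Zx; have [Q Qu QE] := posdef_inv_factor (gp Zx); rewrite (inner1_factor _ _ QE) => H.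
  have H0 : u *m Q^T = 0.
    apply/rowP => j; rewrite [RHS]mxE; apply/eqP; rewrite -sqrf_eq0 expr2; apply/eqP.
    have := psumr_eq0P _ H; apply => // i _.
    by rewrite -expr2 sqr_ge0.
  by rewrite -[u](mulmxK (_ : Q^T \in unitmx)) ?unitmx_tr // H0 mul0mx.
- move=> u v mu mv; apply: (measurable_charts (X := X)) => // c ca.
  (* The values of u, v and g at x refer to a frame that varies arbitrarily with x; only chart
     components are measurable, and [congr_inner1] expresses the inner product through them. *)
  apply: (eq_measurable_fun (fun x : borel M => \sum_i \sum_j invmx (local2 X c g (c x)) i j *
      local1 X c u (c x) 0 i * local1 X c v (c x) 0 j)).
    move=> x; rewrite inE => -[cx Zx]; rewrite -/(inner1 _ _ _) local2E // !local1E //.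
    by rewrite congr_inner1 //; [exact: posdef_unit (gp Zx)|exact: frame_unit].
  apply: measurable_sum => i; apply: measurable_sum => j.
  apply: measurable_funM; last exact: mv.
  by apply: measurable_funM; [exact: invmx_metric_measurable|exact: mu].
- move=> a u v mu mv c ca i; rewrite (_ : (fun _ => _) = fun x : borel M =>
    a * local1 X c u (c x) 0 i + local1 X c v (c x) 0 i); last first.
    by apply/funext => x; rewrite /local1 mulmxDl -scalemxAl 2!mxE.
  apply: measurable_funD; last exact: mv.
  by apply: measurable_funM => //; exact: mu.
- move=> A u mA mu c ca i.
  apply: (eq_measurable_fun (fun x : borel M => (\1_A x : R) * local1 X c u (c x) 0 i)).
    by move=> x; rewrite inE => -[cx Zx]; rewrite /local1 -scalemxAl [RHS]mxE (cinvK ca cx).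
  apply: measurable_funM; last exact: mu.
  by apply: measurable_funTS; exact: measurable_indic.
- move=> u mu uC.
  have /choice[v vP] : forall x, exists v : V, ~ Z x ->
      (forall i j, (fun k => u k x i j) @ \oo --> v i j) /\
      (fun k => inner1 (g x) (u k x - v) (u k x - v)) @ \oo --> (0 : R).
    move=> x; have [Zx|Zx] := pselect (Z x); first by exists 0.
    have [Q Qu QE] := posdef_inv_factor (gp Zx).
    have [||a|e e0|v vP] := @mx_cauchy_cvg R 1 n 1%:M Q^T
      (fun a => inner1 (g x) a a) (u ^~ x); rewrite ?unitmx1 ?unitmx_tr //.
    + rewrite (inner1_factor _ _ QE) big_ord1 mul1mx.
      by apply: eq_bigr => i _; rewrite expr2.
    + exact: uC.
    + by exists v.
  exists v => [c ca i|x Zx]; last by case: (vP x Zx).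
  apply: (eq_measurable_fun (fun x : borel M => (1%:M *m v x *m (frame X c (c x))^T) 0 i)).
    by move=> x; rewrite inE => -[cx Zx]; rewrite mul1mx local1E.
  apply: (@measurable_mx_lim _ _ (borel M) _ _ _ _ _ (fun=> 1%:M) (fun x => (frame X c (c x))^T) (u : nat -> borel M -> V)).
    move=> k i' j; rewrite ord1.
    apply: (eq_measurable_fun (fun x : borel M => local1 X c (u k) (c x) 0 j)); last exact: mu.
    by move=> x; rewrite inE => -[cx Zx]; rewrite mul1mx local1E.
  by move=> x [cx Zx]; case: (vP x Zx).
Qed.

Lemma sym2_tensors_hilbert : hilbert_bundle Z (sym2_tensors X Z g).
Proof.
split => /=.
- by move=> x u v Zx; exact: inner2C (gp Zx) _ _.
- by move=> x a u v w Zx; rewrite (inner2Dl (gp Zx)) (inner2Zl (gp Zx)).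
- by move=> x u Zx; exact: inner2_ge0 (gp Zx) _.
- move=> x u Zx; have [Q Qu QE] := posdef_inv_factor (gp Zx).
  rewrite (inner2_factor (gp Zx) _ _ QE) => H.
  have H0 : Q *m u *m Q^T = 0.
    apply/matrixP => i j; rewrite [RHS]mxE; apply/eqP; rewrite -sqrf_eq0 expr2; apply/eqP.
    have Hi := psumr_eq0P _ H; have := psumr_eq0P _ (Hi _ i isT); apply => //.
      by move=> k _; rewrite -expr2 sqr_ge0.
    by move=> k _; apply: sumr_ge0 => l _; rewrite -expr2 sqr_ge0.
  have QTu : Q^T \in unitmx by rewrite unitmx_tr.
  by rewrite -[u](mulKmx Qu) -[Q *m u](mulmxK QTu) H0 mul0mx mulmx0.
- move=> u v [_ mu] [_ mv]; apply: (measurable_charts (X := X)) => // c ca.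
  apply: (eq_measurable_fun (fun x : borel M => \sum_i \sum_j \sum_k \sum_l
      invmx (local2 X c g (c x)) i k * invmx (local2 X c g (c x)) j l *
      local2 X c u (c x) i j * local2 X c v (c x) k l)).
    move=> x; rewrite inE => -[cx Zx].
    rewrite -[LHS]/(inner2 (local2 X c g (c x)) (local2 X c u (c x)) (local2 X c v (c x))).
    by rewrite !local2E // congr_inner2 //; [exact: gp|exact: frame_unit].
  apply: measurable_sum => i; apply: measurable_sum => j.
  apply: measurable_sum => k; apply: measurable_sum => l.
  apply: measurable_funM; last exact: mv.
  apply: measurable_funM; last exact: mu.
  by apply: measurable_funM; exact: invmx_metric_measurable.
- move=> a u v [su mu] [sv mv]; split => [x Zx|c ca i j].
    by rewrite linearD linearZ /= su // sv.
  rewrite (_ : (fun _ => _) = fun x : borel M =>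
    a * local2 X c u (c x) i j + local2 X c v (c x) i j); last first.
    by apply/funext => x; rewrite /local2 mulmxDr mulmxDl -scalemxAr -scalemxAl 2!mxE.
  apply: measurable_funD; last exact: mv.
  by apply: measurable_funM => //; exact: mu.
- move=> A u mA [su mu]; split => [x Zx|c ca i j]; first by rewrite linearZ /= su.
  apply: (eq_measurable_fun (fun x : borel M => (\1_A x : R) * local2 X c u (c x) i j)).
    move=> x; rewrite inE => -[cx Zx].
    by rewrite /local2 -scalemxAr -scalemxAl [RHS]mxE (cinvK ca cx).
  apply: measurable_funM; last exact: mu.
  by apply: measurable_funTS; exact: measurable_indic.
- move=> u mu uC.
  have /choice[v vP] : forall x, exists v : 'M[R]_n, ~ Z x ->
      (forall i j, (fun k => u k x i j) @ \oo --> v i j) /\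
      (fun k => inner2 (g x) (u k x - v) (u k x - v)) @ \oo --> (0 : R).
    move=> x; have [Zx|Zx] := pselect (Z x); first by exists 0.
    have [Q Qu QE] := posdef_inv_factor (gp Zx).
    have [||a|e e0|v vP] := @mx_cauchy_cvg R n n Q Q^T
      (fun a => inner2 (g x) a a) (u ^~ x); rewrite ?unitmx_tr //.
    + rewrite (inner2_factor (gp Zx) _ _ QE).
      by apply: eq_bigr => i _; apply: eq_bigr => j _; rewrite expr2.
    + exact: uC.
    + by exists v.
  exists v => [|x Zx]; last by case: (vP x Zx).
  split=> [x Zx|c ca i j].
    apply/matrixP => i j; rewrite mxE; have [uv _] := vP x Zx.
    have uE : (fun k => u k x j i) = (fun k => u k x i j).
      by apply/funext => k; have [su _] := mu k; rewrite -{1}(su x Zx) mxE.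
    have uji := uv j i; rewrite uE in uji.
    exact: (cvg_unique (@norm_hausdorff _ R) uji (uv i j)).
  apply: (eq_measurable_fun (fun x : borel M => (frame X c (c x) *m v x *m (frame X c (c x))^T) i j)).
    by move=> x; rewrite inE => -[cx Zx]; rewrite local2E.
  apply: (@measurable_mx_lim _ _ (borel M) _ _ _ _ _ (fun x => frame X c (c x))
    (fun x => (frame X c (c x))^T) (u : nat -> borel M -> 'M[R]_n)).
    move=> k i' j'.
    apply: (eq_measurable_fun (fun x : borel M => local2 X c (u k) (c x) i' j')).
      by move=> x; rewrite inE => -[cx Zx]; rewrite local2E.
    by have [_] := mu k; exact.
  by move=> x [cx Zx]; case: (vP x Zx).
Qed.

Variable mu : {measure set (borel M) -> \bar R}.
Hypothesis mu_vol : riemannian_volume X Z g mu.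

(** The squared norm is continuous off Z, by its expression in charts, and has compact support
    there. *)
Lemma test1_L2 phi : test1 (X := X) (Z := Z) (g := g) phi -> L2 Z mu (E := one_forms X Z g) phi.
Proof.
move=> [sp [K [Kc KZ K0]]]; apply: (integrable_L2 one_forms_hilbert).
  move=> c ca i; apply: (chart_function_measurable (f := fun y => local1 X c phi y 0 i) ca).
  exact: (sp c ca i 0%N).
apply: (compact_support_integrable Zc gR mu_vol Kc KZ) => [x Zx|x Kx] /=; last first.
  by rewrite K0 // -(scale0r (0 : V)) inner1Zl mul0r.
have ca := chart_at_atlas X x; have cx := chart_at_dom X x.
set c := chart_at X x in ca cx *; have ro := reg_open Zc ca.
apply: (continuous_chart ca cx).
apply: (continuous_eq ro (reg_in cx Zx) (f := fun y => \sum_i \sum_j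
    invmx (local2 X c g y) i j * local1 X c phi y 0 i * local1 X c phi y 0 j)).
  move=> _ [z [cz Zz] <-] /=; rewrite (cinvK ca cz) -/(inner1 _ _ _) local2E // !local1E //.
  by rewrite congr_inner1 //; [exact: posdef_unit (gp Zz)|exact: frame_unit].
have H : Ck 0 (reg Z c) (fun y => \sum_i \sum_j
    invmx (local2 X c g y) i j * local1 X c phi y 0 i * local1 X c phi y 0 j).
  apply: Ck_sum => // i; apply: Ck_sum => // j; apply: CkM => //; last exact: sp.
  apply: CkM => //; last exact: sp.
  exact: (invmx_metric_Ck ro (metric_Ck gR ca) (metric_posdef gR ca)).
by apply: H; exact: reg_in.
Qed.

Lemma test2_L2 h : test2 (X := X) (Z := Z) (g := g) h -> L2 Z mu (E := sym2_tensors X Z g) h.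
Proof.
move=> [hs sh [K [Kc KZ K0]]]; apply: (integrable_L2 sym2_tensors_hilbert).
  split => // c ca i j.
  apply: (chart_function_measurable (f := fun y => local2 X c h y i j) ca).
  exact: (sh c ca i j 0%N).
apply: (compact_support_integrable Zc gR mu_vol Kc KZ) => [x Zx|x Kx] /=; last first.
  rewrite K0 // /inner2 big1 // => i _; rewrite big1 // => j _.
  by rewrite big1 // => k _; rewrite big1 // => l _; rewrite [X in _ * X]mxE mulr0.
have ca := chart_at_atlas X x; have cx := chart_at_dom X x.
set c := chart_at X x in ca cx *; have ro := reg_open Zc ca.
apply: (continuous_chart ca cx).
pose F y := inner2 (local2 X c g y) (local2 X c h y) (local2 X c h y).
apply: (continuous_eq ro (reg_in cx Zx) (f := F)).
  move=> _ [z [cz Zz] <-] /=; rewrite (cinvK ca cz) /F !local2E //.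
  by rewrite congr_inner2 //; [exact: gp|exact: frame_unit].
have H : Ck 0 (reg Z c) F.
  have GI := invmx_metric_Ck ro (metric_Ck gR ca) (metric_posdef gR ca).
  apply: Ck_sum => // i; apply: Ck_sum => // j; apply: Ck_sum => // k; apply: Ck_sum => // l.
  apply: CkM => //; last exact: sh.
  by apply: CkM => //; [apply: CkM => //; exact: GI|exact: sh].
by apply: H; exact: reg_in.
Qed.

End TensorBundles.

(* [lin a u v] stands for [a u + v]. *)
Lemma quadratic_minimizer (R : realType) (V : Type) (lin : R -> V -> V -> V) (P : set V)
    (B : V -> V -> R) (l : V -> R) (C : R) : P !=set0 ->
  (forall a u v, P u -> P v -> P (lin a u v)) ->
  (forall u v, P u -> P v -> B u v = B v u) ->
  (forall a u v w, P u -> P v -> P w -> B (lin a u v) w = a * B u w + B v w) ->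
  (forall a u v, P u -> P v -> l (lin a u v) = a * l u + l v) ->
  (forall u, P u -> 0 <= B u u) -> 0 <= C -> (forall u, P u -> l u ^+ 2 <= C * B u u) ->
  exists phi : nat -> V, [/\ forall k, P (phi k),
    forall j k, B (lin (-1) (phi k) (phi j)) (lin (-1) (phi k) (phi j)) <=
      2 * (j.+1%:R^-1 + k.+1%:R^-1) &
    forall k w, P w -> (B (phi k) w - l w) ^+ 2 <= k.+1%:R^-1 * B w w].
Proof.
move=> [u0 Pu0] Plin Bsym Blin llin B0 C0 lC.
pose J u := B u u - 2 * l u.
have Jlin t u w : P u -> P w ->
    J (lin t w u) = J u + 2 * (B u w - l w) * t + B w w * t ^+ 2.
  move=> Pu Pw; have Pl := Plin t w u Pw Pu.
  rewrite /J Blin // !(Bsym _ (lin t w u)) // !Blin // llin // (Bsym w u) //.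
  by move: (B w w) (B u w) (B u u) (l w) (l u) => a b c d e; ring.
(* From l^2 <= C B and 4 C B <= (B + C)^2 follows 2 l <= B + C. *)
have Jlb u : P u -> - C <= J u.
  move=> Pu; have := lC u Pu; have := B0 u Pu; rewrite /J.
  move: (B u u) (l u) => b a b0 ab; rewrite leNgt; apply/negP => H.
  have H1 : b + C < 2 * a by lra.
  have : (b + C) ^+ 2 < (2 * a) ^+ 2 by rewrite ltr_sqr ?nnegrE; lra.
  have := sqr_ge0 (b - C); nra.
pose S := [set J u | u in P]; pose m := inf S.
have Slb : has_lbound S by exists (- C) => _ [u Pu <-]; exact: Jlb.
have Sne : S !=set0 by exists (J u0), u0.
have mJ u : P u -> m <= J u by move=> Pu; apply: ge_inf => //; exists u.
have /choice[phi phiP] : forall k : nat, exists u, P u /\ J u < m + k.+1%:R^-1.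
  move=> k; have e0 : 0 < k.+1%:R^-1 :> R by rewrite invr_gt0 ltr0n.
  by have [_ [u Pu <-] Ju] := inf_adherent e0 (conj Sne Slb); exists u.
have Pphi k : P (phi k) by case: (phiP k).
exists phi; split => // [j k|k w Pw].
  set d := lin (-1) (phi k) (phi j); have Pd : P d by exact: Plin.
  (* Parallelogram law: [lin 2^-1 d (phi k)] is the midpoint of the two terms, where J is at least
     its infimum m. *)
  have Bd : B d d = 2 * J (phi j) + 2 * J (phi k) - 4 * J (lin 2^-1 d (phi k)).
    have ld : l d = - l (phi k) + l (phi j) by rewrite llin // mulN1r.
    have Bkd : B (phi k) d = - B (phi k) (phi k) + B (phi j) (phi k).
      by rewrite Bsym // Blin // mulN1r.
    have Bjd : B (phi j) d = - B (phi j) (phi k) + B (phi j) (phi j).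
      by rewrite Bsym // Blin // mulN1r (Bsym (phi k)).
    have Bdd : B d d = - B (phi k) d + B (phi j) d by rewrite {1}/d Blin // mulN1r.
    rewrite (Jlin 2^-1 _ _ (Pphi k) Pd) Bdd Bkd Bjd ld /J.
    move: (B _ _) (B _ _) (B _ _) (l _) (l _) => b11 b12 b22 l1 l2.
    by field.
  have := mJ _ (Plin 2^-1 _ _ Pd (Pphi k)).
  have [_ Hj] := phiP j; have [_ Hk] := phiP k; rewrite Bd.
  move: Hj Hk; move: (J (phi j)) (J (phi k)) (J _) (j.+1%:R^-1) (k.+1%:R^-1) => a b c e f.
  lra.
(* Moving from [phi k] by t w cannot lower J by more than 1 / (k + 1); this is a quadratic
   inequality in t, and its discriminant is the claim. *)
apply: quadratic_ge0 => [|t]; first exact: B0.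
have := mJ _ (Plin t _ _ Pw (Pphi k)); rewrite Jlin //.
have [_ Hk] := phiP k.
move: Hk; move: (J _) (k.+1%:R^-1) (B (phi k) w - l w) (B w w) => a e b c; lra.
Qed.

(** * The decomposition *)

Section Decomposition.
Variables (R : realType) (n : nat) (M : ptopologicalType) (X : smooth_manifold R n M).
Variables (Z : set M) (g : M -> 'M[R]_n).
Hypothesis M_compact : compact [set: M].
Hypothesis Zc : closed Z.
Hypothesis gR : riemannian_metric X Z g.
Variable mu : {measure set (borel M) -> \bar R}.
Hypothesis mu_vol : riemannian_volume X Z g mu.
Local Notation V := 'rV[R]_n.
Local Notation T1 := (one_forms X Z g).
Local Notation S2 := (sym2_tensors X Z g).
Local Notation test1 := (test1 (X := X) (Z := Z) (g := g)).
Local Notation test2 := (test2 (X := X) (Z := Z) (g := g)).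
Local Notation L2_1 := (L2 Z mu (E := T1)).
Local Notation L2_2 := (L2 Z mu (E := S2)).
Local Notation ip1 := (L2_inner Z mu (E := T1)).
Local Notation ip2 := (L2_inner Z mu (E := S2)).
Local Notation nm1 u := (L2_inner Z mu (E := T1) u u).
Local Notation nm2 u := (L2_inner Z mu (E := S2) u u).
Local Notation ds := (delta_star X g).
Local Notation T h := (fun x => trace_shift (g x) (h x)).

Let H1 : hilbert_bundle Z T1 := one_forms_hilbert M_compact Zc gR.
Let H2 : hilbert_bundle Z S2 := sym2_tensors_hilbert M_compact Zc gR.
Let gp x : ~ Z x -> posdef (g x). Proof. exact: gR.2. Qed.
Let mZ : measurable (~` Z : set (borel M)).
Proof. by apply: open_borel; exact: closed_openC. Qed.
Let tL1 phi : test1 phi -> L2_1 phi. Proof. exact: test1_L2 mu_vol _. Qed.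
Let tL2 h : test2 h -> L2_2 h. Proof. exact: test2_L2 mu_vol _. Qed.

Lemma test1_lin a phi psi : test1 phi -> test1 psi -> test1 (fun x => a *: phi x + psi x).
Proof.
move=> [sp [K [Kc KZ K0]]] [sq [L [Lc LZ L0]]]; split.
  have := smooth1_lin Zc a 1 sp sq.
  by congr smooth1; apply/funext => x; rewrite scale1r.
exists (K `|` L); split; first exact: compactU.
  by move=> x [/KZ|/LZ].
by move=> x /not_orP[Kx Lx]; rewrite K0 // L0 // scaler0 addr0.
Qed.

Lemma test2_lin a h s : test2 h -> test2 s -> test2 (fun x => a *: h x + s x).
Proof.
move=> [hs sh [K [Kc KZ K0]]] [ss sS [L [Lc LZ L0]]]; split.
- by move=> x Zx; rewrite linearD linearZ /= hs // ss.
- have := smooth2_lin Zc a 1 sh sS.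
  by congr smooth2; apply/funext => x; rewrite scale1r.
- exists (K `|` L); split; first exact: compactU.
    by move=> x [/KZ|/LZ].
  by move=> x /not_orP[Kx Lx]; rewrite K0 // L0 // scaler0 addr0.
Qed.

Lemma test1_0 : test1 (fun=> 0).
Proof.
split; last by exists set0; split => //; exact: compact0.
move=> c ca i k; apply: (Ck_eq (reg_open Zc ca) (f := fun=> 0)); last exact: Ck_cst.
by move=> y _; rewrite /local1 mul0mx mxE.
Qed.

Lemma nabla_lin a phi psi x : test1 phi -> test1 psi -> ~ Z x ->
  nabla X g (fun x => a *: phi x + psi x) x = a *: nabla X g phi x + nabla X g psi x.
Proof.
move=> [sp _] [sq _] Zx; set c := chart_at X x.
have dp : diff_row (local1 X c phi) (c x) := smooth1_diff1 Zc sp Zx.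
have dq : diff_row (local1 X c psi) (c x) := smooth1_diff1 Zc sq Zx.
have dap : diff_row (fun y => a *: local1 X c phi y) (c x).
  move=> j; under [X in differentiable X _]funext do rewrite mxE.
  by apply: differentiable_mul => //; exact: dp.
rewrite /nabla -/c (_ : local1 X c _ = fun y => a *: local1 X c phi y + local1 X c psi y); last first.
  by apply/funext => y; rewrite /local1 mulmxDl scalemxAl.
rewrite nabla1D // [X in X + _](@nabla1Mf _ _ _ (fun=> a)) //.
by rewrite (_ : \col_i _ = 0) ?mul0mx ?add0r //; apply/colP => i; rewrite !mxE pd_cst.
Qed.

Lemma delta_star_lin a phi psi x : test1 phi -> test1 psi -> ~ Z x ->
  ds (fun x => a *: phi x + psi x) x = a *: ds phi x + ds psi x.
Proof.
move=> tp tq Zx; rewrite !delta_star_nabla nabla_lin //.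
rewrite [(_ + _)^T](linearP _ a) /= scalerA mulrC -scalerA -scalerDr.
by congr (_ *: _); rewrite scalerDr addrACA.
Qed.

Lemma trace_shift_lin x a (u v : 'M[R]_n) :
  trace_shift (g x) (a *: u + v) = a *: trace_shift (g x) u + trace_shift (g x) v.
Proof.
rewrite /trace_shift mulmxDr -scalemxAr mxtraceD mxtraceZ.
move: (\tr _) (\tr _) => s t; apply/matrixP => i j; rewrite !mxE.
move: (u i j) (v i j) (g x i j) => b c d. ring.
Qed.

Lemma trace_shiftC x (u v : 'M[R]_n) : ~ Z x ->
  inner2 (g x) (trace_shift (g x) u) v = inner2 (g x) (trace_shift (g x) v) u.
Proof.
move=> Zx; rewrite !trace_shift_inner //; try exact: gp.
by rewrite (inner2C (gp Zx)) mulrAC.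
Qed.

(** |T v|^2 <= 2 |v|^2 + 2 (t / 2)^2 |g|^2 with |g|^2 = n, and t^2 = <v, g>^2 <= n |v|^2 by
    Cauchy-Schwarz. *)
Lemma trace_shift_sq_le x (v : 'M[R]_n) : ~ Z x ->
  inner2 (g x) (trace_shift (g x) v) (trace_shift (g x) v) <=
  (2 + n%:R ^+ 2 / 2) * inner2 (g x) v v.
Proof.
move=> Zx; set t := \tr (invmx (g x) *m v).
have gg : inner2 (g x) (g x) (g x) = n%:R.
  by rewrite (inner2_G (gp Zx)) mulVmx ?mxtrace1 //; exact: posdef_unit (gp Zx).
have tE : t = inner2 (g x) v (g x) by rewrite (inner2_G (gp Zx)).
have tle : t ^+ 2 <= inner2 (g x) v v * n%:R.
  rewrite tE -gg; apply: quadratic_ge0 => [|s].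
    exact: inner2_ge0 (gp Zx) _.
  have := inner2_ge0 (gp Zx) (v + s *: g x).
  rewrite (inner2Dl (gp Zx)) !(inner2Dr (gp Zx)) !(inner2Zl (gp Zx)) !(inner2Zr (gp Zx)).
  rewrite (inner2C (gp Zx) (g x) v).
  move: (inner2 _ _ _) (inner2 _ _ _) (inner2 _ _ _) => a b c.
  by congr (_ <= _); ring.
have := fibre_sqD_le H2 Zx v (- ((2^-1 * t) *: g x)).
rewrite [fibre_inner _ (- _) _](fibre_innerNl H2 Zx) (fibre_innerNr H2 Zx) opprK.
rewrite (fibre_innerZl H2 Zx) (fibre_innerZr H2 Zx) /= gg => H.
apply: le_trans H _.
have n0 : 0 <= n%:R :> R by exact: ler0n.
move: tle n0; move: (inner2 _ _ _) (n%:R : R) => a m; nra.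
Qed.

Lemma trace_shift_test h : test2 h -> test2 (T h).
Proof. exact: test2_trace_shift. Qed.

Lemma L2_trace_shiftC u v : ip2 (T u) v = ip2 (T v) u.
Proof. by apply: eq_Rintegral => x; rewrite inE => Zx; exact: trace_shiftC. Qed.

Lemma L2_trace_shift_le h : test2 h -> nm2 (T h) <= (2 + n%:R ^+ 2 / 2) * nm2 h.
Proof.
move=> th; have Lh := tL2 th; have LTh := tL2 (trace_shift_test th).
rewrite /L2_inner -RintegralZl //; last exact: (L2_integrable Zc H2 Lh Lh).
apply: le_Rintegral => //.
- exact: (L2_integrable Zc H2 LTh LTh).
- exact: (integrableZl mZ _ (L2_integrable Zc H2 Lh Lh)).
- by move=> x Zx; exact: trace_shift_sq_le.
Qed.

Lemma test1_divergence Y : test1 Y ->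
  mu.-integrable (~` Z) (EFin \o (div X g Y : borel M -> R)) /\
  \int[mu]_(x in ~` Z) div X g Y x = 0.
Proof.
move=> [sY [K [Kc KZ K0]]].
have [iY Y0] := divergence_theorem Zc gR mu_vol Kc KZ K0 (C1_form_smooth1 sY).
by split => //; rewrite /Rintegral Y0.
Qed.

(** Integrate [beta_pointwise]: the divergence of a compactly supported form contributes nothing. *)
Lemma beta_formal_adjoint phi : test1 phi ->
  formal_adjoint Z mu (E := S2) (F := T1) (beta X g) phi (T (ds phi)).
Proof.
move=> tp; have tT := trace_shift_test (test2_delta_star Zc gR tp).
split => // s ts; have [_ ss _] := ts.
have [iY Y0] := test1_divergence (test1_contraction Zc gR 2^-1 tp ss).
rewrite -[RHS]subr0 -[X in _ - X]Y0 /L2_inner -RintegralB //; last first.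
  exact: (L2_integrable Zc H2 (tL2 ts) (tL2 tT)).
by apply: eq_Rintegral => x; rewrite inE => Zx; exact: (beta_pointwise Zc gR ts tp Zx).
Qed.

Variable k : R.
Hypothesis k_lt0 : k < 0.
Hypothesis g_einstein : einstein X Z g k.

Lemma bochner_estimate phi : test1 phi ->
  nm2 (ds phi) - k * nm1 phi <= 2 * ip2 (T (ds phi)) (ds phi).
Proof.
move=> tp; have td := test2_delta_star Zc gR tp; have tT := trace_shift_test td.
have [iY Y0] := test1_divergence (test1_contraction Zc gR 1 tp (smooth2_nabla Zc gR tp.1)).
have I1 := L2_integrable Zc H2 (tL2 td) (tL2 td).
have I2 := L2_integrable Zc H1 (tL1 tp) (tL1 tp).
have I3 := L2_integrable Zc H2 (tL2 tT) (tL2 td).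
rewrite -[leLHS]addr0 -[X in _ + X]Y0 /L2_inner -!RintegralZl // -RintegralB //; last first.
  exact: (integrableZl mZ k I2).
have I4 := integrableB mZ I1 (integrableZl mZ k I2).
rewrite -RintegralD //; apply: le_Rintegral => //.
- exact: (integrableD mZ I4 iY).
- exact: (integrableZl mZ 2 I3).
- by move=> x Zx; exact: (bochner_pointwise Zc gR tp Zx (g_einstein Zx)).
Qed.

Lemma delta_star_bound phi : test1 phi -> nm2 (ds phi) <= 2 * ip2 (T (ds phi)) (ds phi).
Proof.
move=> tp; apply: le_trans (bochner_estimate tp); rewrite lerDl oppr_ge0.
by rewrite mulr_le0_ge0 ?(L2_inner_ge0 H1) // ltW.
Qed.

(** Drop |delta^* phi|^2 from Bochner's estimate and keep - k |phi|^2; the sign of k allows the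
    division. *)
Lemma potential_bound phi : test1 phi -> nm1 phi <= 2 / - k * ip2 (T (ds phi)) (ds phi).
Proof.
move=> tp; have k0 : 0 < - k by rewrite oppr_gt0.
have := bochner_estimate tp; have := L2_inner_ge0 H2 mu (ds phi).
move: (L2_inner _ _ _) (L2_inner _ _ _) (L2_inner _ _ _) => a b c a0 H.
rewrite mulrAC ler_pdivlMr //; lra.
Qed.

Lemma L2_nm_subC (E : metric_bundle R M) (HE : hilbert_bundle Z E) (u v : M -> fibre E) :
  L2_inner Z mu (E := E) (fun x => u x - v x) (fun x => u x - v x) =
  L2_inner Z mu (E := E) (fun x => v x - u x) (fun x => v x - u x).
Proof.
by apply: eq_Rintegral => x; rewrite inE => Zx; rewrite -(fibre_sqN HE) // opprB.
Qed.

Lemma L2_inner_eq (E : metric_bundle R M) (u u' v v' : M -> fibre E) :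
  (forall x, ~ Z x -> u x = u' x) -> (forall x, ~ Z x -> v x = v' x) ->
  L2_inner Z mu (E := E) u v = L2_inner Z mu (E := E) u' v'.
Proof. by move=> uu vv; apply: eq_Rintegral => x; rewrite inE => Zx; rewrite uu // vv. Qed.

Lemma L2_trace_shift_lin a phi psi w : test1 phi -> test1 psi -> L2_2 w ->
  ip2 (T (ds (fun x => a *: phi x + psi x))) w = a * ip2 (T (ds phi)) w + ip2 (T (ds psi)) w.
Proof.
move=> tp tq Lw.
have LT chi : test1 chi -> L2_2 (T (ds chi)).
  by move=> tc; apply/tL2/trace_shift_test/(test2_delta_star Zc gR).
rewrite -(L2_inner_lin Zc H2) //; try exact: LT.
by apply: L2_inner_eq => // x Zx; rewrite delta_star_lin // trace_shift_lin.
Qed.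

Lemma im_min_decomposition h : L2_2 h -> exists eta v,
  min_graph Z mu (E := T1) (F := S2) ds eta v /\
  forall phi, test1 phi -> ip2 v (T (ds phi)) = ip2 h (T (ds phi)).
Proof.
move=> Lh.
have td phi : test1 phi -> test2 (ds phi) by exact: test2_delta_star.
have LT phi : test1 phi -> L2_2 (T (ds phi)) by move=> tp; apply/tL2/trace_shift_test/td.
have Ld phi : test1 phi -> L2_2 (ds phi) by move=> tp; apply/tL2/td.
pose lin (a : R) (u v : M -> V) := fun x => a *: u x + v x.
pose B (phi psi : M -> V) := ip2 (T (ds phi)) (ds psi).
pose l (phi : M -> V) := ip2 (T (ds phi)) h.
have Bsym u v : test1 u -> test1 v -> B u v = B v u by move=> _ _; exact: L2_trace_shiftC.
have Blin a u v w : test1 u -> test1 v -> test1 w -> B (lin a u v) w = a * B u w + B v w.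
  by move=> tu tv tw; apply: L2_trace_shift_lin => //; exact: Ld.
have B0 u : test1 u -> 0 <= B u u.
  move=> tu; have := delta_star_bound tu; have := L2_inner_ge0 H2 mu (ds u).
  by rewrite /B => ? ?; rewrite -(@pmulr_rge0 _ 2) //; apply: le_trans; eassumption.
pose c0 : R := 2 + n%:R ^+ 2 / 2.
have c0_ge0 : 0 <= c0 by rewrite /c0 addr_ge0 // divr_ge0 // sqr_ge0.
(* The constant 2 c0 |h|^2 comes from Cauchy-Schwarz, then [L2_trace_shift_le], then
   [delta_star_bound]. *)
have [|||||phi [tphi dphi Bphi]] := @quadratic_minimizer R (M -> V) lin test1 B l
    (nm2 h * (c0 * 2)) _ (fun a u v tu tv => test1_lin a tu tv) Bsym Blin.
- by exists (fun=> 0); exact: test1_0.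
- by move=> a u v tu tv; apply: L2_trace_shift_lin.
- exact: B0.
- by rewrite mulr_ge0 ?(L2_inner_ge0 H2) // mulr_ge0.
- move=> u tu; rewrite /l (L2_innerC H2).
  apply: le_trans (L2_CS Zc H2 Lh (LT _ tu)) _.
  rewrite -mulrA ler_wpM2l ?(L2_inner_ge0 H2) //.
  apply: le_trans (L2_trace_shift_le (td _ tu)) _; rewrite -mulrA ler_wpM2l //.
  exact: delta_star_bound.
have tdiff j i : test1 (lin (-1) (phi i) (phi j)) by exact: test1_lin.
have linE j i : lin (-1) (phi i) (phi j) = fun x => phi j x - phi i x.
  by apply/funext => x; rewrite /lin scaleN1r addrC.
have small (C e : R) : 0 <= C -> 0 < e -> exists N, forall j i : nat, (N <= j)%N -> (N <= i)%N ->
    C * (2 * (j.+1%:R^-1 + i.+1%:R^-1)) <= e.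
  move=> C_ge0 e0; exists (Num.truncn (4 * C / e)).+1 => j i Nj Ni.
  have N0 : 0 < (Num.truncn (4 * C / e)).+1%:R :> R by rewrite ltr0n.
  have hN : 4 * C / e <= (Num.truncn (4 * C / e)).+1%:R by apply/ltW/truncnS_gt.
  have le_inv (m : nat) : ((Num.truncn (4 * C / e)).+1 <= m)%N ->
      m.+1%:R^-1 <= (Num.truncn (4 * C / e)).+1%:R^-1 :> R.
    by move=> Nm; rewrite lef_pV2 ?posrE ?ltr0n // ler_nat leqW.
  apply: (@le_trans _ _ (4 * C / (Num.truncn (4 * C / e)).+1%:R)); last first.
    by rewrite ler_pdivrMr // [e * _]mulrC -ler_pdivrMr.
  have := le_inv _ Nj; have := le_inv _ Ni.
  move: (_^-1) (_^-1) (_^-1) => a b d ad bd; nra.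
(* The potentials have to converge along with their images, since [min_graph] asks for L^2 limits on
   both sides. *)
have [|eta Leta etaP] := L2_complete Zc H1 (fun j => tL1 (tphi j)).
  move=> e e0; have k0 : 0 < 2 / - k by rewrite divr_gt0 // oppr_gt0.
  have [N NP] := small (2 / - k) e (ltW k0) e0; exists N => j i Nj Ni.
  apply: le_trans (NP j i Nj Ni); rewrite -linE.
  apply: le_trans (potential_bound (tdiff j i)) _; rewrite ler_pM2l //.
  exact: dphi.
have [|v Lv vP] := L2_complete Zc H2 (fun j => Ld _ (tphi j)).
  move=> e e0; have [N NP] := small 2 e (ler0n _ _) e0; exists N => j i Nj Ni.
  apply: le_trans (NP j i Nj Ni).
  rewrite (@L2_inner_eq S2 _ (ds (lin (-1) (phi i) (phi j))) _ (ds (lin (-1) (phi i) (phi j)))).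
  - by apply: le_trans (delta_star_bound (tdiff j i)) _; rewrite ler_pM2l //; exact: dphi.
  - by move=> x Zx; rewrite delta_star_lin // scaleN1r addrC.
  - by move=> x Zx; rewrite delta_star_lin // scaleN1r addrC.
exists eta, v; split.
  split => // e e0; have e2 : 0 < e / 2 by rewrite divr_gt0.
  have e2e : e / 2 < e by lra.
  have [N1 N1P] := etaP _ e2; have [N2 N2P] := vP _ e2.
  pose N := maxn N1 N2; exists (phi N); split; first exact: tphi.
    rewrite (sqnormE Zc H1); last exact: (L2_sub Zc H1 Leta (tL1 (tphi N))).
    by rewrite lte_fin (L2_nm_subC H1); apply: le_lt_trans (N1P N (leq_maxl _ _)) e2e.
  rewrite (sqnormE Zc H2); last exact: (L2_sub Zc H2 Lv (Ld _ (tphi N))).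
  by rewrite lte_fin (L2_nm_subC H2); apply: le_lt_trans (N2P N (leq_maxr _ _)) e2e.
move=> psi tpsi; apply/eqP; rewrite -subr_eq0 -sqrf_eq0 eq_le sqr_ge0 andbT.
apply/ler_addgt0Pr => e e0; rewrite add0r.
(* Adding 1 keeps the divisor positive. With [e / (4 * c)] the squared error of replacing v by
   delta^* phi_N in the pairing is at most e / 4. *)
pose c := nm2 (T (ds psi)) + 1.
have c_gt0 : 0 < c by rewrite ltr_wpDl ?(L2_inner_ge0 H2).
have [|N1 N1P] := vP (e / (4 * c)); first by rewrite divr_gt0 // mulr_gt0.
pose b := B psi psi; have b0 : 0 <= b by exact: B0.
have [N2 N2P] := small b e b0 e0.
pose N := maxn N1 N2.
have D1 := L2_CS Zc H2 (L2_sub Zc H2 (Ld _ (tphi N)) Lv) (LT _ tpsi).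
have D2 := Bphi N psi tpsi.
rewrite (L2_innerB Zc H2) // in D1; try by [exact: Ld|exact: LT].
have D3 := N1P N (leq_maxl _ _); have D4 := N2P N N (leq_maxr _ _) (leq_maxr _ _).
have BE : B (phi N) psi = ip2 (ds (phi N)) (T (ds psi)).
  by rewrite /B L2_trace_shiftC (L2_innerC H2).
rewrite BE /l [ip2 _ h](L2_innerC H2) in D2.
have D5 : nm2 (fun x => ds (phi N) x - v x) * nm2 (T (ds psi)) <= e / 4.
  apply: (@le_trans _ _ (e / (4 * c) * c)).
    by apply: ler_pM; rewrite ?(L2_inner_ge0 H2) // /c lerDl.
  by rewrite le_eqVlt; apply/predU1P; left; field; rewrite gt_eqF.
have D6 := le_trans D1 D5; move: D2 D4 D6 b0; rewrite -/(B psi psi) -/b.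
move: (ip2 _ _) (ip2 _ _) (ip2 _ _) (N.+1%:R^-1) (b) => vv hh a r b' D2 D4 D6 b0'.
(* (vv - hh)^2 <= 2 (a - vv)^2 + 2 (a - hh)^2, and both squares are at most e / 4. *)
have H : 0 <= (vv + hh - 2 * a) ^+ 2 := sqr_ge0 _.
have D7 : (a - hh) ^+ 2 <= e / 4 by apply: le_trans D2 _; lra.
suff -> : (vv - hh) ^+ 2 =
    2 * (a - vv) ^+ 2 + 2 * (a - hh) ^+ 2 - (vv + hh - 2 * a) ^+ 2 by lra.
by ring.
Qed.

Lemma im_min_orthogonal_eq0 d : L2_2 d ->
  (forall e : R, 0 < e -> exists2 s, test1 s & nm2 (fun x => d x - ds s x) <= e) ->
  (forall phi, test1 phi -> ip2 d (T (ds phi)) = 0) -> nm2 d = 0.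
Proof.
move=> Ld dapp d0; apply/eqP; rewrite eq_le (L2_inner_ge0 H2) andbT.
pose c0 : R := 2 + n%:R ^+ 2 / 2.
have c0_ge0 : 0 <= c0 by rewrite /c0 addr_ge0 // divr_ge0 // sqr_ge0.
apply/ler_addgt0Pr => e e0; rewrite add0r.
(* Let r = |d - delta^* s|^2 and a = |delta^* s|^2. Orthogonality gives <T delta^* s, delta^* s>^2
   <= c0 r a, hence a <= 4 c0 r and |d|^2 <= 2 r + 2 a <= (2 + 8 c0) r. *)
have [|s ts sd] := dapp (e / (2 + 8 * c0)); first by rewrite divr_gt0 //; lra.
have tds := test2_delta_star Zc gR ts; have Lds := tL2 tds.
have LT := tL2 (trace_shift_test tds).
have dE : (fun x => d x) = (fun x => (d x - ds s x) + ds s x).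
  by apply/funext => x; rewrite subrK.
have N1 := L2_nmD_le Zc H2 (L2_sub Zc H2 Ld Lds) Lds; rewrite -dE in N1.
have N2 := delta_star_bound ts.
have N3 := L2_CS Zc H2 (L2_sub Zc H2 Lds Ld) LT.
rewrite (L2_innerB Zc H2) // (d0 _ ts) subr0 -(L2_nm_subC H2) [ip2 (ds s) _](L2_innerC H2) in N3.
have N4 := L2_trace_shift_le tds; rewrite -/c0 in N4.
have N5 := L2_inner_ge0 H2 mu (ds s).
have N6 := L2_inner_ge0 H2 mu (fun x => d x - ds s x).
rewrite ler_pdivlMr in sd; last lra.
move: N1 N2 N3 N4 N5 N6 sd; move: (nm2 d) (nm2 (ds s)) (nm2 (fun x => d x - ds s x)).
move: (ip2 _ (ds s)) (nm2 (T (ds s))) => b t D a r N1 N2 N3 N4 N5 N6 sd.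
have N7 : b ^+ 2 <= r * (c0 * a) by apply: le_trans N3 _; rewrite ler_wpM2l.
have N8 : a <= 4 * r * c0.
  have [->|a0] := eqVneq a 0; first by rewrite !mulr_ge0.
  have a_gt0 : 0 < a by rewrite lt_neqAle eq_sym a0.
  have N9 : a ^+ 2 <= (2 * b) ^+ 2 by rewrite ler_sqr ?nnegrE //; lra.
  rewrite -(ler_pM2r a_gt0) -expr2; apply: le_trans N9 _; rewrite exprMn; lra.
lra.
Qed.

(** [formal_adjoint] is a relation and [max_graph] quantifies over all its values. Two values differ
    by a test section; testing both against that difference shows that its norm is zero. *)
Lemma formal_adjoint_unique phi psi a : test1 phi ->
  formal_adjoint Z mu (E := S2) (F := T1) (beta X g) phi psi -> L2_2 a ->
  ip2 a psi = ip2 a (T (ds phi)).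
Proof.
move=> tp [tpsi psiP] La; have [tT TP] := beta_formal_adjoint tp.
have Lp := tL2 tpsi; have LT := tL2 tT.
pose w x := psi x - T (ds phi) x.
have tw : test2 w.
  have := test2_lin (-1) tT tpsi.
  by congr test2; apply/funext => x; rewrite scaleN1r addrC.
have Lw : L2_2 w by exact: tL2.
have w0 : nm2 w = 0.
  rewrite {1}/w (L2_innerB Zc H2) // ![ip2 _ w](L2_innerC H2) -(psiP w tw) -(TP w tw).
  by rewrite subrr.
have := L2_CS Zc H2 Lw La; rewrite w0 mul0r => H.
have : ip2 w a = 0 by apply/eqP; rewrite -sqrf_eq0 eq_le H sqr_ge0.
rewrite /w (L2_innerB Zc H2) // ![ip2 _ a](L2_innerC H2) => /eqP.
by rewrite subr_eq0 => /eqP.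
Qed.

Lemma ip1_0 phi : test1 phi -> ip1 (fun=> 0) phi = 0.
Proof.
move=> tp; have Lp := tL1 tp; rewrite -(subrr (ip1 phi phi)) -(L2_innerB Zc H1) //.
by congr (L2_inner _ _ _ _); apply/funext => x; rewrite subrr.
Qed.

Lemma ker_max_beta a : L2_2 a -> (forall phi, test1 phi -> ip2 a (T (ds phi)) = 0) ->
  ker_max Z mu (E := S2) (F := T1) (beta X g) a.
Proof.
move=> La aP; split => //; first exact: (tL1 test1_0).
by move=> phi psi tp fp; rewrite (formal_adjoint_unique tp fp La) aP // ip1_0.
Qed.

Lemma min_graph_approx eta v : min_graph Z mu (E := T1) (F := S2) ds eta v ->
  forall e : R, 0 < e -> exists2 s, test1 s & nm2 (fun x => v x - ds s x) <= e.
Proof.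
move=> [_ Lv vP] e /vP[s [ts _ sv]]; exists s => //.
have Ls := tL2 (test2_delta_star Zc gR ts).
by move: sv; rewrite (sqnormE Zc H2 (L2_sub Zc H2 Lv Ls)) lte_fin => /ltW.
Qed.

Theorem ker_beta_im_delta_star_direct_sum :
  L2_direct_sum Z mu (E := S2) (ker_max Z mu (E := S2) (F := T1) (beta X g))
    (im_min Z mu (E := T1) (F := S2) ds).
Proof.
split; [by move=> u []|by move=> v [eta []]|move=> h Lh].
have [eta [v [vmin vT]]] := im_min_decomposition Lh.
have [_ Lv _] := vmin.
pose a x := h x - v x.
have La : L2_2 a := L2_sub Zc H2 Lh Lv.
have LT phi : test1 phi -> L2_2 (T (ds phi)).
  by move=> tp; apply/tL2/trace_shift_test/(test2_delta_star Zc gR).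
have aT phi : test1 phi -> ip2 a (T (ds phi)) = 0.
  by move=> tp; rewrite /a (L2_innerB Zc H2) ?vT ?subrr //; exact: LT.
exists a, v; split.
- exact: ker_max_beta.
- by exists eta.
- by apply: aeW => x _; rewrite /a subrK.
move=> a' b' [La' _ a'P] [eta' b'min] hE; have [_ Lb' _] := b'min.
(* d is a limit of delta^* of test forms and, being equal to a - a' almost everywhere, is orthogonal
   to every T delta^* phi; hence it vanishes by [im_min_orthogonal_eq0]. *)
pose d x := b' x - v x.
have Ld : L2_2 d := L2_sub Zc H2 Lb' Lv.
have daa : {ae mu, forall x : borel M, ~ Z x -> d x = a x - a' x}.
  move: hE; apply: filterS => x hx Zx; rewrite /d /a hx //.
  by rewrite addrAC [a' x + b' x]addrC addrK.
have dT phi : test1 phi -> ip2 d (T (ds phi)) = 0.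
  move=> tp; rewrite (L2_inner_ae Zc H2 Ld (L2_sub Zc H2 La La') (LT _ tp) daa).
  rewrite (L2_innerB Zc H2) //; last exact: LT.
  by rewrite (a'P _ _ tp (beta_formal_adjoint tp)) aT // sub0r ip1_0 // oppr0.
have dapp e : 0 < e -> exists2 s, test1 s & nm2 (fun x => d x - ds s x) <= e.
  (* Two approximations with error e / 4 each; [L2_nmD_le] doubles both, and the sum is e. *)
  move=> e0; have e4 : 0 < e / 4 by rewrite divr_gt0.
  have [s1 t1 s1P] := min_graph_approx b'min e4; have [s2 t2 s2P] := min_graph_approx vmin e4.
  exists (fun x => -1 *: s2 x + s1 x); first exact: test1_lin.
  have L1 := tL2 (test2_delta_star Zc gR t1); have L2' := tL2 (test2_delta_star Zc gR t2).
  pose w x := (b' x - ds s1 x) + (ds s2 x - v x).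
  have wE x : ~ Z x -> d x - ds (fun x => -1 *: s2 x + s1 x) x = w x.
    move=> Zx; rewrite delta_star_lin // scaleN1r /w /d opprD opprK.
    by rewrite addrACA [- v x + _]addrC addrACA [X in _ + X]addrC addrACA.
  rewrite (L2_inner_eq wE wE).
  have := L2_nmD_le Zc H2 (L2_sub Zc H2 Lb' L1) (L2_sub Zc H2 L2' Lv).
  rewrite -(L2_nm_subC H2 v) -/w; move: s1P s2P.
  move: (nm2 _) (nm2 _) (nm2 _) => p q r; lra.
have d_ae := L2_nm_eq0 Zc H2 Ld (im_min_orthogonal_eq0 Ld dapp dT).
have b'v : ae_eq_sections Z mu (E := S2) b' v.
  by move: d_ae; apply: filterS => x dx Zx; apply/eqP; rewrite -subr_eq0; apply/eqP; exact: dx.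
split => //; move: b'v hE; apply: filterS2 => x bx hx Zx.
by rewrite /a hx // -bx // addrK.
Qed.

End Decomposition.

Lemma singular_set_closed (R : realType) (n : nat) (M : ptopologicalType)
    (X : smooth_manifold R n M) (p : nat) (S : 'I_p -> set M) :
  (forall i, codim2_submanifold X (S i)) -> closed (singular_set S).
Proof.
move=> Sc; have -> : singular_set S = \bigcup_(i in [set: 'I_p]) S i.
  by apply/seteqP; split => [x [i Six]|x [i _ Six]]; exists i.
by apply: closed_bigcup => [|i _]; [exact: finite_finset|case: (Sc i)].
Qed.

Theorem mainTheorem4 (R : realType) (n : nat) (n_ge3 : (3 <= n)%N)
    (M : ptopologicalType) (X : smooth_manifold R n M)
    (M_compact : compact [set: M])
    (p : nat) (S : 'I_p -> set M) (alpha : 'I_p -> R)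
    (g : M -> 'M[R]_n) (gS : 'I_p -> M -> 'M[R]_n)
    (M_cone : cone_manifold X S alpha g gS)
    (k : R) (k_lt0 : k < 0) (g_einstein : einstein X (singular_set S) g k)
    (mu : {measure set (borel M) -> \bar R})
    (mu_vol : riemannian_volume X (singular_set S) g mu) :
  let Sigma := singular_set S in
  let T1 := one_forms X Sigma g in
  let S2 := sym2_tensors X Sigma g in
  L2_direct_sum Sigma mu (E := S2)
    (ker_max Sigma mu (E := S2) (F := T1) (beta X g))
    (im_min Sigma mu (E := T1) (F := S2) (delta_star X g)).
Proof.
apply: ker_beta_im_delta_star_direct_sum mu_vol k k_lt0 g_einstein => //.
  exact: singular_set_closed (stratum_submanifold M_cone).
exact: regular_metric M_cone.
Qed.
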